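(* There are universal constants $0<c\le C<\infty$ such that for every $d\ge1$, every compact convex set $T\subset\mathbb{R}^d$ containing the origin and every $\sigma>0$, $$c\,A\le w(T)\le C\,A\qquad\text{and}\qquad c\,B\le w(T)\le C\,B,$$ where $$A=\sigma\log W\Big(\frac{T}{\sigma\sqrt{2\pi}}\Big)+\int_\sigma^\infty\mathbb{E}\|\Pi_{T/\nu}(g)\|_2^2\,d\nu,\qquad B=\sigma\log W\Big(\frac{T}{\sigma\sqrt{2\pi}}\Big)+\int_\sigma^\infty\frac{r(\nu)^2}{\nu^2}\,d\nu .$$
   Context: $g\sim N(0,I_d)$; $w(S)=\mathbb{E}\sup_{x\in S}\langle x,g\rangle$ is the Gaussian width; $B_2^d$ is the closed Euclidean unit ball; $\Pi_S(x)=\operatorname*{arg\,min}_{t\in S}\|x-t\|_2^2$ for nonempty closed convex $S$. For $\nu>0$, $r(\nu)=\operatorname*{arg\,max}_{r\ge0}\{w(T\cap rB_2^d)-r^2/(2\nu)\}$ (exists and is unique). For nonempty compact convex $K\subset\mathbb{R}^d$, the intrinsic volumes $V_0(K),\dots,V_d(K)$ are defined by $\operatorname{Vol}_d(K+\rho B_2^d)=\sum_{i=0}^d\kappa_{d-i}V_i(K)\rho^{d-i}$ for all $\rho>0$, with $\kappa_j=\operatorname{Vol}_j(B_2^j)$, and the Wills functional is $W(K)=\sum_{j=0}^dV_j(K)$. *)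

(* Defs.v *)
From HB Require Import structures.
From mathcomp Require Import all_boot all_order all_algebra.
From mathcomp Require Import all_classical all_reals all_analysis.
Set Implicit Arguments.
Unset Strict Implicit.
Unset Printing Implicit Defensive.
Import Order.TTheory GRing.Theory Num.Theory.
Import numFieldNormedType.Exports.
Local Open Scope classical_set_scope.
Local Open Scope ring_scope.

Definition consT (T : Type) (n : nat) (p : T * n.-tuple T) : n.+1.-tuple T :=
  [tuple of p.1 :: p.2].

Section tuple_measure.
Local Open Scope ereal_scope.
Context d (T : measurableType d) (R : realType).

Lemma measurable_consT n : measurable_fun [set: T * n.-tuple T] (@consT T n).
Proof. exact: measurable_cons. Qed.

HB.instance Definition _ n :=
  isMeasurableFun.Build _ _ _ _ (@consT T n) (@measurable_consT n).

Section cons.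
Variables (mu : {sigma_finite_measure set T -> \bar R}) (n : nat).
Variable nu : {sigma_finite_measure set (n.-tuple T) -> \bar R}.

Definition cons_measure : set (n.+1.-tuple T) -> \bar R :=
  pushforward (mu \x nu) (@consT T n).

Let cons_measure0 : cons_measure set0 = 0.
Proof. by rewrite /cons_measure /pushforward preimage_set0 measure0. Qed.

Let cons_measure_ge0 A : 0 <= cons_measure A.
Proof. exact: measure_ge0. Qed.

Let cons_measure_additive : semi_sigma_additive cons_measure.
Proof.
move=> F mF tF mUF; rewrite /cons_measure /pushforward preimage_bigcup.
apply: measure_semi_sigma_additive.
- by move=> k; rewrite -[X in measurable X]setTI; exact: measurable_consT.
- apply/trivIsetP => /= i j _ _ ij; rewrite -preimage_setI.
  by move/trivIsetP : tF => /(_ _ _ _ _ ij) ->//; rewrite preimage_set0.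
- by rewrite -preimage_bigcup -[X in measurable X]setTI; exact: measurable_consT.
Qed.

HB.instance Definition _ := isMeasure.Build _ _ _ cons_measure
  cons_measure0 cons_measure_ge0 cons_measure_additive.

Let cons_measure_sigma_finite : sigma_finite setT cons_measure.
Proof.
have /sigma_finiteP[F [FT ndF Foo]] := sigma_finiteT mu.
have /sigma_finiteP[G [GT ndG Goo]] := sigma_finiteT nu.
pose un (t : n.+1.-tuple T) := (thead t, [tuple of behead t]).
have unK : cancel (@consT T n) un.
  by move=> [x t]; congr pair; exact/val_inj.
have mun : measurable_fun setT un.
  by apply/measurable_fun_pair; [exact: measurable_tnth|exact: measurable_behead].
exists (fun k => un @^-1` (F k `*` G k)).
  rewrite -preimage_bigcup -[LHS](preimage_setT un); congr (_ @^-1` _).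
  rewrite -setXTT FT GT predeqE => -[x y]; split.
    move=> [/= [k _ Fx] [l _ Gy]]; exists (maxn k l) => //; split.
    - by move: x Fx; exact/subsetPset/ndF/leq_maxl.
    - by move: y Gy; exact/subsetPset/ndG/leq_maxr.
  by move=> [k _ []/= ? ?]; split; exists k.
move=> k; have [mF Fk] := Foo k; have [mG Gk] := Goo k; split.
  by rewrite -[X in measurable X]setTI; apply: mun => //; exact: measurableX.
rewrite /cons_measure /pushforward -comp_preimage.
rewrite (_ : un \o _ = id); last by apply/funext => x; exact: unK.
by rewrite preimage_id product_measure1E// lte_mul_pinfty// ge0_fin_numE.
Qed.

HB.instance Definition _ := Measure_isSigmaFinite.Build _ _ _ cons_measure
  cons_measure_sigma_finite.

End cons.

Fixpoint tuple_measure (mu : {sigma_finite_measure set T -> \bar R}) (n : nat) :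
    {sigma_finite_measure set (n.-tuple T) -> \bar R} :=
  match n with
  | 0 => dirac [tuple]
  | m.+1 => cons_measure mu (tuple_measure mu m)
  end.

End tuple_measure.

Section gaussian.
Variable R : realType.

Definition gauss_measure (d : nat) : set (d.-tuple (measurableTypeR R)) -> \bar R :=
  tuple_measure (normal_prob (0 : R) 1) d.

HB.instance Definition _ d := Measure.on (@gauss_measure d).

Let gauss_measure_setT d : @gauss_measure d setT = 1%E.
Proof.
rewrite /gauss_measure; elim: d => [|d IH] /=; first by rewrite diracT.
rewrite /cons_measure /pushforward preimage_setT -setXTT product_measure1E//.
rewrite [X in (_ * X)%E]IH mule1.
exact: (probability_setT (normal_prob (0 : R) 1)).
Qed.

HB.instance Definition _ d :=
  Measure_isProbability.Build _ _ _ (@gauss_measure d) (@gauss_measure_setT d).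

End gaussian.

Section euclidean.
Variables (R : realType) (d : nat).
Implicit Types (S K : set 'rV[R]_d) (x y : 'rV[R]_d).

Definition dot x y : R := \sum_(i < d) x ord0 i * y ord0 i.

(* the norm [`|x|] of the library on ['rV[R]_d] is the sup norm *)
Definition norm2 x : R := Num.sqrt (dot x x).

Definition ball2 : set 'rV[R]_d := [set x | norm2 x <= 1].

Definition scale_set (a : R) S : set 'rV[R]_d := [set a *: x | x in S].

Definition minkowski_sum S K : set 'rV[R]_d := [set x + y | x in S & y in K].

(* Under [gauss_measure d] this is a standard Gaussian vector g ~ N(0, I_d); it
   also transports the product Lebesgue measure on tuples to ['rV[R]_d]. *)
Definition vec_of_tuple (t : d.-tuple (measurableTypeR R)) : 'rV[R]_d :=
  \row_i tnth t i.

Definition vol S : \bar R :=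
  tuple_measure (@lebesgue_measure R) d (vec_of_tuple @^-1` S).

Definition Egauss (f : 'rV[R]_d -> R) : \bar R :=
  'E_(@gauss_measure R d)[f \o vec_of_tuple].

Definition gaussian_width S : \bar R :=
  Egauss (fun g => sup [set dot x g | x in S]).

(* [xget] selects the minimizer, which exists and is unique when S is nonempty,
   closed and convex; same device for the two definite descriptions below. *)
Definition proj S x : 'rV[R]_d :=
  xget 0 [set t | S t /\
    forall s, S s -> norm2 (x - t) ^+ 2 <= norm2 (x - s) ^+ 2].

Definition localized_radius S (nu : R) : R :=
  let obj r := (gaussian_width (S `&` scale_set r ball2)
                 - (r ^+ 2 / (2 * nu))%:E)%E in
  xget 0 [set r | 0 <= r /\ forall s, 0 <= s -> (obj s <= obj r)%E].

End euclidean.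

Definition kappa (R : realType) (j : nat) : R := fine (vol (@ball2 R j)).

Section intrinsic_volumes.
Variables (R : realType) (d : nat).
Implicit Type K : set 'rV[R]_d.

(* the coefficients in Steiner's formula, which determines them uniquely *)
Definition intrinsic_volumes K : 'I_d.+1 -> R :=
  xget (fun=> 0) [set V : 'I_d.+1 -> R | forall rho : R, 0 < rho ->
    vol (minkowski_sum K (scale_set rho (@ball2 R d))) =
      (\sum_(i < d.+1) kappa R (d - i) * V i * rho ^+ (d - i))%:E].

Definition wills K : R := \sum_(j < d.+1) intrinsic_volumes K j.

End intrinsic_volumes.

Section main_quantities.
Variables (R : realType) (d : nat).
Implicit Types (T : set 'rV[R]_d) (sigma : R).

Definition wills_term T sigma : R :=
  sigma * ln (wills (scale_set (sigma * Num.sqrt (2 * pi))^-1 T)).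

Definition A_quantity T sigma : \bar R :=
  ((wills_term T sigma)%:E +
   \int[lebesgue_measure]_(nu in `[sigma, +oo[)
      Egauss (fun g => norm2 (proj (scale_set nu^-1 T) g) ^+ 2)%R)%E.

Definition B_quantity T sigma : \bar R :=
  ((wills_term T sigma)%:E +
   \int[lebesgue_measure]_(nu in `[sigma, +oo[)
      (localized_radius T nu ^+ 2 / nu ^+ 2)%:E)%E.

End main_quantities.

(* Main.v *)
(* Let H(s) = E sup_(t in T) (<t, g> - |t|^2 / (2 s)), the supremum being attained at the projection
   of s g on T, and Phi(s) = max_r (w(T cap r B) - r^2 / (2 s)), attained at r(s).

   By the envelope theorem the derivatives of H and Phi at s are E |Pi_T(s g)|^2 / (2 s^2) and
   r(s)^2 / (2 s^2), and both functions tend to w(T) at infinity. Hence the two integrals over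
   [s, oo) are 2 (w(T) - H(s)) and 2 (w(T) - Phi(s)); moreover 0 <= Phi(s) <= H(s), because for x in
   T cap r B the penalty |x|^2 / (2 s) is at most r^2 / (2 s).

   Steiner's formula, obtained for polytopes from the cells of points whose projection has a given
   set of active constraints and then by approximation, yields
   W(K) = int exp (- pi dist(x, K)^2) dx, that is,
   W(T / (s sqrt(2 pi))) = E exp (sup_t (<t, g> / s - |t|^2 / (2 s^2))).
   So H(s) <= s log W <= w(T): the lower bound is Jensen's inequality; the upper bound is Vitale's
   inequality, derived from the Gaussian infimum-convolution (transport) inequality, which in
   dimension one follows from Prekopa-Leindler and in general by tensorization.

   With 0 <= v <= u <= w, u + 2 (w - v) lies between w and 3 w. *)
From HB Require Import structures.
From mathcomp Require Import all_boot all_order all_algebra.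
From mathcomp Require Import all_classical all_reals all_analysis.
From mathcomp Require Import measurable_realfun.
From mathcomp Require Import ring lra.
Require Import Defs.
Import Order.TTheory GRing.Theory Num.Theory.
Import numFieldNormedType.Exports.
Local Open Scope classical_set_scope.
Local Open Scope ring_scope.
Set Implicit Arguments.
Unset Strict Implicit.
Unset Printing Implicit Defensive.

(** * Integration over tuples *)

(** Integrals over R^d are iterated one-dimensional integrals, so induction on d reaches only
    diagonal maps. A cell of a polytope, however, is dilated along the normal space of a face, which
    is in general not a coordinate subspace. The change of variables for such dilations is therefore
    derived from translation invariance and Tonelli, with exp (- pi |x|^2) as a test function of
    mass 1. The same function makes the constants kappa_j disappear: the distance to a single point,
    integrated against the derivative of - exp (- pi r^2), gives 1 / kappa_j as the matching moment,
    so no kappa_j is evaluated. Prekopa-Leindler uses weights th and 1 - th with th > 0, which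
    yields the cost (1 - th) |x - y|^2 / 2; Vitale's inequality appears only in the limit th -> 0. H
    and Phi are not differentiated under a maximum or an expectation. Testing the maximizer of one
    parameter at another parameter encloses the difference quotients; for H this is done for each
    fixed g, and the expectation is taken afterwards by Tonelli. *)

Section tuple_integral.
Local Open Scope ereal_scope.
Context d (T : measurableType d) (R : realType).
Variable mu : {sigma_finite_measure set T -> \bar R}.

Lemma integral_tuple0 (f : 0.-tuple T -> \bar R) :
  measurable_fun [set: 0.-tuple T] f -> \int[tuple_measure mu 0]_x f x = f [tuple].
Proof. by move=> mf; rewrite integral_dirac// diracT mul1e. Qed.

Lemma measurable_fun_consT n (f : n.+1.-tuple T -> \bar R) :
  measurable_fun [set: n.+1.-tuple T] f ->
  measurable_fun [set: T * n.-tuple T] (fun p => f (consT p)).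
Proof. by move=> mf; apply: measurableT_comp mf _; exact: measurable_consT. Qed.

Lemma measurable_fun_consT_section n (f : n.+1.-tuple T -> \bar R) (x : T) :
  measurable_fun [set: n.+1.-tuple T] f ->
  measurable_fun [set: n.-tuple T] (fun t => f (consT (x, t))).
Proof.
move=> /measurable_fun_consT mf.
by apply: measurableT_comp mf _; exact: measurable_fun_pair.
Qed.

(** Pushforward along [consT], then Tonelli. Nonnegativity replaces integrability conditions, which
    is why the inductions on the dimension are run for nonnegative functions. *)
Lemma integral_tupleS n (f : n.+1.-tuple T -> \bar R) :
  measurable_fun [set: n.+1.-tuple T] f -> (forall t, 0 <= f t) ->
  \int[tuple_measure mu n.+1]_t f t =
  \int[mu]_x \int[tuple_measure mu n]_t f (consT (x, t)).
Proof.
move=> mf f0.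
transitivity (\int[pushforward (mu \x tuple_measure mu n) (@consT T n)]_t f t).
  exact: eq_measure_integral.
rewrite (ge0_integral_pushforward (@measurable_consT _ T n))//.
rewrite preimage_setT fubini_tonelli1//.
  exact: measurable_fun_consT.
by move=> x; exact: f0.
Qed.

Lemma measurable_integral_consT n (f : n.+1.-tuple T -> \bar R) :
  measurable_fun [set: n.+1.-tuple T] f -> (forall t, 0 <= f t) ->
  measurable_fun setT (fun x => \int[tuple_measure mu n]_t f (consT (x, t))).
Proof.
move=> /measurable_fun_consT mf f0.
exact: (measurable_fun_fubini_tonelli_F (fun p => f (consT p)) mf).
Qed.

End tuple_integral.

Section vec_tuple.
Variable R : realType.
Local Notation TR := (measurableTypeR R).

Definition tuple_of_vec d (x : 'rV[R]_d) : d.-tuple TR := [tuple x ord0 i | i < d].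

Lemma tuple_of_vecK d : cancel (@tuple_of_vec d) (@vec_of_tuple R d).
Proof. by move=> x; apply/rowP => i; rewrite mxE tnth_mktuple. Qed.

Lemma vec_of_tupleK d : cancel (@vec_of_tuple R d) (@tuple_of_vec d).
Proof. by move=> t; apply/eq_from_tnth => i; rewrite tnth_mktuple mxE. Qed.

(** Row vectors carry the sup-norm topology and tuples the product sigma-algebra. They match because
    an open set is a countable union of balls with rational centre and radius 1/(k+1), and such a
    ball is a finite intersection of conditions on single coordinates. *)
Lemma measurable_vec_open d (O : set 'rV[R]_d) : open O ->
  measurable (@vec_of_tuple R d @^-1` O).
Proof.
move=> oO.
pose c (p : 'rV[rat]_d * nat) : 'rV[R]_d := map_mx (ratr : rat -> R) p.1.
pose B (p : 'rV[rat]_d * nat) : set 'rV[R]_d :=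
  if `[< ball (c p) (p.2.+1%:R^-1 : R) `<=` O >]
  then ball (c p) (p.2.+1%:R^-1 : R) else set0.
have -> : O = \bigcup_p B p.
  apply/seteqP; split => [x Ox|x [p _]]; last first.
    by rewrite /B; case: asboolP => // /[apply].
  have /nbhs_ballP[e /= e0 xeO] : nbhs x O by exact: open_nbhs_nbhs.
  (* Half of [e]: a ball of radius 1/(k+1) that contains [x] then stays within distance [e] of
     [x]. *)
  have [k ke] : exists k : nat, (k.+1%:R^-1 : R) < e / 2.
    have [k _ /(_ k (leqnn _))/=] := near_infty_natSinv_lt (PosNum (divr_gt0 e0 (ltr0Sn R 1))).
    by exists k.
  have /choice[q qP] (i : 'I_d) :
      exists q : rat, ratr q \in `](x ord0 i - (k.+1%:R^-1 : R)), (x ord0 i + k.+1%:R^-1)[.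
    by apply: rat_in_itvoo; rewrite ltrBlDr -addrA ltrDl addr_gt0.
  have xq : ball (c (\row_i q i, k)) (k.+1%:R^-1 : R) x.
    split; first by rewrite invr_gt0.
    move=> i j; rewrite /c -ball_normE/= !mxE ord1.
    have := qP j; rewrite in_itv /= => /andP[q1 q2]; rewrite ltr_distl.
    by apply/andP; split; [exact: q1|exact: q2].
  exists (\row_i q i, k) => //; rewrite /B; case: asboolP => // nB; exfalso; apply: nB => y qy.
  apply: xeO; apply: (@le_ball _ _ _ (k.+1%:R^-1 + k.+1%:R^-1)).
    by rewrite ltW// [e]splitr ltrD.
  by apply: ball_triangle qy; exact/ball_sym.
rewrite preimage_bigcup; apply: countable_bigcupT_measurable.
  exact: countableP.
move=> p; rewrite /B; case: asboolP => _; last by rewrite preimage_set0.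
rewrite [X in measurable X](_ : _ = \bigcap_(i in [set: 'I_d])
   ((fun t : d.-tuple TR => tnth t i) @^-1` ball (c p ord0 i) (p.2.+1%:R^-1 : R))).
  apply: fin_bigcap_measurable => // i _; rewrite -[X in measurable X]setTI.
  by apply: measurable_tnth => //; apply: open_measurable; exact: ball_open.
apply/seteqP; split => t /= tB.
  by move=> i _ /=; have := tB.2 ord0 i; rewrite !mxE.
split => [|i j]; first by rewrite invr_gt0.
by rewrite ord1 [X in ball _ _ X]mxE; exact: tB.
Qed.

Lemma measurable_vec_closed d (S : set 'rV[R]_d) : closed S ->
  measurable (@vec_of_tuple R d @^-1` S).
Proof.
move=> cS; rewrite -[S]setCK preimage_setC; apply: measurableC.
exact: (measurable_vec_open (closed_openC cS)).
Qed.

Lemma measurable_vec_continuous d (f : 'rV[R]_d -> R) : continuous f ->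
  measurable_fun [set: d.-tuple TR] (fun t => f (@vec_of_tuple R d t)).
Proof.
move=> cf; apply: (measurability _ (RGenOpens.measurableE R)) => _ [_ [a [b ->] <-]].
rewrite setTI -/(_ \o _) comp_preimage; apply: measurable_vec_open.
by move/continuousP : cf; apply; exact: interval_open.
Qed.

End vec_tuple.

(** * Layer-cake formula, integration against a density, affine substitution on the line *)

Section layer_cake.
Local Open Scope ereal_scope.
Context (R : realType).
Local Notation lam := (@lebesgue_measure R).

Lemma lebesgue_measure_subgraph_section (y : \bar R) : 0 <= y ->
  lam [set t : R | (0 <= t)%R /\ t%:E < y] = y.
Proof.
case: y => [r r0| _ |//].
  rewrite (_ : mkset _ = `[0%R, r[%classic); last first.
    apply/seteqP; split => t /=; rewrite in_itv/= lte_fin.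
      by move=> [-> ->].
    by move=> /andP[-> ->].
  rewrite lebesgue_measure_itv/= lte_fin sube0.
  by case: ltP => // r0'; apply/eqP; rewrite eq_le r0 lee_fin r0'.
rewrite (_ : mkset _ = `[0%R, +oo[%classic); last first.
  apply/seteqP; split => t /=; rewrite in_itv/= andbT ?ltry.
    by move=> [-> _].
  by move=> ->.
by rewrite lebesgue_measure_itv/= ltry.
Qed.

Context d (T : measurableType d).

Lemma measurable_subgraph (f : T -> \bar R) : measurable_fun [set: T] f ->
  measurable [set p : T * R | (0 <= p.2)%R /\ p.2%:E < f p.1].
Proof.
move=> mf; apply: measurableI.
  rewrite [X in measurable X](_ : _ = setT `&` snd @^-1` `[0%R, +oo[).
    exact: measurable_snd.
  by apply/seteqP; split => p /=; rewrite in_itv/= andbT => // -[].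
have m2 : measurable_fun [set: T * R] (fun p => p.2%:E).
  by apply/measurable_EFinP; exact: measurable_snd.
have m1 : measurable_fun [set: T * R] (fun p => f p.1).
  by apply: measurableT_comp mf _; exact: measurable_fst.
by have := emeasurable_fun_lt measurableT m2 m1; rewrite setTI; exact.
Qed.

(** Tonelli on the subgraph of [f]: the slice over x has length f x, the slice at height t is a
    superlevel set. *)
Lemma layer_cake (m : {sigma_finite_measure set T -> \bar R}) (f : T -> \bar R) :
  measurable_fun [set: T] f -> (forall x, 0 <= f x) ->
  \int[m]_x f x = \int[lam]_t m [set x | (0 <= t)%R /\ t%:E < f x].
Proof.
move=> mf f0; have mS := measurable_subgraph mf.
set S := mkset _ in mS.
transitivity (\int[m]_x \int[lam]_t (\1_S (x, t))%:E).
  apply: eq_integral => x _.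
  rewrite -[LHS]lebesgue_measure_subgraph_section// -[X in lam X]setIT.
  rewrite -integral_indic//.
  rewrite (_ : mkset _ = xsection S x); first exact: measurable_xsection.
  by apply/seteqP; split => t; rewrite /xsection/= inE.
have mS1 : measurable_fun [set: T * R] (fun p => (\1_S p)%:E : \bar R).
  by apply/measurable_EFinP; exact: measurable_indic.
rewrite [LHS](fubini_tonelli (m1 := m) (m2 := lam) _ mS1)//.
apply: eq_integral => t _; rewrite -[X in m X]setIT -integral_indic//.
rewrite (_ : mkset _ = ysection S t); first exact: measurable_ysection.
by apply/seteqP; split => x; rewrite /ysection/= inE.
Qed.

(** After [layer_cake] the relation between [m] and [mu] is needed on superlevel sets only; Tonelli
    then brings the integral over heights back inside, where it is f x again. *)
Lemma integral_density (mu m : {sigma_finite_measure set T -> \bar R})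
    (g : T -> R) (f : T -> \bar R) :
  measurable_fun [set: T] g -> (forall x, (0 <= g x)%R) ->
  (forall A, measurable A -> m A = \int[mu]_(x in A) (g x)%:E) ->
  measurable_fun [set: T] f -> (forall x, 0 <= f x) ->
  \int[m]_x f x = \int[mu]_x (f x * (g x)%:E).
Proof.
move=> mg g0 mE mf f0; rewrite layer_cake//; have mS := measurable_subgraph mf.
set S := mkset _ in mS.
transitivity (\int[lam]_t \int[mu]_x ((g x)%:E * (\1_S (x, t))%:E)).
  apply: eq_integral => t _; rewrite mE; last first.
    rewrite (_ : mkset _ = ysection S t); first exact: measurable_ysection.
    by apply/seteqP; split => x; rewrite /ysection/= inE.
  rewrite integral_mkcond; apply: eq_integral => x _.
  rewrite patchE indicE; case: ifPn => [|/negP] xS.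
    by rewrite mem_set ?mule1//; move: xS; rewrite inE.
  by rewrite memNset ?mule0// => xS'; apply: xS; rewrite inE.
have mgS : measurable_fun [set: T * R] (fun p => (g p.1)%:E * (\1_S p)%:E).
  apply: emeasurable_funM; apply/measurable_EFinP; last exact: measurable_indic.
  by apply: measurableT_comp mg _; exact: measurable_fst.
rewrite -[LHS](fubini_tonelli (m1 := mu) (m2 := lam) _ mgS); last first.
  by move=> z; rewrite mule_ge0// lee_fin.
apply: eq_integral => x _; rewrite /= [LHS]ge0_integralZl//; last 2 first.
  apply/measurable_EFinP; apply: measurableT_comp (measurable_indic mS) _.
  exact: measurable_fun_pair.
  by rewrite lee_fin.
rewrite muleC; congr (_ * _).
rewrite -[RHS]lebesgue_measure_subgraph_section// -[X in lam X]setIT.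
rewrite -integral_indic//.
rewrite (_ : mkset _ = xsection S x); first exact: measurable_xsection.
by apply/seteqP; split => t; rewrite /xsection/= inE.
Qed.

End layer_cake.

Lemma integral_normal_prob (R : realType) (f : measurableTypeR R -> \bar R) :
  measurable_fun [set: measurableTypeR R] f -> (forall x, 0 <= f x)%E ->
  (\int[normal_prob (0 : R) 1]_x f x =
   \int[@lebesgue_measure R]_x (f x * (normal_pdf 0 1 x)%:E))%E.
Proof.
move=> mf f0; apply: integral_density => //.
- exact: measurable_normal_pdf.
- by move=> x; exact: normal_pdf_ge0.
Qed.

Section lebesgue_affine.
Variable R : realType.
Local Notation lam := (@lebesgue_measure R).
Local Notation TR := (measurableTypeR R).

Lemma measurable_affine (a b : R) :
  measurable_fun [set: TR] (fun x : TR => (a * x + b : TR)).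
Proof. by apply: measurable_funD => //; exact: measurable_funM. Qed.

(** By uniqueness of Lebesgue measure it suffices to compare both sides on half-open intervals. *)
Lemma lebesgue_measure_affine (a b : R) (A : set TR) : 0 < a -> measurable A ->
  (a%:E * lam ((fun x => a * x + b)%R @^-1` A) = lam A)%E.
Proof.
move=> a0 mA; pose a' : {nonneg R} := NngNum (ltW a0).
pose m' : {measure set TR -> \bar R} :=
  mscale a' (pushforward lam (fun x : TR => a * x + b : TR)).
pose m := m' (measurable_affine a b).
suff -> : lam A = m A by [].
apply: lebesgue_measure_unique => //= _ [[x y]] _ <-.
rewrite /m/= /mscale/= /pushforward/=.
rewrite (_ : _ @^-1` _ = `](x - b) / a, (y - b) / a]%classic); last first.
  apply/seteqP; split => z /=; rewrite !in_itv/= ltr_pdivrMr// ler_pdivlMr//.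
    by rewrite mulrC ltrBlDr lerBrDr.
  by rewrite mulrC ltrBlDr lerBrDr.
rewrite !lebesgue_measure_itv/= !lte_fin ltr_pM2r ?invr_gt0// ltrD2r.
case: ifPn => _; last by rewrite mule0.
rewrite -!EFinD -EFinM; congr EFin.
by field; rewrite gt_eqF.
Qed.

Lemma integral_affine (a b : R) (f : TR -> \bar R) : 0 < a ->
  measurable_fun [set: TR] f -> (forall x, 0 <= f x)%E ->
  (\int[lam]_x f x = a%:E * \int[lam]_x f (a * x + b)%R)%E.
Proof.
move=> a0 mf f0; pose a' : {nonneg R} := NngNum (ltW a0).
pose m' : {measure set TR -> \bar R} :=
  mscale a' (pushforward lam (fun x : TR => a * x + b : TR)).
pose m := m' (measurable_affine a b).
transitivity (\int[m]_x f x)%E.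
  apply: eq_measure_integral => A mA _.
  by rewrite -[LHS](lebesgue_measure_affine b a0 mA).
rewrite /m /m' ge0_integral_mscale//.
rewrite (ge0_integral_pushforward (measurable_affine a b))//.
Qed.

End lebesgue_affine.

(** * Infimum convolution for the Gaussian measure *)

Section prekopa_leindler.
Variable R : realType.
Local Notation lam := (@lebesgue_measure R).
Local Notation TR := (measurableTypeR R).

Lemma lebesgue_measure_scale_shift (a b : R) (A : set TR) : 0 < a ->
  measurable A ->
  (lam ((fun x => (x - b) / a)%R @^-1` A) = a%:E * lam A)%E.
Proof.
move=> a0 mA; have a0' : 0 < a^-1 by rewrite invr_gt0.
rewrite -(lebesgue_measure_affine (- b / a) a0' mA).
rewrite muleA -EFinM divff ?gt_eqF// mul1e; congr (lam _).
by apply/seteqP; split => x /=; rewrite mulrBl mulrC mulNr.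
Qed.

Lemma measurable_scale_shift (a b : R) (A : set TR) : measurable A ->
  measurable ((fun x => (x - b) / a)%R @^-1` A : set TR).
Proof.
move=> mA; rewrite -[X in measurable X]setTI.
rewrite (_ : (fun x => (x - b) / a)%R = (fun x => a^-1 * x + (- b / a))).
  exact: measurable_affine.
by apply/funext => x; rewrite mulrBl mulrC mulNr.
Qed.

Lemma compact_has_max (A : set R) : A !=set0 -> compact A ->
  exists2 a, A a & forall x, A x -> x <= a.
Proof.
move=> A0 cA; have [|a /set_mem Aa ha] := compact_EVT_max (f := id) A0 cA.
  by apply: continuous_subspaceT => x; exact: cvg_id.
by exists a => // x Ax; apply: ha; exact: mem_set.
Qed.

Lemma compact_has_min (A : set R) : A !=set0 -> compact A ->
  exists2 a, A a & forall x, A x -> a <= x.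
Proof.
move=> A0 cA; have [|a /set_mem Aa ha] := compact_EVT_min (f := id) A0 cA.
  by apply: continuous_subspaceT => x; exact: cvg_id.
by exists a => // x Ax; apply: ha; exact: mem_set.
Qed.

(* A translate of [th *: A] and a translate of [(1 - th) *: B] lie in [C] and meet in at most one
   point. *)
Lemma brunn_minkowski_compact (th : R) (A B C : set TR) : 0 < th -> th < 1 ->
  measurable C -> compact (A : set R) -> compact (B : set R) ->
  A !=set0 -> B !=set0 ->
  (forall x y, A x -> B y -> C (th * x + (1 - th) * y)) ->
  (th%:E * lam A + (1 - th)%:E * lam B <= lam C)%E.
Proof.
move=> th0 th1 mC cA cB A0 B0 ABC.
have th1' : 0 < 1 - th by rewrite subr_gt0.
have mA : measurable A := compact_measurable cA.
have mB : measurable B := compact_measurable cB.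
have [a Aa aA] := compact_has_max A0 cA.
have [b Bb bB] := compact_has_min B0 cB.
pose A' : set TR := (fun x => (x - (1 - th) * b) / th)%R @^-1` A.
pose B' : set TR := (fun x => (x - th * a) / (1 - th))%R @^-1` B.
have mA' : measurable A' by exact: measurable_scale_shift.
have mB' : measurable B' by exact: measurable_scale_shift.
rewrite -(lebesgue_measure_scale_shift ((1 - th) * b) th0 mA).
rewrite -(lebesgue_measure_scale_shift (th * a) th1' mB).
rewrite -/A' -/B'.
(* [A'] lies at or to the left of [p] because [a] is the maximum of [A], and [B'] at or to the right
   because [b] is the minimum of [B]; removing the null set {p} makes them disjoint. *)
pose p := th * a + (1 - th) * b.
have -> : lam B' = lam (B' `\ p).
  apply/eqP; rewrite eq_le; apply/andP; split; last first.
    by rewrite le_measure ?inE//; exact: measurableD.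
  rewrite -[leRHS](@measureU0 _ _ _ lam (B' `\ p) [set p])//.
  - rewrite le_measure ?inE//; first by apply: measurableU => //; exact: measurableD.
    by move=> x Bx; have [->|/eqP xp] := eqVneq x p; [right|left].
  - exact: measurableD.
  - exact: lebesgue_measure_set1.
rewrite -measureU//; last 2 first.
- exact: measurableD.
- apply/seteqP; split => // x [/= A'x [B'x]]; apply.
  have := aA _ A'x; have := bB _ B'x.
  rewrite ler_pdivrMr// ler_pdivlMr// /p => ? ?; apply/eqP; rewrite eq_le.
  by apply/andP; split; lra.
rewrite le_measure ?inE//; first by apply: measurableU => //; exact: measurableD.
move=> x [A'x|[B'x _]].
  have := ABC _ _ A'x Bb; rewrite (_ : _ + _ = x)//.
  by rewrite mulrC divfK ?gt_eqF// subrK.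
have := ABC _ _ Aa B'x; rewrite (_ : _ + _ = x)//.
by rewrite [X in _ + X]mulrC divfK ?gt_eqF// addrC subrK.
Qed.

(** Inner regularity reduces the claim to compact sets. Adding a fixed point of the set to each
    compact subset keeps it inside and makes it nonempty, as the compact case demands. *)
Lemma brunn_minkowski (th : R) (A B C : set TR) : 0 < th -> th < 1 ->
  measurable C -> measurable A -> measurable B ->
  A !=set0 -> B !=set0 ->
  (forall x y, A x -> B y -> C (th * x + (1 - th) * y)) ->
  (th%:E * lam A + (1 - th)%:E * lam B <= lam C)%E.
Proof.
move=> th0 th1 mC mA mB [a Aa] [b Bb] ABC.
have th1' : 0 < 1 - th by rewrite subr_gt0.
have inner (D : set TR) d : measurable D -> D d ->
    lam D = ereal_sup [set lam K | K in
      [set K : set TR | [/\ compact (K : set R), K d & K `<=` D]]].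
  move=> mD Dd; rewrite lebesgue_regularity_inner_sup//.
  apply/eqP; rewrite eq_le; apply/andP; split; last first.
    by apply: le_ereal_sup => _ [K [cK _ KD] <-]; exists K.
  apply: ge_ereal_sup => _ [K [cK KD] <-].
  apply: (@le_trans _ _ (lam (K `|` [set d]))).
    rewrite le_measure ?inE//; first exact: compact_measurable.
    by apply: measurableU => //; exact: compact_measurable.
  apply: ereal_sup_ubound; exists (K `|` [set d]) => //; split.
  - by apply: compactU => //; exact: compact_set1.
  - by right.
  - by move=> x [/KD|->].
have sup_le (x z : \bar R) (r : R) (S : set (\bar R)) : x \is a fin_num -> 0 < r ->
    (forall y, S y -> x + r%:E * y <= z)%E -> (x + r%:E * ereal_sup S <= z)%E.
  move=> xf r0 Sz; rewrite -leeBrDl// -ereal_sup_pZl//.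
  by apply: ge_ereal_sup => _ [y Sy <-]; rewrite leeBrDl//; exact: Sz.
have fin K : compact (K : set R) -> lam K \is a fin_num.
  move=> cK; rewrite ge0_fin_numE//; exact: compact_finite_measure.
have AB K L : compact (K : set R) -> K a -> K `<=` A ->
    compact (L : set R) -> L b -> L `<=` B ->
    (th%:E * lam K + (1 - th)%:E * lam L <= lam C)%E.
  move=> cK Ka KA cL Lb LB; apply: brunn_minkowski_compact => //.
  - by exists a.
  - by exists b.
  - by move=> x y Kx Ly; apply: ABC; [exact: KA|exact: LB].
have [->|] := eqVneq (lam C) +oo%E; first exact: leey.
rewrite -ltey => Cfin.
have KB K : compact (K : set R) -> K a -> K `<=` A ->
    (th%:E * lam K + (1 - th)%:E * lam B <= lam C)%E.
  move=> cK Ka KA; rewrite (inner B b)//; apply: sup_le => //.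
    by rewrite fin_numM// fin.
  by move=> _ [L [cL Lb LB] <-]; exact: AB.
(* The one-point set {a} in place of [A] already bounds this term by [lam C]; its finiteness is what
   [sup_le] needs for the supremum over the subsets of [A]. *)
have Bfin : ((1 - th)%:E * lam B)%E \is a fin_num.
  rewrite ge0_fin_numE ?mule_ge0// ?lee_fin ?(ltW th1')//.
  apply: le_lt_trans Cfin; apply: le_trans (KB [set a] _ _ _) => //.
  - by rewrite leeDr// mule_ge0// lee_fin ltW.
  - exact: compact_set1.
  - by move=> _ ->.
rewrite (inner A a)// addeC; apply: sup_le => //.
by move=> _ [K [cK Ka KA] <-]; rewrite addeC; exact: KB.
Qed.

(** Brunn-Minkowski is applied to the superlevel sets at each height and integrated by [layer_cake].
    Requiring that both superlevel sets be empty at the same heights rules out the case of a single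
    empty set, where Brunn-Minkowski fails, and yields the arithmetic instead of the geometric mean
    of the integrals. *)
Lemma prekopa_leindler_min (th : R) (a b c : TR -> R) : 0 < th -> th < 1 ->
  measurable_fun setT a -> measurable_fun setT b -> measurable_fun setT c ->
  (forall x, 0 <= a x) -> (forall x, 0 <= b x) -> (forall x, 0 <= c x) ->
  (forall t : R, 0 <= t -> (exists x, t < a x) <-> (exists x, t < b x)) ->
  (forall (t : R) x y, 0 <= t -> t < a x -> t < b y -> t < c (th * x + (1 - th) * y)) ->
  (th%:E * (\int[lam]_x (a x)%:E) + (1 - th)%:E * (\int[lam]_x (b x)%:E) <=
   \int[lam]_x (c x)%:E)%E.
Proof.
move=> th0 th1 ma mb mc a0 b0 c0 ab abc.
have th1' : 0 < 1 - th by rewrite subr_gt0.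
have mset (f : TR -> R) (t : R) : measurable_fun setT f ->
    measurable [set x : TR | 0 <= t /\ (t%:E < (f x)%:E)%E].
  move=> mf; have mf' : measurable_fun setT (EFin \o f) by exact/measurable_EFinP.
  rewrite (_ : mkset _ = ysection [set p : TR * R |
    0 <= p.2 /\ (p.2%:E < (EFin \o f) p.1)%E] t).
    by apply: measurable_ysection; exact: measurable_subgraph mf'.
  by apply/seteqP; split => x; rewrite /ysection/= inE.
have ms (f : TR -> R) : measurable_fun setT f ->
    measurable_fun setT (fun t : R => lam [set x : TR | 0 <= t /\ (t%:E < (f x)%:E)%E]).
  move=> mf; have mf' : measurable_fun setT (EFin \o f) by exact/measurable_EFinP.
  apply: eq_measurable_fun (measurable_fun_ysection lam (measurable_subgraph mf')).
  move=> t _; congr (lam _).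
  by apply/seteqP; split => x; rewrite /ysection/= inE.
have lc (f : TR -> R) : measurable_fun setT f -> (forall x, 0 <= f x) ->
    (\int[lam]_x (f x)%:E =
     \int[lam]_t lam [set x : TR | (0 <= t :> R)%R /\ ((t : R)%:E < (f x)%:E)%E])%E.
  move=> mf f0; apply: (layer_cake lam (f := EFin \o f)) => //.
  exact/measurable_EFinP.
rewrite (lc a)// (lc b)// (lc c)//.
rewrite -!ge0_integralZl ?lee_fin//; try exact: ms; try exact: ltW.
rewrite -ge0_integralD//; try by (apply: measurable_funeM; exact: ms).
- apply: ge0_le_integral => //.
  + by move=> t _; rewrite adde_ge0// mule_ge0// ?lee_fin// ltW.
  + by apply: emeasurable_funD; apply: measurable_funeM; exact: ms.
  + exact: ms.
  + move=> t _; have [t0|t0] := pselect (0 <= t :> R); last first.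
      rewrite [X in lam X](_ : _ = set0) ?measure0 ?mule0 ?add0e; last first.
        by apply/seteqP; split => // x [].
      rewrite [X in lam X](_ : _ = set0) ?measure0 ?mule0//.
      by apply/seteqP; split => // x [].
    have [[x tx]|nx] := pselect (exists x, t < a x).
      have [y ty] : exists y, t < b y by apply/ab => //; exists x.
      apply: brunn_minkowski => //; try exact: mset.
      * by exists x.
      * by exists y.
      * by move=> u v [_ /= tu] [_ /= tv]; split => //; rewrite lte_fin; apply: abc.
    rewrite [X in lam X](_ : _ = set0) ?measure0 ?mule0 ?add0e; last first.
      by apply/seteqP; split => // x [_ tx]; apply: nx; exists x.
    rewrite [X in lam X](_ : _ = set0) ?measure0 ?mule0//.
    apply/seteqP; split => // y [_ ty]; apply: nx; apply/ab => //.
    by exists y.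
- by move=> t _; rewrite mule_ge0// lee_fin ltW.
- by move=> t _; rewrite mule_ge0// lee_fin ltW.
Qed.
End prekopa_leindler.

Section gaussian_transport.
Variable R : realType.
Local Notation TR := (measurableTypeR R).
Local Notation gam := (normal_prob (0 : R) 1).

Lemma measurable_expeR : measurable_fun [set: \bar R] (@expeR R).
Proof.
rewrite (_ : @expeR R = fun x => if x == +oo%E then +oo%E else
    if x == -oo%E then 0%E else (expR (fine x))%:E); last first.
  by apply/funext => -[r| |].
have msing (y : \bar R) : measurable_fun [set: \bar R] (fun x => x == y).
  apply: (measurable_fun_bool true); rewrite setTI.
  rewrite (_ : _ @^-1` _ = [set y]); first exact: emeasurable_set1.
  by apply/seteqP; split => x /=; [move=> /eqP|move=> ->; rewrite eqxx].
apply: measurable_fun_ifT => //; apply: measurable_fun_ifT => //.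
apply/measurable_EFinP; apply: measurableT_comp; first exact: measurable_expR.
exact: fine_measurable.
Qed.

(* Jensen's inequality for [x |-> exp(- eps * x)], in the form
   [exp(- eps f) + exp(- eps m) eps f >= exp(- eps m) (1 + eps m)]. *)
Lemma expeRN_jensen d (T : measurableType d) (P : probability T R) (f : T -> \bar R)
    (m eps : R) : 0 < eps ->
  measurable_fun setT f -> (forall x, 0 <= f x)%E -> (\int[P]_x f x = m%:E)%E ->
  ((expR (- eps * m))%:E <= \int[P]_x expeR ((- eps)%:E * f x))%E.
Proof.
move=> eps_gt0 mf f0 fm; have eps0 := ltW eps_gt0.
have m0 : 0 <= m by rewrite -lee_fin -fm; exact: integral_ge0.
set e := expR (- eps * m); have e0 : 0 <= e := expR_ge0 _.
have mexp : measurable_fun setT (fun x => expeR ((- eps)%:E * f x)%E).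
  apply: measurableT_comp; first exact: measurable_expeR.
  exact: measurable_funeM.
have : (\int[P]_x (e * (1 + eps * m))%:E <=
        \int[P]_x (expeR ((- eps)%:E * f x) + (e * eps)%:E * f x))%E.
  apply: ge0_le_integral => //.
  - by move=> x _; rewrite lee_fin mulr_ge0// addr_ge0// mulr_ge0.
  - by apply: emeasurable_funD => //; exact: measurable_funeM.
  - move=> x _; have := f0 x; case: (f x) => [r| |//]; last first.
      move=> _.
      rewrite [X in (_ + X)%E]gt0_muley ?lte_fin ?mulr_gt0 ?expR_gt0//.
      by rewrite addey ?leey// gt_eqF// (lt_le_trans _ (expeR_ge0 _)).
    rewrite lee_fin => r0 /=; rewrite lee_fin.
    rewrite (_ : - eps * r = - eps * m + (- eps * (r - m))); last by ring.
    rewrite expRD -/e -mulrA -mulrDr ler_wpM2l//.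
    have := expR_ge1Dx (- eps * (r - m)); lra.
rewrite integral_cst// [X in (_ * X <= _)%E]probability_setT mule1 ge0_integralD//; last 3 first.
- by move=> x _; exact: expeR_ge0.
- by move=> x _; rewrite mule_ge0// lee_fin mulr_ge0.
- exact: measurable_funeM.
rewrite ge0_integralZl//; last by rewrite lee_fin mulr_ge0.
rewrite fm -leeBlDr// => /(le_trans _); apply.
by rewrite -EFinM -EFinB lee_fin; lra.
Qed.

Lemma normal_pdf01E (x : R) : normal_pdf 0 1 x = normal_peak 1 * expR (- (x ^+ 2 / 2)).
Proof.
by rewrite normal_pdfE ?oner_neq0// /normal_fun subr0 expr1n mulNr.
Qed.

Lemma exists_gt_scaled_sup (T : Type) (g : T -> R) (s t : R) : 0 < s ->
  has_sup (range g) -> (exists x, t < s * g x) <-> t < s * sup (range g).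
Proof.
move=> s0 gs; split => [[x tx]|].
  by apply: (lt_le_trans tx); rewrite ler_pM2l//; apply: sup_upper_bound => //; exists x.
rewrite -ltr_pdivrMl// => /(sup_gt gs.1)[_ [x _ <-]]; rewrite ltr_pdivrMl// => tx.
by exists x.
Qed.

(** Prekopa-Leindler for v phi, exp (- eps f) phi and phi, with phi the Gaussian density. The
    identity th x^2 + (1 - th) y^2 - th (1 - th) (x - y)^2 = (th x + (1 - th) y)^2 turns the
    quadratic cost into the exponent of phi at the interpolated point. *)
Lemma gaussian_infconv1 (th : R) (v f : TR -> \bar R) : 0 < th -> th < 1 ->
  measurable_fun setT v -> measurable_fun setT f ->
  (forall x, 0 <= v x)%E -> (forall x, 0 <= f x)%E ->
  (forall x y : R, v x <= expeR (f y + ((1 - th) / 2 * (x - y) ^+ 2)%:E))%E ->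
  (\int[gam]_x v x <= expeR (\int[gam]_x f x))%E.
Proof.
move=> th0 th1 mv mf v0 f0 vf.
have th1' : 0 < 1 - th by rewrite subr_gt0.
case fm : (\int[gam]_x f x)%E => [m| |]; last 2 first.
- exact: leey.
- by have := integral_ge0 gam (D := setT) (fun x _ => f0 x); rewrite fm.
have [[x0 vx0]|v00] := pselect (exists x, 0 < v x)%E; last first.
  rewrite integral0_eq ?expeR_ge0// => x _; apply/eqP; rewrite eq_le v0 andbT leNgt.
  by apply/negP => vx; apply: v00; exists x.
have [y0 fy0] : exists y, (f y < +oo)%E.
  apply/not_existsP => foo; move: fm; rewrite (eq_integral (cst +oo%E)).
    by rewrite integral_cst// [X in (_ * X)%E]probability_setT mule1.
  by move=> y _; apply/eqP; rewrite -leye_eq leNgt; apply/negP; exact: foo.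
have fy0f : f y0 \is a fin_num by rewrite ge0_fin_numE.
pose phi x : R := normal_pdf 0 1 x.
pose pk : R := normal_peak 1.
have pk0 : 0 < pk by apply: normal_peak_gt0; rewrite oner_neq0.
have phiE x : phi x = pk * expR (- (x ^+ 2 / 2)) by exact: normal_pdf01E.
have phi0 x : 0 < phi x by rewrite phiE mulr_gt0// expR_gt0.
(* Since (1 - th) eps = th, the contributions th f(y) and - (1 - th) eps f(y) cancel in the
   interpolation. *)
pose eps := th / (1 - th).
have eps0 : 0 < eps by rewrite divr_gt0.
have epsE : (1 - th) * eps = th by rewrite /eps mulrC divfK// gt_eqF.
have vfin x : v x \is a fin_num.
  rewrite ge0_fin_numE//; apply: (le_lt_trans (vf x y0)).
  by rewrite -(fineK fy0f)/= ltry.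
(* Where [f] is infinite this is 0, so a strict superlevel set of [b0] at a nonnegative height
   contains only points where [f] is finite. *)
pose e y := expeR ((- eps)%:E * f y)%E.
have efin y : e y \is a fin_num.
  rewrite /e ge0_fin_numE ?expeR_ge0//; have := f0 y; case: (f y) => [r| |]//.
    by rewrite -EFinM/= ltry.
  by rewrite lt0_muley ?lte_fin ?oppr_lt0.
pose a0 x : R := fine (v x) * phi x.
pose b0 y : R := fine (e y) * phi y.
have a0_ge0 x : 0 <= a0 x by rewrite mulr_ge0 ?fine_ge0// ltW.
have b0_ge0 x : 0 <= b0 x by rewrite mulr_ge0 ?fine_ge0 ?expeR_ge0// ltW.
have a0s : has_sup (range a0).
  split; first by exists (a0 x0), x0.
  (* The fraction is the maximum over x of (1 - th) / 2 (x - y0)^2 - x^2 / 2, a quadratic with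
     leading coefficient - th / 2; the gap to it is a square divided by 2 th. *)
  exists (pk * expR (fine (f y0) +
    ((1 - th) ^+ 2 * y0 ^+ 2 / th + (1 - th) * y0 ^+ 2) / 2)) => _ [x _ <-].
  have vx : fine (v x) <= expR (fine (f y0) + (1 - th) / 2 * (x - y0) ^+ 2).
    by rewrite -lee_fin fineK//; have := vf x y0; rewrite -(fineK fy0f).
  rewrite /a0 phiE mulrCA ler_pM2l//; apply: le_trans (ler_wpM2r (expR_ge0 _) vx) _.
  rewrite -expRD ler_expR -addrA lerD2l -subr_ge0.
  rewrite (_ : _ - _ = (th * x + (1 - th) * y0) ^+ 2 / th / 2); last first.
    by field; rewrite gt_eqF.
  by rewrite !divr_ge0 ?sqr_ge0// ltW.
have b0s : has_sup (range b0).
  split; first by exists (b0 x0), x0.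
  exists pk => _ [y _ <-]; rewrite /b0 phiE mulrCA ger_pMr//.
  rewrite mulr_ile1 ?fine_ge0 ?expeR_ge0 ?expR_ge0//.
    rewrite -lee_fin fineK// -expeR0 lee_expeR; apply: mule_le0_ge0 => //.
    by rewrite lee_fin oppr_le0 ltW.
  by rewrite -[leRHS]expR0 ler_expR oppr_le0 divr_ge0// sqr_ge0.
pose A := sup (range a0); pose B := sup (range b0).
have A0 : 0 < A.
  apply: (@lt_le_trans _ _ (a0 x0)).
    by rewrite mulr_gt0// fine_gt0// vx0/= -ge0_fin_numE//.
  by apply: sup_upper_bound => //; exists x0.
have B0 : 0 < B.
  apply: (@lt_le_trans _ _ (b0 y0)).
    by rewrite mulr_gt0// /e -(fineK fy0f) -EFinM /= expR_gt0.
  by apply: sup_upper_bound => //; exists y0.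
(* The factors exp k and exp (- eps k) give the two functions the same supremum, as
   [prekopa_leindler_min] requires; [k] cancels at the end. *)
pose k := (ln B - ln A) / (1 + eps).
have eps1 : 0 < 1 + eps by rewrite addr_gt0.
have kE : expR k * A = expR (- eps * k) * B.
  rewrite -[A in LHS]lnK// -[B in RHS]lnK// -!expRD; congr expR.
  by rewrite /k; field; rewrite gt_eqF.
have mphi : measurable_fun setT (phi : TR -> R) by exact: measurable_normal_pdf.
have ma0 : measurable_fun setT (a0 : TR -> R).
  by apply: measurable_funM => //; apply: measurableT_comp mv; exact: fine_measurable.
have me : measurable_fun setT e.
  by apply: measurableT_comp; [exact: measurable_expeR|exact: measurable_funeM].
have mb0 : measurable_fun setT (b0 : TR -> R).
  by apply: measurable_funM => //; apply: measurableT_comp me; exact: fine_measurable.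
have pl : (th%:E * (\int[@lebesgue_measure R]_x (expR k * a0 x)%:E) +
    (1 - th)%:E * (\int[@lebesgue_measure R]_x (expR (- eps * k) * b0 x)%:E) <=
    \int[@lebesgue_measure R]_x (phi x)%:E)%E.
  apply: prekopa_leindler_min => //.
  - exact: measurable_funM.
  - exact: measurable_funM.
  - by move=> x; rewrite mulr_ge0 ?expR_ge0.
  - by move=> x; rewrite mulr_ge0 ?expR_ge0.
  - by move=> x; exact: ltW.
  - by move=> t t0; rewrite !exists_gt_scaled_sup ?expR_gt0// -/A -/B kE.
  move=> t x y; rewrite le_eqVlt => /predU1P[<-//|t0] ta tb.
  have fyf : f y \is a fin_num.
    rewrite ge0_fin_numE// ltey; apply/eqP => fy; move: tb.
    rewrite /b0 /e fy lt0_muley ?lte_fin ?oppr_lt0//= mul0r mulr0.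
    by move/(lt_trans t0); rewrite ltxx.
  have fyE := fineK fyf.
  have tp0 : 0 < t / pk by rewrite divr_gt0.
  have lna : ln (t / pk) < k + (fine (f y) + (1 - th) / 2 * (x - y) ^+ 2) - x ^+ 2 / 2.
    rewrite -ltr_expR lnK// ltr_pdivrMr//; apply: (lt_le_trans ta).
    rewrite (_ : _ * pk = expR k * (expR (fine (f y) + (1 - th) / 2 * (x - y) ^+ 2) * phi x)).
      rewrite ler_pM2l ?expR_gt0// /a0 ler_pM2r// -lee_fin fineK//.
      by have := vf x y; rewrite -fyE.
    by rewrite phiE -addrA expRD [expR (_ - _)]expRD -!mulrA [pk * _]mulrC.
  have lnb : ln (t / pk) < - eps * k + - eps * fine (f y) - y ^+ 2 / 2.
    rewrite -ltr_expR lnK// ltr_pdivrMr//; apply: (lt_le_trans tb).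
    by rewrite !expRD /b0 phiE /e -fyE/= -!mulrA [pk * _]mulrC.
  rewrite phiE -ltr_pdivrMl// mulrC -[ltLHS]lnK// ltr_expR.
  have : th * ln (t / pk) + (1 - th) * ln (t / pk) <
    th * (k + (fine (f y) + (1 - th) / 2 * (x - y) ^+ 2) - x ^+ 2 / 2) +
    (1 - th) * (- eps * k + - eps * fine (f y) - y ^+ 2 / 2).
    by rewrite ltrD// ltr_pM2l.
  rewrite -mulrDl addrC subrK mul1r => /lt_le_trans; apply.
  by rewrite le_eqVlt; apply/orP; left; apply/eqP; rewrite /eps; field; rewrite gt_eqF.
move: pl; rewrite [X in (_ <= X)%E]integral_normal_pdf.
have intZ (r : R) (g : TR -> R) : 0 <= r -> measurable_fun setT g ->
    (forall x, 0 <= g x) ->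
    (\int[@lebesgue_measure R]_x (r * g x)%:E = r%:E * \int[@lebesgue_measure R]_x (g x)%:E)%E.
  move=> r0 mg g0; under eq_integral do rewrite EFinM.
  by rewrite ge0_integralZl//; [exact/measurable_EFinP|move=> x _; rewrite lee_fin].
rewrite !intZ ?expR_ge0//.
have -> : (\int[@lebesgue_measure R]_x (a0 x)%:E = \int[gam]_x v x)%E.
  rewrite integral_normal_prob//; apply: eq_integral => x _.
  by rewrite /a0 EFinM fineK.
have eb : ((expR (- eps * m))%:E <= \int[@lebesgue_measure R]_x (b0 x)%:E)%E.
  apply: (le_trans (expeRN_jensen eps0 mf f0 fm)).
  rewrite integral_normal_prob//; last by move=> x; exact: expeR_ge0.
  apply: ge0_le_integral => //=.
  - by move=> x _; rewrite mule_ge0 ?expeR_ge0// lee_fin ltW.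
  - apply: emeasurable_funM => //; exact/measurable_EFinP.
  - exact/measurable_EFinP.
  - by move=> x _; rewrite /b0 EFinM fineK.
move=> pl.
have {}pl : (th%:E * ((expR k)%:E * \int[gam]_x v x) +
    (1 - th)%:E * ((expR (- eps * k))%:E * (expR (- eps * m))%:E) <= 1)%E.
  apply: le_trans pl; rewrite leeD2l// lee_pmul2l//.
  by rewrite lee_pmul2l// lte_fin expR_gt0.
have V0 : (0 <= \int[gam]_x v x)%E by exact: integral_ge0.
move: V0 pl; case: (\int[gam]_x v x)%E => [V| |//]; last first.
  move=> _; rewrite gt0_muley ?lte_fin ?expR_gt0// gt0_muley ?lte_fin//.
rewrite lee_fin => V0 pl.
have {}pl : th * (expR k * V) + (1 - th) * expR (- eps * (k + m)) <= 1.
  by rewrite mulrDr expRD -lee_fin.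
rewrite /= lee_fin.
(* Replacing the second exponential by its tangent at 0 leaves exp k * V <= 1 + k + m <= exp (k +
   m), hence V <= exp m. *)
have ge : (1 - th) * (1 - eps * (k + m)) <= (1 - th) * expR (- eps * (k + m)).
  by rewrite ler_pM2l//; have := expR_ge1Dx (- eps * (k + m)); rewrite mulNr.
have : th * (expR k * V) <= th * (1 + (k + m)).
  have e2 : (1 - th) * (1 - eps * (k + m)) = 1 - th - th * (k + m).
    by rewrite mulrBr mulr1 mulrA epsE.
  move: ge; rewrite e2; lra.
rewrite ler_pM2l// => /le_trans/(_ (expR_ge1Dx _)).
by rewrite expRD ler_pM2l// expR_gt0.
Qed.

End gaussian_transport.

Section gaussian_infconv.
Variable R : realType.
Local Notation TR := (measurableTypeR R).
Local Notation gam := (normal_prob (0 : R) 1).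

Lemma tuple_measure_normalT d : tuple_measure gam d setT = 1%E.
Proof. exact: (probability_setT (@gauss_measure R d)). Qed.

Lemma tnth_consT (T : Type) n (x : T) (t : n.-tuple T) (i : 'I_n) :
  tnth (consT (x, t)) (lift ord0 i) = tnth t i.
Proof. exact: tnthS. Qed.

(* The dual form of Talagrand's transport inequality tensorizes: integrating out the
   last coordinates preserves the hypothesis. *)
Lemma gaussian_infconv d (th : R) (v f : d.-tuple TR -> \bar R) :
  0 < th -> th < 1 ->
  measurable_fun [set: d.-tuple TR] v -> measurable_fun [set: d.-tuple TR] f ->
  (forall x, 0 <= v x)%E -> (forall x, 0 <= f x)%E ->
  (forall x y, v x <= expeR (f y +
    ((1 - th) / 2 * (\sum_(i < d) (tnth x i - tnth y i) ^+ 2)%R)%:E))%E ->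
  (\int[tuple_measure gam d]_x v x <= expeR (\int[tuple_measure gam d]_x f x))%E.
Proof.
move=> th0 th1; elim: d v f => [|d IH] v f mv mf v0 f0 vf.
  rewrite !integral_tuple0//; have := vf [tuple] [tuple].
  by rewrite big_ord0 mulr0 adde0.
rewrite !integral_tupleS//; apply: (gaussian_infconv1 th0 th1).
- exact: measurable_integral_consT.
- exact: measurable_integral_consT.
- by move=> x; exact: integral_ge0.
- by move=> x; exact: integral_ge0.
move=> x y; set c := (1 - th) / 2 * (x - y) ^+ 2.
have c0 : (0 <= c%:E)%E.
  by rewrite lee_fin /c mulr_ge0 ?sqr_ge0// divr_ge0// subr_ge0 ltW.
have mfy := measurable_fun_consT_section y mf.
(* For fixed first coordinates their cost is a constant added to [f]; it leaves the integral
   unchanged because the Gaussian measure has mass 1. *)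
have := IH (fun t => v (consT (x, t))) (fun t => f (consT (y, t)) + c%:E)%E.
rewrite ge0_integralD// integral_cst// [X in (c%:E * X)%E]tuple_measure_normalT mule1; apply => //.
- exact: measurable_fun_consT_section.
- by apply: emeasurable_funD.
- by move=> t; exact: adde_ge0.
- move=> s t; apply: (le_trans (vf _ (consT (y, t)))).
  rewrite lee_expeR -addeA leeD2l// -EFinD lee_fin big_ord_recl.
  under eq_bigr do rewrite !tnth_consT.
  by rewrite mulrDr.
Qed.

End gaussian_infconv.

(** * Euclidean geometry and metric projections *)

Section euclidean_geometry.
Variables (R : realType) (d : nat).
Implicit Types (x y z : 'rV[R]_d) (K : set 'rV[R]_d).

Lemma dotC x y : dot x y = dot y x.
Proof. by apply: eq_bigr => i _; rewrite mulrC. Qed.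

Lemma dotDl x y z : dot (x + y) z = dot x z + dot y z.
Proof. by rewrite -big_split; apply: eq_bigr => i _; rewrite mxE mulrDl. Qed.

Lemma dotZl (a : R) x y : dot (a *: x) y = a * dot x y.
Proof. by rewrite mulr_sumr; apply: eq_bigr => i _; rewrite mxE mulrA. Qed.

Lemma dotNl x y : dot (- x) y = - dot x y.
Proof. by rewrite -scaleN1r dotZl mulN1r. Qed.

Lemma dotBl x y z : dot (x - y) z = dot x z - dot y z.
Proof. by rewrite dotDl dotNl. Qed.

Lemma dotDr x y z : dot z (x + y) = dot z x + dot z y.
Proof. by rewrite ![dot z _]dotC dotDl. Qed.

Lemma dotZr (a : R) x y : dot x (a *: y) = a * dot x y.
Proof. by rewrite ![dot x _]dotC dotZl. Qed.

Lemma dotNr x y : dot x (- y) = - dot x y.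
Proof. by rewrite ![dot x _]dotC dotNl. Qed.

Lemma dotBr x y z : dot z (x - y) = dot z x - dot z y.
Proof. by rewrite ![dot z _]dotC dotBl. Qed.

Lemma dot0l x : dot 0 x = 0.
Proof. by rewrite -(scale0r x) dotZl mul0r. Qed.

Definition dotE := (dotDl, dotDr, dotBl, dotBr, dotZl, dotZr, dotNl, dotNr).

Lemma dot_ge0 x : 0 <= dot x x.
Proof. by apply: sumr_ge0 => i _; rewrite -expr2 sqr_ge0. Qed.

Lemma dot_eq0 x : dot x x = 0 -> x = 0.
Proof.
move=> /eqP; rewrite psumr_eq0 => [/allP x0|i _]; last by rewrite -expr2 sqr_ge0.
apply/rowP => i; rewrite mxE; apply/eqP.
by have := x0 i (mem_index_enum _); rewrite /= mulf_eq0 orbb.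
Qed.

Lemma norm2_ge0 x : 0 <= norm2 x.
Proof. exact: sqrtr_ge0. Qed.

Lemma norm2_sqr x : norm2 x ^+ 2 = dot x x.
Proof. by rewrite sqr_sqrtr// dot_ge0. Qed.

Lemma norm2Z (a : R) x : norm2 (a *: x) = `|a| * norm2 x.
Proof. by rewrite /norm2 !dotE mulrA -expr2 sqrtrM ?sqr_ge0// sqrtr_sqr. Qed.

Lemma norm2N x : norm2 (- x) = norm2 x.
Proof. by rewrite /norm2 !dotE opprK. Qed.

Lemma norm2_0 : norm2 (0 : 'rV[R]_d) = 0.
Proof. by rewrite /norm2 dot0l sqrtr0. Qed.

Lemma norm2_eq0 x : norm2 x = 0 -> x = 0.
Proof. by move=> x0; apply: dot_eq0; rewrite -norm2_sqr x0 expr0n. Qed.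

Lemma norm2_le x (r : R) : 0 <= r -> (norm2 x <= r) = (dot x x <= r ^+ 2).
Proof. by move=> r0; rewrite -norm2_sqr ler_pXn2r// nnegrE norm2_ge0. Qed.

Lemma cauchy_schwarz x y : dot x y <= norm2 x * norm2 y.
Proof.
have [x0|x0] := eqVneq (norm2 x) 0; first by rewrite (norm2_eq0 x0) dot0l norm2_0 mul0r.
have [y0|y0] := eqVneq (norm2 y) 0.
  by rewrite (norm2_eq0 y0) dotC dot0l norm2_0 mulr0.
have := dot_ge0 (norm2 y *: x - norm2 x *: y).
have -> : dot (norm2 y *: x - norm2 x *: y) (norm2 y *: x - norm2 x *: y) =
    2 * (norm2 x * norm2 y) * (norm2 x * norm2 y - dot x y).
  by rewrite !dotE -!norm2_sqr (dotC y x); ring.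
by rewrite pmulr_rge0 ?subr_ge0// !mulr_gt0// lt_neqAle eq_sym ?x0 ?y0 norm2_ge0.
Qed.

Lemma norm2D x y : norm2 (x + y) <= norm2 x + norm2 y.
Proof.
rewrite norm2_le ?addr_ge0 ?norm2_ge0// !dotE (dotC y x) -!norm2_sqr.
have := cauchy_schwarz x y; lra.
Qed.

Lemma normr_le_norm2 x : `|x| <= norm2 x.
Proof.
rewrite [leLHS]/Num.norm/= mx_normrE; apply: bigmax_le => [|[i j] _]; first exact: norm2_ge0.
rewrite /= ord1 -sqrtr_sqr ler_wsqrtr// /dot (bigD1 j)//= expr2 lerDl.
by apply: sumr_ge0 => k _; rewrite -expr2 sqr_ge0.
Qed.

Lemma dot_continuousl y : continuous (fun x : 'rV[R]_d => dot x y : R).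
Proof.
apply: continuous_big => [|i _ x]; first exact: add_continuous.
by apply: continuousM; [exact: coord_continuous|exact: cst_continuous].
Qed.

Lemma norm2_continuous : continuous (@norm2 R d : 'rV[R]_d -> R).
Proof.
move=> x; apply: continuous_comp; last exact: sqrt_continuous.
apply: (@continuous_big _ _ _ _ _ _ 'rV[R]_d) => [|i _ {}x]; first exact: add_continuous.
by apply: continuousM; exact: coord_continuous.
Qed.

Definition is_convex K := forall x y (l : R), 0 <= l -> l <= 1 ->
  K x -> K y -> K (l *: x + (1 - l) *: y).

Lemma convex_set_is_convex K :
  convex_set (K : set (convex_lmodType 'rV[R]_d)) -> is_convex K.
Proof.
move=> cK x y l l0 l1 /mem_set Kx /mem_set Ky.
have l01 : Itv.spec (@Itv.num_sem R) (Itv.Real `[0%Z, 1%Z]) l.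
  by rewrite /Itv.num_sem/= in_itv/= l0 l1 ger0_real.
have := cK x y (Itv.mk l01) Kx Ky.
by rewrite inE.
Qed.

Lemma compact_norm2_bounded K : compact K -> exists2 D : R, 0 <= D & forall x, K x -> norm2 x <= D.
Proof.
move=> cK; have [K0|/set0P K0] := eqVneq K set0.
  by exists 0 => // x; rewrite K0.
have [|a _ ha] := EVT_max_rV K0 cK (f := @norm2 R d).
  by apply: continuous_subspaceT; exact: norm2_continuous.
exists (norm2 a); first exact: norm2_ge0.
by move=> x Kx; apply: ha; exact: mem_set.
Qed.

End euclidean_geometry.

Section projection.
Variables (R : realType) (d : nat).
Implicit Types (x y s t p : 'rV[R]_d) (K : set 'rV[R]_d).

Definition convex_body K := [/\ K !=set0, compact K & is_convex K].

Lemma dot_subZ x y (l : R) :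
  dot (x - l *: y) (x - l *: y) = dot x x - 2 * l * dot x y + l ^+ 2 * dot y y.
Proof. by rewrite !dotE (dotC y x); ring. Qed.

Lemma norm2_sub_continuous x : continuous (fun t => norm2 (x - t) : R).
Proof.
move=> t; apply: continuous_comp; last exact: norm2_continuous.
by apply: continuousB; [exact: cst_continuous|exact: cvg_id].
Qed.

Lemma projP K x : convex_body K -> K (proj K x) /\
  forall s, K s -> norm2 (x - proj K x) ^+ 2 <= norm2 (x - s) ^+ 2.
Proof.
case=> K0 cK _; apply: (@xgetPex _ 0 [set t | K t /\
  forall s, K s -> norm2 (x - t) ^+ 2 <= norm2 (x - s) ^+ 2]).
have [|a /set_mem Ka ha] := EVT_min_rV K0 cK (f := fun t => norm2 (x - t)).
  by apply: continuous_subspaceT; exact: norm2_sub_continuous.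
exists a; split => // s Ks; rewrite ler_pXn2r// ?nnegrE ?norm2_ge0//.
by apply: ha; exact: mem_set.
Qed.

Lemma proj_obtuse K x s : convex_body K -> K s ->
  dot (x - proj K x) (s - proj K x) <= 0.
Proof.
move=> bK Ks; have [Kp hp] := projP x bK; case: bK => _ _ vK.
set p := proj K x in Kp hp *; rewrite leNgt; apply/negP => a0.
set a := dot _ _ in a0; pose b := dot (s - p) (s - p).
have b0 : 0 <= b := dot_ge0 _.
have ab0 : 0 < a + b by rewrite ltr_wpDr.
(* Any l in (0, 1] with l b < 2 a contradicts minimality of the projection; this choice also works
   when b = 0. *)
pose l := a / (a + b).
have l0 : 0 < l by rewrite divr_gt0.
have l1 : l <= 1 by rewrite ler_pdivrMr// mul1r lerDl.
have := hp _ (vK _ _ _ (ltW l0) l1 Ks Kp); rewrite !norm2_sqr.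
have -> : x - (l *: s + (1 - l) *: p) = (x - p) - l *: (s - p).
  by rewrite scalerBl scale1r scalerBr !opprD !opprK !addrA; congr (_ + _); rewrite addrAC.
rewrite dot_subZ -/b -/a => h.
have : l * (2 * a) <= l * (l * b) by move: h; lra.
rewrite ler_pM2l// leNgt => /negP; apply.
rewrite /l mulrAC ltr_pdivrMr//.
have := mulr_gt0 a0 a0; have := mulr_ge0 (ltW a0) b0; lra.
Qed.

(** Testing the obtuse-angle conditions at the two candidates against each other and adding gives |q
    - p|^2 <= 0. *)
Lemma proj_unique K x p : convex_body K -> K p ->
  (forall s, K s -> dot (x - p) (s - p) <= 0) -> proj K x = p.
Proof.
move=> bK Kp hp; have [Kq _] := projP x bK; have := proj_obtuse x bK Kp.
have := hp _ Kq; set q := proj K x in Kq *.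
rewrite -[dot (x - q) _]opprK -dotNr opprB => h1 h2.
apply/eqP; rewrite -subr_eq0; apply/eqP; apply: dot_eq0.
apply/eqP; rewrite eq_le dot_ge0 andbT.
have -> : dot (q - p) (q - p) = dot (x - p) (q - p) - dot (x - q) (q - p).
  by rewrite -dotBl opprB [x - p + _]addrC addrA subrK.
lra.
Qed.

(** The two obtuse-angle inequalities add up to |p - q|^2 <= <x - y, p - q>; Cauchy-Schwarz does the
    rest. *)
Lemma proj_lipschitz K x y : convex_body K ->
  norm2 (proj K x - proj K y) <= norm2 (x - y).
Proof.
move=> bK; have [Kp _] := projP x bK; have [Kq _] := projP y bK.
have := proj_obtuse x bK Kq; have := proj_obtuse y bK Kp.
set p := proj K x in Kp *; set q := proj K y in Kq *.
move=> h1 h2.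
have h : norm2 (p - q) * norm2 (p - q) <= norm2 (x - y) * norm2 (p - q).
  apply: le_trans (cauchy_schwarz _ _); rewrite -expr2 norm2_sqr.
  move: h1 h2; rewrite !dotE; lra.
have [->|pq0] := eqVneq (norm2 (p - q)) 0; first exact: norm2_ge0.
by move: h; rewrite ler_pM2r// lt0r pq0 norm2_ge0.
Qed.

Lemma proj_continuous K : convex_body K -> continuous (proj K : 'rV[R]_d -> 'rV[R]_d).
Proof.
move=> bK x; apply/(cvgrPdist_lt (FF := nbhs_filter x)) => e e0.
have /cvgrPdist_lt/(_ e e0) := @norm2_sub_continuous x x.
apply: filterS => y; rewrite subrr norm2_0.
rewrite sub0r normrN ger0_norm ?norm2_ge0// => xy.
apply: le_lt_trans (normr_le_norm2 _) _.
exact: le_lt_trans (proj_lipschitz _ _ bK) xy.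
Qed.

(** The vectors satisfying the obtuse-angle condition at a given point form a cone, the normal
    cone. *)
Lemma proj_ray K x (c : R) : 0 < c -> convex_body K ->
  proj K (proj K x + c *: (x - proj K x)) = proj K x.
Proof.
move=> c0 bK; have [Kp _] := projP x bK; apply: proj_unique => // s Ks.
by rewrite addrAC subrr add0r dotZl pmulr_rle0// proj_obtuse.
Qed.

Lemma scale_set_convex_body (a : R) K : convex_body K -> convex_body (scale_set a K).
Proof.
move=> [[k Kk] cK vK]; split.
- by exists (a *: k), k.
- apply: continuous_compact => //; apply: continuous_subspaceT => x.
  exact: scaler_continuous.
- move=> _ _ l l0 l1 [x Kx <-] [y Ky <-]; exists (l *: x + (1 - l) *: y); first exact: vK.
  by rewrite scalerDr !scalerA ![a * _]mulrC.
Qed.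

Lemma proj_scale_set (a : R) K x : 0 < a -> convex_body K ->
  proj (scale_set a K) x = a *: proj K (a^-1 *: x).
Proof.
move=> a0 bK; have [Kp _] := projP (a^-1 *: x) bK.
apply: proj_unique; [exact: scale_set_convex_body|by exists (proj K (a^-1 *: x))|].
move=> _ [s Ks <-]; rewrite -scalerBr dotZr.
rewrite (_ : x - _ = a *: (a^-1 *: x - proj K (a^-1 *: x))); last first.
  by rewrite scalerBr scalerA divff ?gt_eqF// scale1r.
by rewrite dotZl !pmulr_rle0//; exact: proj_obtuse.
Qed.

Definition support K g : R := sup [set dot x g | x in K].

Lemma support_attained K g : K !=set0 -> compact K ->
  exists t, [/\ K t, support K g = dot t g & forall s, K s -> dot s g <= dot t g].
Proof.
move=> K0 cK; have [|t /set_mem Kt ht] := EVT_max_rV K0 cK (f := fun x => dot x g).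
  by apply: continuous_subspaceT; exact: dot_continuousl.
have {}ht s : K s -> dot s g <= dot t g by move=> Ks; apply: ht; exact: mem_set.
exists t; split => //; apply/eqP; rewrite eq_le; apply/andP; split.
  by apply: ge_sup; [exists (dot t g), t|move=> _ [s Ks <-]; exact: ht].
apply: ub_le_sup; last by exists t.
by exists (dot t g) => _ [s Ks <-]; exact: ht.
Qed.

Lemma support_ge K g t : compact K -> K t -> dot t g <= support K g.
Proof.
move=> cK Kt; have [|s [_ -> hs]] := support_attained g _ cK; first by exists t.
exact: hs.
Qed.

Lemma support_ge0 K g : compact K -> K 0 -> 0 <= support K g.
Proof. by move=> cK K0; rewrite -(dot0l g); exact: support_ge. Qed.

Lemma support_le K g (D : R) : K !=set0 -> compact K -> (forall x, K x -> norm2 x <= D) ->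
  support K g <= D * norm2 g.
Proof.
move=> K0 cK KD; have [t [Kt -> _]] := support_attained g K0 cK.
apply: le_trans (cauchy_schwarz _ _) _.
by rewrite ler_wpM2r ?norm2_ge0// KD.
Qed.

Lemma support_continuous K : K !=set0 -> compact K -> continuous (support K : 'rV[R]_d -> R).
Proof.
move=> K0 cK; have [D D0 KD] := compact_norm2_bounded cK.
have lip g h : support K g - support K h <= D * norm2 (g - h).
  have [t [Kt -> _]] := support_attained g K0 cK.
  apply: (@le_trans _ _ (dot t (g - h))).
    by rewrite dotBr lerB// support_ge.
  apply: le_trans (cauchy_schwarz _ _) _.
  by rewrite ler_wpM2r ?norm2_ge0// KD.
move=> x; apply/(cvgrPdist_lt (FF := nbhs_filter x)) => e e0.
have D1 : 0 < D + 1 by rewrite ltr_wpDl.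
have /cvgrPdist_lt/(_ (e / (D + 1)) (divr_gt0 e0 D1)) := @norm2_sub_continuous x x.
apply: filterS => y; rewrite subrr norm2_0 sub0r normrN ger0_norm ?norm2_ge0//.
rewrite ltr_pdivlMr// mulrC; apply: le_lt_trans.
apply: (@le_trans _ _ (D * norm2 (x - y))).
  by rewrite ler_norml lip andbT lerNl opprB -[x - y]opprB norm2N lip.
by rewrite ler_wpM2r ?norm2_ge0// lerDl.
Qed.

(* For [0 < s] this is the maximum over [t] in [K] of [dot t g - norm2 t ^+ 2 / (2 * s)]. *)
Definition penalized_support K (s : R) g : R :=
  let p := proj K (s *: g) in dot p g - norm2 p ^+ 2 / (2 * s).

(** Completing the square, 2 s <t, g> - |t|^2 = s^2 |g|^2 - |s g - t|^2, so maximizing the penalized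
    functional is minimizing the distance to s g. *)
Lemma penalized_support_ge K (s : R) g t : 0 < s -> convex_body K -> K t ->
  dot t g - norm2 t ^+ 2 / (2 * s) <= penalized_support K s g.
Proof.
move=> s0 bK Kt; have [_ hp] := projP (s *: g) bK.
have s20 : 0 < 2 * s by rewrite mulr_gt0.
have E q : dot q g - norm2 q ^+ 2 / (2 * s) = (2 * s * dot q g - dot q q) / (2 * s).
  by rewrite -norm2_sqr; field; rewrite gt_eqF.
rewrite /penalized_support/= !E ler_pM2r ?invr_gt0//.
by have := hp _ Kt; rewrite !norm2_sqr !dotE !(dotC g); lra.
Qed.

Lemma penalized_support_le K (s : R) g : 0 < s -> convex_body K ->
  penalized_support K s g <= support K g.
Proof.
move=> s0 bK; have [Kp _] := projP (s *: g) bK; case: bK => K0 cK _.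
rewrite /penalized_support lerBlDr (le_trans (support_ge g cK Kp))// lerDl.
by rewrite divr_ge0 ?sqr_ge0// mulr_ge0// ltW.
Qed.

Lemma penalized_support_ge0 K (s : R) g : 0 < s -> convex_body K -> K 0 ->
  0 <= penalized_support K s g.
Proof.
move=> s0 bK K0; have := penalized_support_ge g s0 bK K0.
by rewrite dot0l norm2_0 expr0n mul0r subr0.
Qed.

End projection.

(** * Envelope theorem and integration of the derivative over a half-line *)

Section envelope.
Variable R : realType.
Variables (Q h : R -> R).
Hypothesis Qc : forall x, 0 < x -> {for x, continuous Q}.
Hypothesis hQ : forall x y, 0 < x -> 0 < y -> Q x / 2 * (x^-1 - y^-1) <= h y - h x.

(** [hQ] says that Q x / 2 is a subgradient at x of [h] regarded as a function of - 1 / x. Used at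
    (x, y) and at (y, x), it places the difference quotient of 2 h between Q x / (x y) and Q y / (x
    y), which share the limit Q x / x^2 by continuity of [Q]. *)
Lemma envelope_is_derive (x : R) : 0 < x ->
  is_derive x 1 (fun y => 2 * h y) (Q x / x ^+ 2).
Proof.
move=> x0; have xn0 : x != 0 by rewrite gt_eqF.
have cx : {for (0 : R), continuous (fun t : R => t + x)}.
  by apply: continuousD; [exact: cvg_id|exact: cst_continuous].
have cxV : {for (0 : R), continuous (fun t : R => (x * (t + x))^-1)}.
  apply: continuousV; first by rewrite add0r mulf_neq0.
  by apply: continuousM => //; exact: cst_continuous.
have cA : {for (0 : R), continuous (fun t : R => Q x * (x * (t + x))^-1)}.
  by apply: continuousM => //; exact: cst_continuous.
have cB : {for (0 : R), continuous (fun t : R => Q (t + x) * (x * (t + x))^-1)}.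
  apply: continuousM => //; apply: continuous_comp => //.
  by rewrite add0r; exact: Qc.
have lim : (fun t : R => t^-1 *: (2 * h (t *: (1 : R) + x) - 2 * h x)) @ 0^' --> Q x / x ^+ 2.
  apply/cvgrPdist_lt => e e0.
  have /cvgrPdist_lt/(_ e e0) := cA; have /cvgrPdist_lt/(_ e e0) := cB.
  rewrite add0r -expr2 => nB nA; near=> t.
  have t0 : t != 0 by near: t; exact: nbhs_dnbhs_neq.
  have tx : 0 < t + x.
    near: t; apply: nbhs_dnbhs; apply: cvgr_gt cx _ _; by rewrite add0r.
  have tA : `|Q x / x ^+ 2 - Q x / (x * (t + x))| < e by near: t; apply: nbhs_dnbhs.
  have tB : `|Q x / x ^+ 2 - Q (t + x) / (x * (t + x))| < e by near: t; apply: nbhs_dnbhs.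
  have txn0 : t + x != 0 by rewrite gt_eqF.
  have h1 := hQ x0 tx; have h2 := hQ tx x0.
  rewrite [t *: _]mulr1 [_ *: _]/GRing.scale/= -mulrBr.
  have dV : x^-1 - (t + x)^-1 = t / (x * (t + x)) by field; rewrite ?xn0 ?txn0.
  have dV' : (t + x)^-1 - x^-1 = - (t / (x * (t + x))) by rewrite -dV opprB.
  rewrite dV in h1; rewrite dV' in h2.
  move: tA tB; rewrite !ltr_norml => /andP[a1 a2] /andP[b1 b2].
  (* Division by a negative [t] exchanges the roles of the two bounds. *)
  have [tpos|tneg] := ltP 0 t.
    have l1 : Q x / (x * (t + x)) <= t^-1 * (2 * (h (t + x) - h x)).
      rewrite ler_pdivlMl// mulrA -[leLHS]mulrA.
      by move: h1; rewrite -!mulrA; lra.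
    have l2 : t^-1 * (2 * (h (t + x) - h x)) <= Q (t + x) / (x * (t + x)).
      rewrite ler_pdivrMl//; move: h2; lra.
    by apply/andP; split; lra.
  have {}tneg : t < 0 by rewrite lt_neqAle t0.
  have l1 : t^-1 * (2 * (h (t + x) - h x)) <= Q x / (x * (t + x)).
    rewrite ler_ndivrMl//; move: h1; lra.
  have l2 : Q (t + x) / (x * (t + x)) <= t^-1 * (2 * (h (t + x) - h x)).
    rewrite ler_ndivlMl//; move: h2; lra.
  by apply/andP; split; lra.
apply: DeriveDef; first by apply/cvg_ex; exists (Q x / x ^+ 2).
by apply: cvg_lim.
Unshelve. all: by end_near. Qed.

Lemma envelope_integral (w s : R) : 0 < s -> (forall x, 0 < x -> 0 <= Q x) ->
  h x @[x --> +oo] --> w ->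
  (\int[@lebesgue_measure R]_(x in `[s, +oo[) (Q x / x ^+ 2)%:E =
   (2 * (w - h s))%:E)%E.
Proof.
move=> s0 Q0 hw.
have dh x : 0 < x -> derivable (fun y => 2 * h y) x 1.
  by move=> /envelope_is_derive[].
rewrite (@ge0_continuous_FTC2y _ _ (fun y => 2 * h y) _ (2 * w)).
- by rewrite -EFinB mulrBr.
- by move=> x sx; rewrite divr_ge0 ?sqr_ge0// Q0// (lt_le_trans s0).
- apply: continuous_in_subspaceT => x; rewrite inE/= in_itv/= andbT => sx.
  have x0 := lt_le_trans s0 sx.
  have : {for x, continuous (fun y => Q y * (y ^+ 2)^-1)}; last exact.
  apply: continuousM; first exact: Qc.
  apply: continuousV; first by rewrite expf_neq0// gt_eqF.
  exact: exprn_continuous.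
- by apply: cvgM => //; exact: cvg_cst.
- by move=> x sx; apply: dh; exact: lt_trans sx.
- apply: cvg_at_right_filter.
  have /derivable1_diffP/differentiable_continuous := dh _ s0; exact.
- move=> x; rewrite in_itv/= andbT => sx.
  have [_] := envelope_is_derive (lt_trans s0 sx).
  by rewrite derive1E.
Qed.

End envelope.

(** * Lebesgue measure under linear maps *)

Section lebesgue_integral_vec.
Variable R : realType.
Local Notation TR := (measurableTypeR R).
Local Notation lam := (@lebesgue_measure R).

Definition diag_affine d (b a : 'rV[R]_d) (t : d.-tuple TR) : d.-tuple TR :=
  [tuple b ord0 i * tnth t i + a ord0 i | i < d].

Lemma measurable_tuple_affine d m (T : measurableType d) (n : nat)
    (u : T -> n.-tuple TR) (A : 'M[R]_(n, m)) (v : T -> m.-tuple TR) (B : 'M[R]_m) (a : 'rV[R]_m) :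
  measurable_fun [set: T] u -> measurable_fun [set: T] v ->
  measurable_fun [set: T] (fun x => tuple_of_vec
    (vec_of_tuple (u x) *m A + vec_of_tuple (v x) *m B + a)).
Proof.
move=> mu mv; apply/measurable_fun_tnthP => i.
rewrite (_ : _ \o _ = fun x => (\sum_j (tnth (u x) j * A j i) +
    \sum_j (tnth (v x) j * B j i) + a ord0 i)); last first.
  apply/funext => x; rewrite /= tnth_mktuple !mxE; congr (_ + _ + _);
    by apply: eq_bigr => j _; rewrite mxE.
apply: measurable_funD => //; apply: measurable_funD; apply: measurable_sum => j;
  apply: measurable_funM => //.
- exact: (measurableT_comp (measurable_tnth j) mu).
- exact: (measurableT_comp (measurable_tnth j) mv).
Qed.

Lemma measurable_diag_affine d (b a : 'rV[R]_d) :
  measurable_fun [set: d.-tuple TR] (diag_affine b a).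
Proof.
apply/measurable_fun_tnthP => i.
rewrite (_ : _ \o _ = fun t => b ord0 i * tnth t i + a ord0 i); last first.
  by apply/funext => t /=; rewrite tnth_mktuple.
apply: measurable_funD => //; apply: measurable_funM => //.
exact: measurable_tnth.
Qed.

Lemma integral_diag_affine d (b a : 'rV[R]_d) (f : d.-tuple TR -> \bar R) :
  (forall i, 0 < b ord0 i) ->
  measurable_fun [set: d.-tuple TR] f -> (forall t, 0 <= f t)%E ->
  (\int[tuple_measure lam d]_t f t =
   (\prod_i b ord0 i)%:E * \int[tuple_measure lam d]_t f (diag_affine b a t))%E.
Proof.
elim: d b a f => [|d IH] b a f b0 mf f0.
  rewrite big_ord0 mul1e; apply: eq_integral => t _; congr (f _).
  by rewrite tuple0 [RHS]tuple0.
have mfd : measurable_fun [set: d.+1.-tuple TR] (fun t => f (diag_affine b a t)).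
  exact: (measurableT_comp mf (measurable_diag_affine b a)).
rewrite !integral_tupleS//.
pose b' : 'rV[R]_d := \row_i b ord0 (lift ord0 i).
pose a' : 'rV[R]_d := \row_i a ord0 (lift ord0 i).
have consE x t : diag_affine b a (consT (x, t)) =
    consT (b ord0 ord0 * x + a ord0 ord0, diag_affine b' a' t).
  apply/eq_from_tnth => i; rewrite tnth_mktuple.
  have [j ->|->] := unliftP ord0 i; last by rewrite !tnth0.
  by rewrite !tnth_consT tnth_mktuple !mxE.
have b'0 i : 0 < b' ord0 i by rewrite mxE.
have -> : \prod_i b ord0 i = b ord0 ord0 * \prod_i b' ord0 i.
  by rewrite big_ord_recl; congr (_ * _); apply: eq_bigr => i _; rewrite mxE.
pose F x := (\int[tuple_measure lam d]_t f (consT (x, t)))%E.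
have FE x : F x = ((\prod_i b' ord0 i)%:E *
    \int[tuple_measure lam d]_t f (consT (x, diag_affine b' a' t)))%E.
  by apply: IH => //; exact: measurable_fun_consT_section.
have mF : measurable_fun setT F by exact: measurable_integral_consT.
have F0 x : (0 <= F x)%E by exact: integral_ge0.
rewrite [LHS](integral_affine (a ord0 ord0) (b0 ord0) mF F0).
rewrite EFinM -muleA; congr (_ * _)%E.
rewrite -ge0_integralZl//; last 3 first.
- exact: measurable_integral_consT mfd _.
- by move=> x _; exact: integral_ge0.
- by rewrite lee_fin prodr_ge0// => i _; exact: ltW.
apply: eq_integral => x _; rewrite FE; congr (_ * _)%E.
by apply: eq_integral => t _; rewrite consE.
Qed.

Local Notation gam := (normal_prob (0 : R) 1).

Definition sqrt2pi : R := Num.sqrt (2 * pi).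

Lemma sqrt2pi_gt0 : 0 < sqrt2pi.
Proof. by rewrite sqrtr_gt0 mulr_gt0// pi_gt0. Qed.

Lemma sqrt2pi_sqr : sqrt2pi ^+ 2 = 2 * pi.
Proof. by rewrite sqr_sqrtr// mulr_ge0// pi_ge0. Qed.

(** Substituting sqrt (2 pi) x turns the Gaussian density into exp (- pi x^2), the weight of the
    Wills functional, with no constant in front. *)
Lemma integral_normal_prob_scaled (f : TR -> \bar R) :
  measurable_fun [set: TR] f -> (forall x, 0 <= f x)%E ->
  (\int[gam]_x f x = \int[lam]_x (f (sqrt2pi * x + 0)%R * (expR (- pi * x ^+ 2))%:E))%E.
Proof.
move=> mf f0; rewrite integral_normal_prob//.
have mp : measurable_fun [set: TR] (fun x => (normal_pdf 0 1 x)%:E : \bar R).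
  by apply/measurable_EFinP; exact: measurable_normal_pdf.
rewrite (integral_affine 0 sqrt2pi_gt0); last 2 first.
- exact: emeasurable_funM.
- by move=> x; rewrite mule_ge0// lee_fin normal_pdf_ge0.
have maf := measurable_affine sqrt2pi 0.
rewrite -ge0_integralZl//; last 3 first.
- apply: emeasurable_funM; first exact: (measurableT_comp mf maf).
  exact: (measurableT_comp mp maf).
- by move=> x _; rewrite mule_ge0// lee_fin normal_pdf_ge0.
- by rewrite lee_fin ltW// sqrt2pi_gt0.
apply: eq_integral => x _; rewrite muleCA -EFinM; congr (_ * _%:E)%E.
rewrite addr0 normal_pdf01E /normal_peak expr1n mul1r -mulr_natl -/sqrt2pi.
rewrite mulrA divff ?gt_eqF ?sqrt2pi_gt0// mul1r; congr expR.
by rewrite exprMn sqrt2pi_sqr; field.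
Qed.

Lemma measurable_expR_sqr d (c : R) : measurable_fun [set: d.-tuple TR]
  (fun t => (expR (c * \sum_(i < d) tnth t i ^+ 2))%:E : \bar R).
Proof.
apply/measurable_EFinP; apply: measurableT_comp; first exact: measurable_expR.
apply: measurable_funM => //; apply: measurable_sum => i.
by apply: measurable_funX; exact: measurable_tnth.
Qed.

Lemma integral_gauss_lebesgue d (f : d.-tuple TR -> \bar R) :
  measurable_fun [set: d.-tuple TR] f -> (forall t, 0 <= f t)%E ->
  (\int[tuple_measure gam d]_t f t =
   \int[tuple_measure lam d]_t (f (diag_affine (const_mx sqrt2pi) 0 t) *
     (expR (- pi * \sum_(i < d) tnth t i ^+ 2))%:E))%E.
Proof.
elim: d f => [|d IH] f mf f0.
  have m1 : measurable_fun [set: 0.-tuple TR] (fun t => f (diag_affine (const_mx sqrt2pi) 0 t) *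
     (expR (- pi * \sum_(i < 0) tnth t i ^+ 2))%:E)%E.
    apply: emeasurable_funM; last exact: measurable_expR_sqr.
    exact: (measurableT_comp mf (measurable_diag_affine _ _)).
  rewrite !integral_tuple0// big_ord0 mulr0 expR0 mule1; congr (f _).
  by rewrite [RHS]tuple0.
have m1 n g : measurable_fun [set: n.-tuple TR] g -> measurable_fun [set: n.-tuple TR]
    (fun t => g (diag_affine (const_mx sqrt2pi) 0 t) *
     (expR (- pi * \sum_(i < n) tnth t i ^+ 2))%:E)%E.
  move=> mg; apply: emeasurable_funM; last exact: measurable_expR_sqr.
  exact: (measurableT_comp mg (measurable_diag_affine _ _)).
rewrite !integral_tupleS//; last 2 first.
- exact: m1.
- by move=> t; rewrite mule_ge0// lee_fin expR_ge0.
rewrite integral_normal_prob_scaled//; last 2 first.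
- exact: measurable_integral_consT.
- by move=> x; exact: integral_ge0.
apply: eq_integral => x _; rewrite IH//; last exact: measurable_fun_consT_section.
rewrite muleC -ge0_integralZl//; last 2 first.
- exact: (m1 d _ (measurable_fun_consT_section (sqrt2pi * x + 0) mf)).
- by move=> t _; rewrite mule_ge0// lee_fin expR_ge0.
apply: eq_integral => t _.
rewrite muleCA -EFinM -expRD big_ord_recl; congr (f _ * (expR _)%:E)%E.
  apply/eq_from_tnth => i; rewrite tnth_mktuple !mxE.
  have [j ->|->] := unliftP ord0 i; last by rewrite !tnth0.
  by rewrite !tnth_consT tnth_mktuple !mxE.
rewrite mulrDr; congr (_ * _ + _ * _).
by apply: eq_bigr => i _; rewrite tnth_consT.
Qed.

End lebesgue_integral_vec.

Section lebesgue_linear.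
Variables (R : realType) (d : nat).
Local Notation TR := (measurableTypeR R).
Local Notation lam := (@lebesgue_measure R).
Local Open Scope ereal_scope.
Implicit Types (f g : 'rV[R]_d -> \bar R) (x y : 'rV[R]_d) (A B : 'M[R]_d).

Definition vec_integral f : \bar R :=
  \int[tuple_measure lam d]_t f (vec_of_tuple t).

Definition vec_measurable f :=
  measurable_fun [set: d.-tuple TR] (fun t => f (vec_of_tuple t)).

Lemma eq_vec_integral f g : f =1 g -> vec_integral f = vec_integral g.
Proof. by move=> fg; apply: eq_integral => t _; rewrite fg. Qed.

Lemma measurable_vec_affine dd (T : measurableType dd) f (u v : T -> d.-tuple TR)
    A B (a : 'rV[R]_d) : vec_measurable f ->
  measurable_fun [set: T] u -> measurable_fun [set: T] v ->
  measurable_fun [set: T] (fun z =>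
    f (vec_of_tuple (u z) *m A + vec_of_tuple (v z) *m B + a)%R).
Proof.
move=> mf mu mv; have := measurableT_comp mf (measurable_tuple_affine A B a mu mv).
by apply: eq_measurable_fun => z _ /=; rewrite tuple_of_vecK.
Qed.

Lemma vec_measurable_affine f A (a : 'rV[R]_d) : vec_measurable f ->
  vec_measurable (fun x => f (x *m A + a)%R).
Proof.
move=> mf; have := measurable_vec_affine (T := d.-tuple TR) A 0 a mf
  (@measurable_id _ _ _) (@measurable_id _ _ _).
by apply: eq_measurable_fun => t _; rewrite mulmx0 addr0.
Qed.

Lemma vec_integral_diag f (b a : 'rV[R]_d) : (forall i, (0 < b ord0 i)%R) ->
  vec_measurable f -> (forall x, 0 <= f x) ->
  vec_integral f =
  (\prod_i b ord0 i)%R%:E * vec_integral (fun x => f (x *m diag_mx b + a)%R).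
Proof.
move=> b0 mf f0.
rewrite /vec_integral (integral_diag_affine a b0)//; congr (_ * _).
apply: eq_integral => t _; congr f; apply/rowP => i.
rewrite !mxE tnth_mktuple; congr (_ + _)%R.
rewrite (bigD1 i)//= big1 ?addr0 ?mxE ?eqxx ?mulr1n 1?mulrC//.
by move=> j ji; rewrite !mxE (negbTE ji) mulr0n mulr0.
Qed.

Lemma vec_integral_translate f (a : 'rV[R]_d) : vec_measurable f ->
  (forall x, 0 <= f x) -> vec_integral (fun x => f (x + a)%R) = vec_integral f.
Proof.
move=> mf f0; rewrite (@vec_integral_diag f (const_mx 1%R) a)//; last first.
  by move=> i; rewrite mxE.
rewrite big1 ?mul1e => [|i _]; last by rewrite mxE.
by apply: eq_vec_integral => x; rewrite diag_const_mx mulmx1.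
Qed.

(** The integrand is a product of functions of two linear forms in (x, y) so that joint
    measurability is settled once; [vec_integral_linear_aux] uses it with two different choices of
    the forms. *)
Lemma vec_integral_fubini f g A B A' B' :
  vec_measurable f -> vec_measurable g ->
  (forall x, 0 <= f x) -> (forall x, 0 <= g x) ->
  vec_integral (fun x => vec_integral (fun y =>
    f (x *m A + y *m B)%R * g (x *m A' + y *m B')%R)) =
  vec_integral (fun y => vec_integral (fun x =>
    f (x *m A + y *m B)%R * g (x *m A' + y *m B')%R)).
Proof.
move=> mf mg f0 g0; rewrite /vec_integral.
have mF : measurable_fun [set: d.-tuple TR * d.-tuple TR] (fun p =>
  f (vec_of_tuple p.1 *m A + vec_of_tuple p.2 *m B + 0)%R *
  g (vec_of_tuple p.1 *m A' + vec_of_tuple p.2 *m B' + 0)%R).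
  apply: emeasurable_funM;
    exact: (measurable_vec_affine _ _ _ _ measurable_fst measurable_snd).
have E x y C D : (x *m C + y *m D = x *m C + y *m D + 0)%R by rewrite addr0.
transitivity (\int[tuple_measure lam d]_s \int[tuple_measure lam d]_t
  (f (vec_of_tuple s *m A + vec_of_tuple t *m B + 0)%R *
   g (vec_of_tuple s *m A' + vec_of_tuple t *m B' + 0)%R)).
  by apply: eq_integral => s _; apply: eq_integral => t _; rewrite !addr0.
rewrite [LHS](fubini_tonelli (m1 := tuple_measure lam d) (m2 := tuple_measure lam d) _ mF).
  by apply: eq_integral => s _; apply: eq_integral => t _; rewrite /= !addr0.
by move=> p; exact: mule_ge0.
Qed.

Lemma vec_integralZl (k : \bar R) f : vec_measurable f -> (forall x, 0 <= f x) -> 0 <= k ->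
  vec_integral (fun x => k * f x) = k * vec_integral f.
Proof. by move=> mf f0 k0; rewrite /vec_integral ge0_integralZl. Qed.

Lemma vec_integral_ge0 f : (forall x, 0 <= f x) -> 0 <= vec_integral f.
Proof. by move=> f0; exact: integral_ge0. Qed.

Definition vec_gauss x : \bar R := (expR (- pi * dot x x))%:E.

Lemma vec_gauss_ge0 x : 0 <= vec_gauss x.
Proof. by rewrite lee_fin expR_ge0. Qed.

Lemma vec_gaussE (t : d.-tuple TR) :
  vec_gauss (vec_of_tuple t) = (expR (- pi * \sum_(i < d) tnth t i ^+ 2))%:E.
Proof.
congr (expR (_ * _))%:E; apply: eq_bigr => i _; rewrite !mxE.
by rewrite -expr2.
Qed.

Lemma vec_measurable_gauss : vec_measurable vec_gauss.
Proof.
have := @measurable_expR_sqr R d (- pi)%R.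
by apply: eq_measurable_fun => t _; rewrite vec_gaussE.
Qed.

Lemma vec_integral_gauss : vec_integral vec_gauss = 1.
Proof.
rewrite -(tuple_measure_normalT R d) -[RHS]mul1e -(integral_cst _ measurableT).
rewrite integral_gauss_lebesgue//; apply: eq_integral => t _.
by rewrite vec_gaussE mul1e.
Qed.

Local Opaque vec_integral vec_gauss.

(** Insert the Gaussian at y + x A, which has mass 1 in y, exchange the integrals, shift x, exchange
    back and shift y: the integrand becomes a product of a function of x and a function of y. *)
Lemma vec_integral_linear_aux f A : A \in unitmx ->
  vec_measurable f -> (forall x, 0 <= f x) ->
  vec_integral (fun x => f (x *m A)) =
  vec_integral (fun x => vec_gauss (x *m A)) * vec_integral (fun y => f (- y)%R).
Proof.
move=> uA mf f0; have mG := vec_measurable_gauss; have G0 := vec_gauss_ge0.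
have mlin g C : vec_measurable g -> vec_measurable (fun x => g (x *m C)).
  by move=> /(vec_measurable_affine C 0); apply: eq_measurable_fun => t _; rewrite addr0.
have mtr g a : vec_measurable g -> vec_measurable (fun x => g (x + a)%R).
  by move=> /(vec_measurable_affine 1%:M a); apply: eq_measurable_fun => t _; rewrite mulmx1.
have mopp a : vec_measurable (fun y => f (a - y)%R).
  have := vec_measurable_affine (- 1%:M)%R a mf.
  by apply: eq_measurable_fun => t _; rewrite mulmxN mulmx1 addrC.
transitivity (vec_integral (fun x => vec_integral (fun y =>
    f (x *m A + y *m 0)%R * vec_gauss (x *m A + y *m 1%:M)%R))).
  apply: eq_vec_integral => x.
  transitivity (f (x *m A) * vec_integral (fun y => vec_gauss (y + x *m A)%R)).
    by rewrite (vec_integral_translate (x *m A) mG G0) vec_integral_gauss mule1.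
  rewrite -(vec_integralZl (mtr _ (x *m A) mG) (fun y => G0 _) (f0 _)).
  by apply: eq_vec_integral => y; rewrite mulmx0 addr0 mulmx1 [(_ + y)%R]addrC.
rewrite (vec_integral_fubini _ _ _ _ mf mG f0 G0).
transitivity (vec_integral (fun y => vec_integral (fun x =>
    f (x *m A + y *m (- 1%:M))%R * vec_gauss (x *m A + y *m 0)%R))).
  apply: eq_vec_integral => y.
  pose F x := f (x *m A + y *m 0)%R * vec_gauss (x *m A + y *m 1%:M)%R.
  have mF : vec_measurable F.
    by apply: emeasurable_funM; exact: vec_measurable_affine.
  have F0 x : 0 <= F x by exact: mule_ge0.
  rewrite -[LHS](vec_integral_translate (- (y *m invmx A))%R mF F0).
  apply: eq_vec_integral => x; rewrite /F mulmxDl mulNmx -mulmxA mulVmx//.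
  by rewrite mulmxN !mulmx1 mulmx0 !addr0 subrK.
rewrite -(vec_integral_fubini _ _ _ _ mf mG f0 G0).
rewrite muleC -(vec_integralZl (mlin _ A mG) (fun x => G0 _) (vec_integral_ge0 (fun y => f0 _))).
apply: eq_vec_integral => x.
transitivity (vec_gauss (x *m A) * vec_integral (fun y => f (x *m A - y)%R)).
  rewrite -(vec_integralZl (mopp _) (fun y => f0 _) (G0 _)); apply: eq_vec_integral => y.
  by rewrite muleC mulmx0 addr0 mulmxN mulmx1.
rewrite muleC; congr (_ * _).
rewrite -(vec_integral_translate (x *m A) (mopp (x *m A)) (fun y => f0 _)).
by apply: eq_vec_integral => y; rewrite opprD addrCA subrr addr0.
Qed.

(* Haar uniqueness by Tonelli: the translation-invariant measure [S |-> vol {x | x A \in S}] is a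
   multiple of [vol]. *)
Lemma vec_integral_linear f A : A \in unitmx ->
  vec_measurable f -> (forall x, 0 <= f x) ->
  vec_integral (fun x => f (x *m A)) =
  vec_integral (fun x => vec_gauss (x *m A)) * vec_integral f.
Proof.
move=> uA mf f0; rewrite vec_integral_linear_aux//; congr (_ * _).
(* For A = 1 the auxiliary identity says that f and its reflection have the same integral, which
   removes the sign. *)
have := vec_integral_linear_aux (unitmx1 _ _) mf f0.
have E g : vec_integral (fun x => g (x *m 1%:M)) = vec_integral g.
  by apply: eq_vec_integral => x; rewrite mulmx1.
by rewrite !E vec_integral_gauss mul1e => ->.
Qed.

(** The unknown factors of Q and of its inverse multiply to 1, as the Gaussian composed with both
    shows, so only the diagonal part contributes. *)
Lemma vec_integral_diagonalizable f (Q : 'M[R]_d) (b : 'rV[R]_d) :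
  Q \in unitmx -> (forall i, (0 < b ord0 i)%R) ->
  vec_measurable f -> (forall x, 0 <= f x) ->
  vec_integral f = (\prod_i b ord0 i)%R%:E *
    vec_integral (fun x => f (x *m (invmx Q *m diag_mx b *m Q))).
Proof.
move=> uQ b0 mf f0.
have mlin g C : vec_measurable g -> vec_measurable (fun x => g (x *m C)).
  by move=> /(vec_measurable_affine C 0); apply: eq_measurable_fun => t _; rewrite addr0.
have uV : invmx Q \in unitmx by rewrite unitmx_inv.
pose c A := vec_integral (fun x => vec_gauss (x *m A)).
have cV : c (invmx Q) * c Q = 1.
  have := vec_integral_linear uV (mlin _ Q vec_measurable_gauss) (fun x => vec_gauss_ge0 _).
  move=> <-; rewrite -vec_integral_gauss; apply: eq_vec_integral => x.
  by rewrite -mulmxA mulVmx// mulmx1.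
have E : vec_integral (fun x => f (x *m (invmx Q *m diag_mx b *m Q))) =
    c (invmx Q) * vec_integral (fun x => f (x *m diag_mx b *m Q)).
  rewrite -vec_integral_linear//; last by apply: (mlin (fun x => f (x *m Q))); exact: mlin.
  by apply: eq_vec_integral => x; rewrite !mulmxA.
have -> : vec_integral f = c (invmx Q) * vec_integral (fun x => f (x *m Q)).
  by rewrite (vec_integral_linear uQ)// muleA -/(c _) cV mul1e.
rewrite E muleCA; congr (_ * _).
rewrite (vec_integral_diag 0 b0 (mlin _ Q mf))//; congr (_ * _).
by apply: eq_vec_integral => x; rewrite addr0.
Qed.

End lebesgue_linear.

Section orthogonal_scaling.
Variables (R : realType) (d : nat).
Implicit Types (x : 'rV[R]_d) (V : 'M[R]_d).

Lemma dotE_mx x y : x *m y^T = (dot x y)%:M :> 'M[R]_1.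
Proof.
apply/matrixP => i j; rewrite !ord1 !mxE mulr1n.
by apply: eq_bigr => k _; rewrite !mxE.
Qed.

(** The row space of this matrix is the orthogonal complement of the row space of [V]. *)
Definition orthmx V := kermx V^T.

Lemma capmx_orthmx V : (V :&: orthmx V)%MS = 0.
Proof.
apply/eqP; rewrite -submx0; apply/rV_subP => x; rewrite sub_capmx.
move=> /andP[/submxP[u ->] /sub_kermxP]; rewrite -mulmxA => uVV.
rewrite submx0; apply/eqP; apply: dot_eq0.
have : (u *m V) *m (u *m V)^T = 0 by rewrite trmx_mul !mulmxA -(mulmxA u) uVV mul0mx.
by rewrite dotE_mx => /matrixP/(_ 0 0); rewrite !mxE mulr1n.
Qed.

Lemma addmx_orthmx V : (V + orthmx V == 1%:M)%MS.
Proof.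
rewrite submx1 sub1mx /row_full mxrank_disjoint_sum ?capmx_orthmx//.
by rewrite mxrank_ker mxrank_tr subnKC ?rank_leq_row ?eqxx.
Qed.

Definition orthproj V := proj_mx V (orthmx V).

Lemma orthproj_id V x : (x <= V)%MS -> x *m orthproj V = x.
Proof. by apply: proj_mx_id; exact: capmx_orthmx. Qed.

Lemma orthproj_0 V x : x *m V^T = 0 -> x *m orthproj V = 0.
Proof.
move=> /sub_kermxP; apply: proj_mx_0; exact: capmx_orthmx.
Qed.

(** The rows of [V] are fixed and those of its complement are killed, so the eigenspaces for 1 and 0
    together fill the space. *)
Lemma orthproj_diagonalizable V : exists2 Q : 'M[R]_d, Q \in unitmx &
  exists e : 'I_d -> bool,
    orthproj V = invmx Q *m diag_mx (\row_i (e i)%:R) *m Q.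
Proof.
have PP : orthproj V *m orthproj V = orthproj V.
  exact: proj_mx_proj (capmx_orthmx V).
have /diagonalizablePeigen [Q uQ] : exists2 rs : seq R, uniq rs &
    (\sum_(r <- rs) eigenspace (orthproj V) r :=: 1%:M)%MS.
  exists [:: 1; 0]; first by rewrite /= inE oner_neq0.
  rewrite big_cons big_cons big_nil; apply/eqmxP; rewrite submx1/=.
  have /andP[_] := addmx_orthmx V; move/submx_trans; apply.
  apply: addsmxS; last first.
    apply: submx_trans (addsmxSl _ _); apply/eigenspaceP.
    by rewrite scale0r proj_mx_0 ?capmx_orthmx.
  by apply/eigenspaceP; rewrite scale1r proj_mx_id ?capmx_orthmx.
move=> /(diagonalizable_forLR uQ)[D]; rewrite mxpoly.conjumx ?unitmx_inv// invmxK => PE.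
(* Idempotence passes to [D], so each diagonal entry equals its square and is 0 or 1. *)
have DD : diag_mx D *m diag_mx D = diag_mx D.
  have : Q *m (orthproj V *m orthproj V) *m invmx Q = Q *m orthproj V *m invmx Q.
    by rewrite PP.
  by rewrite PE !mulmxA !(mulmxKV, mulmxK, mulmxV, mul1mx)//.
have D01 i : D ord0 i = (D ord0 i != 0)%:R.
  move/matrixP : DD => /(_ i i); rewrite mul_mx_diag !mxE eqxx mulr1n.
  by case: eqVneq => [->//|D0]; rewrite -[RHS]mul1r => /(mulIf D0).
exists Q => //; exists (fun i => D ord0 i != 0); rewrite PE; congr (_ *m diag_mx _ *m _).
by apply/rowP => i; rewrite mxE -D01.
Qed.

(** The map fixes the row space of [V] and dilates the orthogonal complement by rho. The exponent
    counts the zero eigenvalues of the orthogonal projection, hence is the same for all rho; this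
    uniformity produces a monomial in [vol_face_cell]. *)
Lemma vec_integral_orth_scaling V : exists2 k : nat, (k <= d)%N &
  forall rho : R, 0 < rho -> exists A : 'M[R]_d,
  [/\ A \in unitmx, forall x, (x <= V)%MS -> x *m A = x,
      forall x, x *m V^T = 0 -> x *m A = rho *: x &
      forall f : 'rV[R]_d -> \bar R, vec_measurable f -> (forall x, 0 <= f x)%E ->
        vec_integral f = ((rho ^+ k)%:E * vec_integral (fun x => f (x *m A)))%E].
Proof.
have [Q uQ [e PE]] := orthproj_diagonalizable V.
exists #|[pred i | ~~ e i]|; first by rewrite -[leqRHS]card_ord max_card.
move=> rho rho0.
pose b : 'rV[R]_d := \row_i (if e i then 1 else rho).
have b0 i : 0 < b ord0 i by rewrite mxE; case: ifP.
pose A := invmx Q *m diag_mx b *m Q; exists A.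
have AE : A = orthproj V + rho *: (1%:M - orthproj V).
  set D := diag_mx _ in PE.
  have -> : 1%:M - orthproj V = invmx Q *m (1%:M - D) *m Q.
    by rewrite PE mulmxBr mulmxBl mulmx1 mulVmx.
  rewrite PE scalemxAl scalemxAr -mulmxDl -mulmxDr.
  congr (_ *m _ *m _); apply/matrixP => i j; rewrite !mxE.
  by case: eqVneq => [->|_]; case: (e j); rewrite !(mulr1n, mulr0n) /=; ring.
split.
- rewrite !unitmx_mul unitmx_inv uQ/= andbT unitmxE det_diag unitfE.
  by apply/prodf_neq0 => i _; rewrite gt_eqF.
- by move=> x xV; rewrite AE mulmxDr -scalemxAr mulmxBr mulmx1 orthproj_id// subrr scaler0 addr0.
- by move=> x xV; rewrite AE mulmxDr -scalemxAr mulmxBr mulmx1 orthproj_0// subr0 add0r.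
- move=> f mf f0; rewrite (vec_integral_diagonalizable uQ b0 mf f0); congr (_%:E * _)%E.
  rewrite (bigID e)/= big1 => [|i ei]; last by rewrite mxE ei.
  rewrite mul1r (eq_bigr (fun=> rho)) => [|i /negbTE ei]; last by rewrite mxE ei.
  by rewrite prodr_const; congr (_ ^+ _); apply: eq_card.
Qed.

End orthogonal_scaling.

(** * Steiner's formula *)

Section volume.
Variables (R : realType) (d : nat).
Local Notation TR := (measurableTypeR R).
Implicit Types (x : 'rV[R]_d) (S K : set 'rV[R]_d).

Definition vec_measurable_set S :=
  measurable (@vec_of_tuple R d @^-1` S : set (d.-tuple TR)).

Lemma vec_measurable_indic S : vec_measurable_set S ->
  vec_measurable (fun x => (\1_S x)%:E).
Proof.
move=> mS; apply/measurable_EFinP.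
have := @measurable_indic _ (d.-tuple TR) R setT _ mS.
by apply: eq_measurable_fun => t _.
Qed.

Lemma volE S : vec_measurable_set S -> vol S = vec_integral (fun x => (\1_S x)%:E).
Proof.
move=> mS; rewrite /vol -[X in tuple_measure _ _ X]setIT.
rewrite -(integral_indic _ measurableT mS).
by apply: eq_integral => t _.
Qed.

Lemma le_vol S K : vec_measurable_set S -> vec_measurable_set K -> S `<=` K ->
  (vol S <= vol K)%E.
Proof. by move=> mS mK SK; rewrite le_measure ?inE// => t; exact: SK. Qed.

Definition distance K x : R := norm2 (x - proj K x).

Definition parallel_set K (r : R) : set 'rV[R]_d := [set x | distance K x <= r].

Lemma distance_continuous K : convex_body K -> continuous (distance K : 'rV[R]_d -> R).
Proof.
move=> bK x; apply: continuous_comp; last exact: norm2_continuous.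
by apply: continuousB; [exact: cvg_id|exact: proj_continuous].
Qed.

Lemma distance_le K x s : convex_body K -> K s -> distance K x <= norm2 (x - s).
Proof.
move=> bK Ks; have [_ /(_ _ Ks)] := projP x bK.
by rewrite ler_pXn2r// nnegrE norm2_ge0.
Qed.

Lemma parallel_set_closed K r : convex_body K -> closed (parallel_set K r).
Proof.
move=> bK; apply: (@preimage_closed _ _ (distance K) [set y | y <= r]).
  by move=> x _; exact: distance_continuous.
exact: closed_le.
Qed.

Lemma parallel_set_measurable K r : convex_body K -> vec_measurable_set (parallel_set K r).
Proof. by move=> bK; apply: measurable_vec_closed; exact: parallel_set_closed. Qed.

Lemma minkowski_sum_ball K (r : R) : 0 < r -> convex_body K ->
  minkowski_sum K (scale_set r (@ball2 R d)) = parallel_set K r.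
Proof.
move=> r0 bK; apply/seteqP; split => [_ [k Kk] [_ [x bx <-] <-]|x Kx].
  apply: (le_trans (distance_le _ bK Kk)).
  by rewrite addrAC subrr add0r norm2Z gtr0_norm// ger_pMr.
have [Kp _] := projP x bK.
exists (proj K x) => //; exists (x - proj K x); last by rewrite subrKC.
exists (r^-1 *: (x - proj K x)); last by rewrite scalerA divff ?gt_eqF// scale1r.
by rewrite /ball2/= norm2Z gtr0_norm ?invr_gt0// ler_pdivrMl// mulr1.
Qed.

(** The indicator of [S] is at most exp (pi r^2) times the Gaussian, whose integral is 1. *)
Lemma vol_bounded S (r : R) : 0 <= r -> vec_measurable_set S ->
  (forall x, S x -> norm2 x <= r) -> (vol S < +oo)%E.
Proof.
move=> r0 mS Sr; rewrite volE//.
have : (vec_integral (fun x => (\1_S x)%:E) <=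
    (expR (pi * r ^+ 2))%:E * vec_integral (@vec_gauss R d))%E.
  have e0 : (0 <= (expR (pi * r ^+ 2) : R)%:E)%E by rewrite lee_fin expR_ge0.
  rewrite -(vec_integralZl (@vec_measurable_gauss R d) (@vec_gauss_ge0 R d) e0).
  apply: ge0_le_integral => //.
  - exact: vec_measurable_indic.
  - apply: measurable_funeM; exact: vec_measurable_gauss.
  - move=> t _; move: (vec_of_tuple t) => x; rewrite -EFinM lee_fin indicE.
    have [|_] := boolP (x \in S); last by rewrite mulr_ge0 ?expR_ge0.
    rewrite inE => /Sr xr.
    rewrite -expRD mulNr -mulrBr -[leLHS]expR0 ler_expR mulr_ge0 ?pi_ge0//.
    by rewrite subr_ge0 -norm2_le//.
by move=> /le_lt_trans; apply; rewrite vec_integral_gauss mule1 ltry.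
Qed.

Lemma convex_body_bounded K : convex_body K ->
  exists2 D : R, 0 <= D & forall r x, 0 <= r -> parallel_set K r x -> norm2 x <= D + r.
Proof.
move=> bK; have [_ cK _] := bK; have [D D0 KD] := compact_norm2_bounded cK.
exists D => // r x r0 xr; rewrite -(subrK (proj K x) x) addrC.
apply: (le_trans (norm2D _ _)); apply: lerD => //.
by apply: KD; have [] := projP x bK.
Qed.

Lemma vol_parallel_lty K r : 0 <= r -> convex_body K -> (vol (parallel_set K r) < +oo)%E.
Proof.
move=> r0 bK; have [D D0 KD] := convex_body_bounded bK.
apply: (@vol_bounded _ (D + r)); first exact: addr_ge0.
  exact: parallel_set_measurable.
by move=> x; exact: KD.
Qed.

End volume.

Section polytope_steiner.
Variables (R : realType) (d n : nat) (a : 'I_n -> 'rV[R]_d) (b : 'I_n -> R).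
Implicit Types (x y p v : 'rV[R]_d) (I : {ffun 'I_n -> bool}).

Let P : set 'rV[R]_d := [set x | forall i, dot (a i) x <= b i].
Hypothesis bP : convex_body P.

Definition active_set x : {ffun 'I_n -> bool} :=
  [ffun i => dot (a i) (proj P x) == b i].

(** Directions of the face on which the constraints in [I] are tight. Inactive rows are set to 0 so
    that the matrix has the same shape for every [I]. *)
Definition face_dir I : 'M[R]_d :=
  kermx (\matrix_(i < n) (if I i then a i else 0))^T.

Lemma face_dirP I v : reflect (forall i, I i -> dot (a i) v = 0) (v <= face_dir I)%MS.
Proof.
have E i : (v *m (\matrix_(i < n) (if I i then a i else 0))^T) ord0 i =
    if I i then dot (a i) v else 0.
  rewrite !mxE; case: ifPn => Ii; last first.
    by rewrite big1// => j _; rewrite !mxE (negbTE Ii) mxE mulr0.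
  by apply: eq_bigr => j _; rewrite !mxE Ii mulrC.
rewrite /face_dir; apply: (iffP sub_kermxP) => [/rowP h i Ii|h].
  by have := h i; rewrite E Ii mxE.
by apply/rowP => i; rewrite E [RHS]mxE; case: ifPn => // /h.
Qed.

(* Inactive constraints leave room to move from [proj P x] in both directions [v] and [- v]. *)
Lemma sub_proj_orth x v : (v <= face_dir (active_set x))%MS -> dot (x - proj P x) v = 0.
Proof.
move=> /face_dirP av; have [Pp _] := projP x bP; set p := proj P x in Pp *.
pose s i := b i - dot (a i) p.
have s0 i : ~~ active_set x i -> 0 < s i.
  by rewrite ffunE -/p => h; rewrite subr_gt0 lt_neqAle h Pp.
(* 1 / S is at most the slack of each inactive constraint divided by |<a_i, v>| whenever the latter
   is nonzero; the summand 1 keeps [S] positive. *)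
pose S := 1 + \sum_(i < n | ~~ active_set x i) `|dot (a i) v| / s i.
have S0 : 0 < S.
  by rewrite ltr_wpDr// sumr_ge0// => i /s0 si; rewrite divr_ge0// ltW.
have inP (c : R) : `|c| <= S^-1 -> P (p + c *: v).
  move=> cS i; rewrite dotDr dotZr.
  have [Ii|Ii] := boolP (active_set x i); first by rewrite (av i Ii) mulr0 addr0.
  rewrite -lerBrDl -/(s i); apply: le_trans (ler_norm _) _; rewrite normrM.
  have [av0|av0] := eqVneq `|dot (a i) v| 0; first by rewrite av0 mulr0 ltW// s0.
  have avp : 0 < `|dot (a i) v| by rewrite lt0r av0 normr_ge0.
  rewrite -ler_pdivlMr//; apply: (le_trans cS).
  rewrite -[leRHS]invrK lef_pV2 ?posrE ?invr_gt0 ?divr_gt0 ?s0// invf_div /S.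
  rewrite (bigD1 i)//= addrCA lerDl addr_ge0// sumr_ge0// => j /andP[/s0 sj _].
  by rewrite divr_ge0// ltW.
have Sn : `|S^-1| <= S^-1 by rewrite gtr0_norm// invr_gt0.
have := proj_obtuse x bP (inP S^-1 Sn).
have := proj_obtuse x bP (inP (- S^-1) _); rewrite normrN => /(_ Sn).
have e (c : R) : p + c *: v - p = c *: v by rewrite addrAC subrr add0r.
rewrite -/p !e !dotZr mulNr oppr_le0 pmulr_rge0 ?invr_gt0// => h1.
rewrite pmulr_rle0 ?invr_gt0// => h2.
by apply/eqP; rewrite eq_le h1 h2.
Qed.

Definition face_cell I (r : R) : set 'rV[R]_d :=
  [set x | active_set x = I /\ distance P x <= r].

Lemma face_cell_ray I x (r c : R) : 0 < c ->
  face_cell I r x -> face_cell I (c * r) (proj P x + c *: (x - proj P x)).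
Proof.
move=> c0 [<- xr]; split; first by apply/ffunP => i; rewrite !ffunE proj_ray.
by rewrite /distance proj_ray// addrAC subrr add0r norm2Z gtr0_norm// ler_pM2l.
Qed.

Lemma face_cell_measurable I r : vec_measurable_set (face_cell I r).
Proof.
pose E i : set 'rV[R]_d := [set x | dot (a i) (proj P x) = b i].
have mE i : vec_measurable_set (E i).
  apply: measurable_vec_closed.
  apply: (@preimage_closed _ _ (fun x => dot (a i) (proj P x)) [set b i]).
    move=> x _; rewrite (_ : (fun x => _) = (fun y => dot y (a i)) \o proj P).
      by apply: continuous_comp; [exact: proj_continuous|exact: dot_continuousl].
    by apply/funext => y; rewrite /= dotC.
  by apply: accessible_closed_set1; apply: hausdorff_accessible; exact: Rhausdorff.
rewrite /vec_measurable_set (_ : _ @^-1` _ =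
  (\bigcap_(i in [set: 'I_n]) (if I i then @vec_of_tuple R d @^-1` E i
    else ~` (@vec_of_tuple R d @^-1` E i))) `&` @vec_of_tuple R d @^-1` parallel_set P r).
  apply: measurableI; last exact: parallel_set_measurable.
  apply: fin_bigcap_measurable => // i _; case: ifP => _; first exact: mE.
  by apply: measurableC; exact: mE.
apply/seteqP; split => [t [<- tr]|t [tI tr]]; split => //.
  by move=> i _; case: ifPn; rewrite ffunE => /eqP.
apply/ffunP => i; have := tI i Logic.I; rewrite ffunE; case: ifPn => _ /=.
  by move=> ->; rewrite eqxx.
by move=> /eqP/negbTE.
Qed.

(** Relative to a point q of the face, x - q is the sum of proj x - q, along the face, and x - proj
    x, orthogonal to it. The linear map fixing the first part and multiplying the second by r
    carries the cell of radius 1 onto the cell of radius r. *)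
Lemma vol_face_cell I : exists2 k : nat, (k <= d)%N &
  forall r : R, 0 < r -> (vol (face_cell I r) = (r ^+ k)%:E * vol (face_cell I 1))%E.
Proof.
have [k kd kP] := vec_integral_orth_scaling (face_dir I); exists k => // r r0.
rewrite !volE; try exact: face_cell_measurable.
have mF s := vec_measurable_indic (face_cell_measurable I s).
(* If no point has active set [I] the cell is empty for every radius and any exponent works. *)
have [[x0 x0I]|nI] := pselect (exists x, active_set x = I); last first.
  have E s : vec_integral (fun x => (\1_(face_cell I s) x)%:E) = (0 : \bar R)%E.
    rewrite /vec_integral integral0_eq// => t _; rewrite indicE memNset//.
    by move=> -[tI _]; apply: nI; eexists; exact: tI.
  by rewrite !E mule0.
pose q := proj P x0.
have [A [uA AV AO Aint]] := kP r r0.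
have f0 s x : (0 <= (\1_(face_cell I s) x)%:E :> \bar R)%E by rewrite lee_fin.
rewrite -(vec_integral_translate q (mF r) (f0 r)) -(vec_integral_translate q (mF 1) (f0 1)).
have mT : vec_measurable (fun x => (\1_(face_cell I r) (x + q))%:E).
  have := vec_measurable_affine 1%:M q (mF r).
  by apply: eq_measurable_fun => t _; rewrite mulmx1.
rewrite (Aint _ mT (fun x => f0 r _)); congr (_ * _)%E.
apply: eq_vec_integral => y; rewrite !indicE; congr ((_ : bool)%:R%:E).
have dirI x : active_set x = I -> (proj P x - q <= face_dir I)%MS.
  move=> xI; apply/face_dirP => i Ii; rewrite dotBr.
  move: (Ii); rewrite -xI ffunE => /eqP ->.
  by move: (Ii); rewrite -x0I ffunE => /eqP ->; rewrite subrr.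
have orthI x : active_set x = I -> (x - proj P x) *m (face_dir I)^T = 0.
  move=> xI; apply/rowP => i; rewrite !mxE.
  have : (row i (face_dir I) <= face_dir (active_set x))%MS by rewrite xI row_sub.
  move=> /sub_proj_orth; rewrite /dot => h; rewrite -[RHS]h.
  by apply: eq_bigr => j _; rewrite !mxE.
have mapI x : active_set x = I -> (x - q) *m A + q = proj P x + r *: (x - proj P x).
  move=> xI; rewrite -[x in LHS](subrK (proj P x)) -addrA mulmxDl.
  by rewrite (AO _ (orthI _ xI)) (AV _ (dirI _ xI)) -addrA subrK addrC.
apply/idP/idP; rewrite !inE => cell; last first.
  have := face_cell_ray r0 cell; rewrite mulr1.
  by have := mapI _ cell.1; rewrite addrK => ->.
(* Conversely, a point of the large cell is pulled back along its normal ray by the factor 1 / r;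
   injectivity of [A] identifies the result with the given preimage. *)
have rV0 : 0 < r^-1 by rewrite invr_gt0.
have rn0 : r != 0 by rewrite gt_eqF.
have := face_cell_ray rV0 cell; rewrite (mulVf rn0).
set z := y *m A + q in cell *; move=> cellz.
suff -> : y + q = proj P z + r^-1 *: (z - proj P z) by [].
set u := proj P z + _ in cellz *.
have uP : proj P u = proj P z by exact: proj_ray.
have uz : u - proj P z = r^-1 *: (z - proj P z) by rewrite /u addrAC subrr add0r.
have := mapI _ cellz.1; rewrite uP uz scalerA (divff rn0) scale1r subrKC /z => /addIr.
move=> /(congr1 (mulmx^~ (invmx A))); rewrite !mulmxK// => <-.
by rewrite subrK.
Qed.

End polytope_steiner.

Section steiner.
Variables (R : realType) (d : nat).
Implicit Types (x y : 'rV[R]_d) (K : set 'rV[R]_d).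

Definition polyhedron n (a : 'I_n -> 'rV[R]_d) (b : 'I_n -> R) : set 'rV[R]_d :=
  [set x | forall i, dot (a i) x <= b i].

(** The cells partition the parallel set and each has a monomial volume; the coefficient of r^i
    collects the cells with exponent i. *)
Lemma vol_parallel_polytope n (a : 'I_n -> 'rV[R]_d) (b : 'I_n -> R) :
  convex_body (polyhedron a b) -> exists c : 'rV[R]_d.+1, forall r : R, 0 < r ->
  vol (parallel_set (polyhedron a b) r) = (\sum_(i < d.+1) c ord0 i * r ^+ i)%:E.
Proof.
move=> bP; pose P := polyhedron a b.
have mcell := face_cell_measurable bP.
have volS r : (vol (parallel_set P r) = \sum_I vol (face_cell a b I r))%E.
  rewrite volE; last exact: parallel_set_measurable.
  under [RHS]eq_bigr => I _ do rewrite (volE (mcell I r)).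
  rewrite /vec_integral -ge0_integral_sum//; last first.
    by move=> I; exact: vec_measurable_indic.
  apply: eq_integral => t _; move: (vec_of_tuple t) => x.
  rewrite (bigD1 (active_set a b x))//= big1 ?adde0.
    rewrite !indicE; congr ((_ : bool)%:R%:E).
    by apply/idP/idP; rewrite !inE; [move=> xr; split|case].
  move=> I Ix; rewrite indicE memNset// => -[xI _].
  by move: Ix; rewrite -xI eqxx.
have fincell I r : 0 <= r -> vol (face_cell a b I r) \is a fin_num.
  move=> r0; rewrite ge0_fin_numE//; apply: le_lt_trans (vol_parallel_lty r0 bP).
  by apply: le_vol => //; [exact: parallel_set_measurable|move=> x []].
have /choice[k kP] (I : {ffun 'I_n -> bool}) : exists k : 'I_d.+1, forall r : R, 0 < r ->
    (vol (face_cell a b I r) = (r ^+ k)%:E * vol (face_cell a b I 1))%E.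
  have [k kd h] := vol_face_cell bP I.
  by exists (inord k) => r r0; rewrite inordK ?ltnS// h.
pose m I := fine (vol (face_cell a b I 1)).
exists (\row_i \sum_(I | k I == i) m I) => r r0.
rewrite volS (eq_bigr (fun I => (m I * r ^+ k I)%:E)) => [|I _]; last first.
  by rewrite kP// /m EFinM fineK ?fincell// muleC.
rewrite sumEFin; congr EFin.
rewrite (partition_big k xpredT)//=; apply: eq_bigr => i _.
by rewrite mxE mulr_suml; apply: eq_bigr => I /eqP <-.
Qed.

(** The points at distance exactly [e] from [K] form a compact set, and each is cut off from [K] by
    the half-space supporting [K] at its projection. Finitely many of these half-spaces suffice and
    define the polytope. *)
Lemma polytope_between K (e : R) : 0 < e -> convex_body K ->
  exists n (a : 'I_n -> 'rV[R]_d) (b : 'I_n -> R),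
  [/\ convex_body (polyhedron a b), K `<=` polyhedron a b
    & polyhedron a b `<=` parallel_set K e].
Proof.
move=> e0 bK; have [K0 cK vK] := bK.
pose S : set 'rV[R]_d := [set x | distance K x = e].
have cD := distance_continuous bK.
have [D D0 KD] := convex_body_bounded bK.
have bounded r (A : set 'rV[R]_d) : 0 <= r -> A `<=` parallel_set K r -> bounded_set A.
  move=> r0 Ar; exists (D + r); split => [|M DM x /Ar/(KD _ _ r0) xDr].
    by rewrite ger0_real// addr_ge0.
  by apply: le_trans (normr_le_norm2 _) (le_trans xDr (ltW DM)).
have cS : compact S.
  apply: bounded_closed_compact.
    by apply: (bounded e) => [|x]; [exact: ltW|rewrite /S/= /parallel_set/= => ->].
  apply: (@preimage_closed _ _ (distance K) [set e]) => [x _|]; first exact: cD.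
  by apply: accessible_closed_set1; apply: hausdorff_accessible; exact: Rhausdorff.
pose u z := z - proj K z.
pose O z : set 'rV[R]_d := [set x | dot (u z) (proj K z) < dot (u z) x].
have dotc z : continuous (fun x => dot (u z) x : R).
  move=> x; rewrite (_ : (fun x => _) = fun x => dot x (u z)).
    exact: dot_continuousl.
  by apply/funext => y; rewrite dotC.
have [F _ SF] : finite_subset_cover [set: 'rV[R]_d] O S.
  move: cS; rewrite compact_cover; apply.
    move=> z _; apply: (@open_comp _ _ (dot (u z)) [set y | dot (u z) (proj K z) < y]).
      by move=> x _; exact: dotc.
    exact: open_gt.
  move=> x Sx; exists x => //; rewrite /O/= -subr_gt0 -dotBr -norm2_sqr.
  by rewrite exprn_gt0// [norm2 _]Sx.
pose s : seq 'rV[R]_d := finmap.enum_fset F.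
pose a (i : 'I_(size s)) := u (tnth (in_tuple s) i).
pose b (i : 'I_(size s)) := dot (a i) (proj K (tnth (in_tuple s) i)).
exists (size s), a, b.
have KP : K `<=` polyhedron a b.
  by move=> x Kx i; rewrite -subr_le0 /b -dotBr; exact: proj_obtuse.
have vP : is_convex (polyhedron a b).
  move=> x y l l0 l1 xP yP i; rewrite dotDr !dotZr.
  rewrite (_ : b i = l * b i + (1 - l) * b i); last by ring.
  by apply: lerD; apply: ler_wpM2l; rewrite ?subr_ge0.
have Pe : polyhedron a b `<=` parallel_set K e.
  move=> x Px; rewrite /parallel_set/= leNgt; apply/negP => ex.
  have [Kp _] := projP x bK.
  have dx0 : 0 < distance K x by apply: lt_trans ex.
  (* Chosen so that the point [y] on the segment from [proj K x] to [x] has distance exactly [e];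
     convexity puts it in the polyhedron, although the cover excludes it. *)
  pose l := e / distance K x.
  have l0 : 0 < l by rewrite divr_gt0.
  have l1 : l <= 1 by rewrite ler_pdivrMr// mul1r ltW.
  pose y := proj K x + l *: (x - proj K x).
  have Py : polyhedron a b y.
    rewrite (_ : y = l *: x + (1 - l) *: proj K x); last first.
      by rewrite /y scalerBr scalerBl scale1r addrCA.
    exact: vP (ltW l0) l1 Px (KP _ Kp).
  have Sy : S y.
    rewrite /S/= /distance /y (proj_ray x l0 bK) addrAC subrr add0r norm2Z gtr0_norm//.
    by rewrite -/(distance K x) /l divfK// gt_eqF.
  have [z /= zF] := SF _ Sy; rewrite /O/=; apply/negP; rewrite -leNgt.
  have zs : z \in s by [].
  have zi : (index z s < size s)%N by rewrite index_mem.
  by have := Py (Ordinal zi); rewrite /b /a (tnth_nth 0) /= nth_index.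
split => //; split => //.
  by have [x Kx] := K0; exists x; exact: KP.
apply: bounded_closed_compact; first by apply: (bounded e) => //; exact: ltW.
rewrite (_ : polyhedron a b = \bigcap_(i in [set: 'I_(size s)]) [set x | dot (a i) x <= b i]).
  apply: closed_bigI => i _.
  apply: (@preimage_closed _ _ (dot (a i)) [set y | y <= b i]).
    by move=> x _; exact: dotc.
  exact: closed_le.
by apply/seteqP; split => [x Px i _|x Px i]; [exact: Px|exact: (Px i)].
Qed.

End steiner.

Section steiner_limit.
Variables (R : realType) (d : nat).
Local Notation lam := (@lebesgue_measure R).
Implicit Types (K L : set 'rV[R]_d).

Lemma parallel_set_sub K L (e r : R) : convex_body K -> convex_body L ->
  K `<=` L -> L `<=` parallel_set K e ->
  parallel_set K r `<=` parallel_set L r /\ parallel_set L r `<=` parallel_set K (r + e).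
Proof.
move=> bK bL KL LK; split => x.
  have [Kp _] := projP x bK; apply: le_trans.
  by apply: distance_le => //; exact: KL.
move=> xr; have [Lp _] := projP x bL; have [Kp _] := projP (proj L x) bK.
apply: (le_trans (distance_le x bK Kp)).
rewrite -(subrKA (proj L x)); apply: (le_trans (norm2D _ _)).
by apply: lerD; [exact: xr|exact: LK].
Qed.

Lemma vol_parallel_cvg K (r : R) : 0 < r -> convex_body K ->
  vol (parallel_set K (r + n.+1%:R^-1)) @[n --> \oo] --> vol (parallel_set K r).
Proof.
move=> r0 bK.
pose F n := @vec_of_tuple R d @^-1` parallel_set K (r + n.+1%:R^-1).
have -> : vol (parallel_set K r) = tuple_measure lam d (\bigcap_n F n).
  rewrite /vol; congr (tuple_measure _ _ _); apply/seteqP; split => t tr.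
    by move=> n _; apply: (le_trans tr); rewrite lerDl invr_ge0.
  rewrite /= /parallel_set/=; apply/ler_addgt0Pr => e e0.
  have [n _ /(_ n (leqnn _))/= ne] := near_infty_natSinv_lt (PosNum e0).
  by apply: (le_trans (tr n I)); rewrite lerD2l ltW.
apply: nonincreasing_cvg_mu.
- by apply: vol_parallel_lty => //; rewrite addr_ge0// ltW.
- by move=> n; exact: parallel_set_measurable.
- by apply: bigcapT_measurable => n; exact: parallel_set_measurable.
- move=> m n mn; apply/subsetPset => t; rewrite /F/= /parallel_set/= => /le_trans; apply.
  by rewrite lerD2l lef_pV2 ?posrE// ler_nat ltnS.
Qed.

(* Lagrange interpolation at [1, ..., d + 1]. *)
Lemma poly_limit (c : nat -> 'rV[R]_d.+1) (v : R -> R) :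
  (forall r, 0 < r -> (\sum_(i < d.+1) c n ord0 i * r ^+ i) @[n --> \oo] --> v r) ->
  exists c' : 'rV[R]_d.+1, forall r, 0 < r -> v r = \sum_(i < d.+1) c' ord0 i * r ^+ i.
Proof.
move=> cv; pose a : 'rV[R]_d.+1 := \row_j j.+1%:R.
pose V : 'M[R]_d.+1 := Vandermonde d.+1 a.
have uV : V \in unitmx.
  rewrite unitmxE det_Vandermonde unitfE; apply/prodf_neq0 => i _.
  apply/prodf_neq0 => j ij; rewrite subr_eq0 !mxE eqr_nat eqSS.
  by rewrite gtn_eqF.
pose c' : 'rV[R]_d.+1 := (\row_j v j.+1%:R) *m invmx V; exists c'.
have cc' i : c n ord0 i @[n --> \oo] --> c' ord0 i.
  rewrite mxE.
  rewrite (_ : (fun n => _) = fun n =>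
    \sum_(j < d.+1) (\sum_(k < d.+1) c n ord0 k * j.+1%:R ^+ k) * invmx V j i).
    apply: cvg_big => [|j _]; first exact: add_continuous.
    by apply: cvgM; [rewrite mxE; exact: cv|exact: cvg_cst].
  apply/funext => n; rewrite -[in LHS](mulmxK uV (c n)) mxE.
  apply: eq_bigr => j _; congr (_ * _); rewrite mxE.
  by apply: eq_bigr => k _; rewrite !mxE.
move=> r r0; apply: (cvg_unique _ (cv r r0)); first exact: Rhausdorff.
apply: cvg_big => [|i _]; first exact: add_continuous.
by apply: cvgM; [exact: cc'|exact: cvg_cst].
Qed.

(** Polytopes within 1/(n+1) of [K] have polynomial parallel volumes of degree at most d, squeezed
    by continuity from above of the measure; a pointwise limit of such polynomials is again one. *)
Lemma vol_parallel_polynomial K : convex_body K -> exists c : 'rV[R]_d.+1,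
  forall r : R, 0 < r -> vol (parallel_set K r) = (\sum_(i < d.+1) c ord0 i * r ^+ i)%:E.
Proof.
move=> bK.
have fin r : 0 < r -> vol (parallel_set K r) \is a fin_num.
  move=> r0; rewrite ge0_fin_numE ?measure_ge0//.
  by apply: vol_parallel_lty => //; exact: ltW.
have /choice[c cP] n : exists c : 'rV[R]_d.+1, forall r : R, 0 < r ->
    (vol (parallel_set K r) <= (\sum_(i < d.+1) c ord0 i * r ^+ i)%:E <=
     vol (parallel_set K (r + n.+1%:R^-1)))%E.
  have n0 : 0 < n.+1%:R^-1 :> R by [].
  have [m [a [b [bP KP PK]]]] := polytope_between n0 bK.
  have [c cE] := vol_parallel_polytope bP; exists c => r r0; rewrite -cE//.
  have [s1 s2] := parallel_set_sub r bK bP KP PK.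
  by rewrite !le_vol//; exact: parallel_set_measurable.
have [|c' c'P] := @poly_limit c (fun r => fine (vol (parallel_set K r))).
  move=> r r0; apply: (@squeeze_cvgr _ _ _ _ (cst (fine (vol (parallel_set K r))))
      (fun n => fine (vol (parallel_set K (r + n.+1%:R^-1))))).
  - apply: nearW => n; rewrite -!lee_fin !fineK ?fin//; first exact: cP.
    by rewrite addr_gt0.
  - exact: cvg_cst.
  - apply: fine_cvg; rewrite fineK ?fin//; exact: vol_parallel_cvg.
by exists c' => r r0; rewrite -c'P// fineK// fin.
Qed.

End steiner_limit.

(** * The Wills functional as a Gaussian expectation *)

Section gaussian_tail.
Variable R : realType.
Local Notation lam := (@lebesgue_measure R).

(** Minus the derivative of exp (- pi r^2), so that its integral over [s, oo) is exp (- pi s^2) for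
    s >= 0. *)
Definition rayleigh (r : R) : R := 2 * pi * r * expR (- pi * r ^+ 2).

Lemma rayleigh_ge0 r : 0 <= r -> 0 <= rayleigh r.
Proof. by move=> r0; rewrite !mulr_ge0 ?expR_ge0 ?pi_ge0. Qed.

Lemma measurable_rayleigh : measurable_fun [set: measurableTypeR R] rayleigh.
Proof.
apply: measurable_funM; first exact: measurable_funM.
apply: measurableT_comp; first exact: measurable_expR.
by apply: measurable_funM => //; exact: measurable_funX.
Qed.

Lemma is_derive_rayleigh (r : R) :
  is_derive r 1 (fun x => - expR (- pi * x ^+ 2)) (rayleigh r).
Proof.
rewrite (_ : (fun x => _) = - (expR \o ((- pi) *: ((@id R) ^+ 2)))) //.
apply: is_derive_eq.
rewrite /rayleigh (_ : (- pi *: id ^+ 2) r = - pi * r ^+ 2)//.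
by rewrite /GRing.scale/= expr1; ring.
Qed.

Lemma integral_rayleigh (s : R) : 0 <= s ->
  (\int[lam]_(r in `[s, +oo[) (rayleigh r)%:E = (expR (- pi * s ^+ 2))%:E)%E.
Proof.
move=> s0; have dF := is_derive_rayleigh.
have cF x : {for x, continuous (fun x : R => - expR (- pi * x ^+ 2))}.
  by apply: differentiable_continuous; apply/derivable1_diffP; case: (dF x).
rewrite (@ge0_continuous_FTC2y _ _ (fun x => - expR (- pi * x ^+ 2)) _ 0).
- by rewrite sub0e -EFinN opprK.
- by move=> x sx; apply: rayleigh_ge0; exact: le_trans sx.
- apply: continuous_subspaceT => x.
  have : {for x, continuous rayleigh}; last exact.
  apply: continuousM; first by apply: continuousM; [exact: cst_continuous|exact: cvg_id].
  apply: continuous_comp; last exact: continuous_expR.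
  by apply: continuousM; [exact: cst_continuous|exact: exprn_continuous].
- rewrite -[X in _ --> X]oppr0; apply: cvgN.
  rewrite (_ : (fun x => _) = (fun y => expR (- y)) \o (fun x => x ^+ 2 * pi)); last first.
    by apply/funext => x /=; rewrite mulNr mulrC.
  have cy : (x ^+ 2 * pi : R) @[x --> +oo] --> +oo.
    by apply: gt0_cvgMly; [exact: pi_gt0|exact: cvgr_expr2].
  exact: (cvg_comp (fun x : R => x ^+ 2 * pi) (fun y => expR (- y)) cy (@cvgr_expR R)).
- by move=> x _; case: (dF x).
- by apply: cvg_at_right_filter; exact: cF.
- by move=> x _; have [_] := dF x; rewrite derive1E.
Qed.
End gaussian_tail.

Section wills.
Variable R : realType.
Local Notation lam := (@lebesgue_measure R).

Lemma measurable_distance d (K : set 'rV[R]_d) : convex_body K ->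
  measurable_fun [set: d.-tuple (measurableTypeR R)]
    (fun t => distance K (vec_of_tuple t)).
Proof. by move=> bK; apply: measurable_vec_continuous; exact: distance_continuous. Qed.

Lemma distance_ge0 d (K : set 'rV[R]_d) x : 0 <= distance K x.
Proof. exact: norm2_ge0. Qed.

(** exp (- pi dist^2) is the integral of [rayleigh] over the radii r >= dist; exchanging the
    integrals leaves, for each r, the volume of the points with dist <= r. *)
Lemma vec_integral_distance d (K : set 'rV[R]_d) : convex_body K ->
  (vec_integral (fun x => (expR (- pi * distance K x ^+ 2))%:E) =
   \int[lam]_(r in `[0%R, +oo[) (vol (parallel_set K r) * (rayleigh r)%:E))%E.
Proof.
move=> bK; have mD := measurable_distance bK.
pose T := (d.-tuple (measurableTypeR R))%type.
pose S : set (T * measurableTypeR R) := [set p | distance K (vec_of_tuple p.1) <= p.2].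
have mS : measurable S.
  have m1 : measurable_fun [set: T * measurableTypeR R] (fun p => distance K (vec_of_tuple p.1)).
    by apply: measurableT_comp mD _; exact: measurable_fst.
  have := measurable_fun_ler m1 measurable_snd; move=> /(_ measurableT [set true]).
  by rewrite setTI; apply.
pose G (p : T * measurableTypeR R) : \bar R :=
  ((\1_S p)%:E * ((rayleigh p.2)%:E * (\1_`[0%R, +oo[%classic p.2)%:E))%E.
have mw : measurable_fun [set: measurableTypeR R]
    (fun r : R => ((rayleigh r)%:E * (\1_`[0%R, +oo[%classic r)%:E)%E).
  apply: emeasurable_funM; apply/measurable_EFinP; first exact: measurable_rayleigh.
  exact: measurable_indic.
have w0 (r : R) : (0 <= (rayleigh r)%:E * (\1_`[0%R, +oo[%classic r)%:E)%E.
  rewrite indicE; have [|_] := boolP (_ \in _); last by rewrite mule0.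
  by rewrite inE/= in_itv/= andbT => r0; rewrite mule1 lee_fin rayleigh_ge0.
have mG : measurable_fun [set: T * measurableTypeR R] G.
  apply: emeasurable_funM; first by apply/measurable_EFinP; exact: measurable_indic.
  exact: (measurableT_comp mw measurable_snd).
have G0 p : (0 <= G p)%E by rewrite mule_ge0// lee_fin.
transitivity (\int[tuple_measure lam d]_t \int[lam]_r G (t, r))%E.
  apply: eq_integral => t _; rewrite -integral_rayleigh ?distance_ge0//.
  rewrite integral_mkcond; apply: eq_integral => r _.
  rewrite /G/= patchE !indicE; case: ifPn => [|/negP] tr.
    rewrite mem_set ?mul1e; last by move: tr; rewrite inE/= in_itv/= andbT.
    rewrite mem_set ?mule1// /= in_itv/= andbT.
    by move: tr; rewrite inE/= in_itv/= andbT; apply: le_trans; exact: distance_ge0.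
  rewrite memNset ?mul0e// => tr'; apply: tr.
  by rewrite inE/= in_itv/= andbT.
rewrite [LHS](fubini_tonelli (m1 := tuple_measure lam d) (m2 := lam) G)//.
rewrite [RHS]integral_mkcond; apply: eq_integral => r _.
rewrite /G/= [LHS]ge0_integralZr//; last first.
  apply/measurable_EFinP; apply: measurableT_comp (measurable_indic mS) _.
  exact: measurable_fun_pair.
have -> : (\int[tuple_measure lam d]_t (\1_S (t, r))%:E = vol (parallel_set K r))%E.
  by rewrite volE//; exact: parallel_set_measurable.
rewrite patchE indicE; case: ifPn => _; first by rewrite mule1.
by rewrite !mule0.
Qed.

Lemma convex_body_set1 d (x : 'rV[R]_d) : convex_body [set x].
Proof.
split; [by exists x|exact: compact_set1|].
by move=> _ _ l _ _ -> ->; rewrite -scalerDl subrKC scale1r.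
Qed.

Lemma distance_set0 d (x : 'rV[R]_d) : distance [set 0] x = norm2 x.
Proof. by rewrite /distance; have [-> _] := projP x (convex_body_set1 0); rewrite subr0. Qed.

Lemma vol_parallel_set0 d (r : R) : 0 < r ->
  (vol (parallel_set [set (0 : 'rV[R]_d)%R] r) = (r ^+ d)%:E * vol (@ball2 R d))%E.
Proof.
move=> r0; have m0 s := parallel_set_measurable s (convex_body_set1 (0 : 'rV[R]_d)).
have -> : @ball2 R d = parallel_set [set 0] 1.
  by apply/seteqP; split => x; rewrite /ball2/parallel_set/= distance_set0.
rewrite !volE//.
rewrite (vec_integral_diag (b := const_mx r) 0 _ (vec_measurable_indic (m0 r))); last 2 first.
- by move=> i; rewrite mxE.
- by move=> x; rewrite lee_fin.
congr (_%:E * _)%E.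
  by rewrite (eq_bigr (fun=> r)) => [|i _]; rewrite ?mxE// prodr_const card_ord.
apply: eq_vec_integral => x; rewrite !indicE; congr ((_ : bool)%:R%:E).
have E : (distance [set 0] (x *m diag_mx (const_mx r) + 0) <= r) = (distance [set 0] x <= 1).
  rewrite !distance_set0 addr0 diag_const_mx mul_mx_scalar norm2Z gtr0_norm//.
  by rewrite -ler_pdivlMl// mulVf// gt_eqF.
by apply/idP/idP; rewrite !inE /parallel_set/= E.
Qed.

Definition rayleigh_moment j : \bar R :=
  (\int[lam]_(r in `[0%R, +oo[) (r ^+ j * rayleigh r)%:E)%E.

Lemma measurable_rayleigh_moment j :
  measurable_fun (`[0, +oo[%classic : set (measurableTypeR R))
    (fun r : R => (r ^+ j * rayleigh r)%:E).
Proof.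
apply: measurable_funTS; apply/measurable_EFinP.
by apply: measurable_funM; [exact: measurable_funX|exact: measurable_rayleigh].
Qed.

(** [vec_integral_distance] for K = {0}, where the left side is the Gaussian integral 1. This shows
    kappa_j <> 0 and gives the moment as 1 / kappa_j. *)
Lemma vol_ball_rayleigh_moment j : (vol (@ball2 R j) * rayleigh_moment j = 1)%E.
Proof.
rewrite -(vec_integral_gauss R j).
transitivity (vec_integral (fun x : 'rV[R]_j => (expR (- pi * distance [set 0] x ^+ 2))%:E)).
  rewrite vec_integral_distance; last exact: convex_body_set1.
  rewrite /rayleigh_moment -ge0_integralZl//; last 2 first.
  - exact: measurable_rayleigh_moment.
  - move=> r; rewrite /= in_itv/= andbT => r0.
    by rewrite lee_fin mulr_ge0 ?exprn_ge0 ?rayleigh_ge0.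
  apply: eq_integral => r; rewrite inE/= in_itv/= andbT le_eqVlt => /predU1P[<-|r0].
    by rewrite /rayleigh mulr0 !mul0r mulr0 !mule0.
  by rewrite vol_parallel_set0// EFinM muleA [(_ * vol _)%E]muleC.
by apply: eq_vec_integral => x; rewrite distance_set0 norm2_sqr.
Qed.

Lemma vol_ball_fin_num j : vol (@ball2 R j) \is a fin_num.
Proof.
have m0 := parallel_set_measurable 1 (convex_body_set1 (0 : 'rV[R]_j)).
rewrite ge0_fin_numE ?measure_ge0//.
have -> : @ball2 R j = parallel_set [set 0] 1.
  by apply/seteqP; split => x; rewrite /ball2/parallel_set/= distance_set0.
by apply: vol_parallel_lty => //; exact: convex_body_set1.
Qed.

Lemma kappa_neq0 j : kappa R j != 0.
Proof.
apply/eqP => k0; have := vol_ball_rayleigh_moment j.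
rewrite -(fineK (vol_ball_fin_num j)) -/(kappa R j) k0 mul0e => /esym/eqP.
by rewrite onee_eq0.
Qed.

Lemma rayleigh_momentE j : rayleigh_moment j = ((kappa R j)^-1)%:E.
Proof.
have := vol_ball_rayleigh_moment j; rewrite -(fineK (vol_ball_fin_num j)) -/(kappa R j).
move=> /(congr1 (fun x => ((kappa R j)^-1)%:E * x)%E).
by rewrite muleA -EFinM mulVf ?kappa_neq0// mul1e mule1.
Qed.

Lemma intrinsic_volumesP d (K : set 'rV[R]_d) : convex_body K -> forall r : R, 0 < r ->
  vol (parallel_set K r) =
  (\sum_(i < d.+1) kappa R (d - i) * intrinsic_volumes K i * r ^+ (d - i))%:E.
Proof.
move=> bK; have [c cP] := vol_parallel_polynomial bK.
have : [set V : 'I_d.+1 -> R | forall rho : R, 0 < rho ->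
    vol (minkowski_sum K (scale_set rho (@ball2 R d))) =
      (\sum_(i < d.+1) kappa R (d - i) * V i * rho ^+ (d - i))%:E] !=set0.
  (* Index i goes with the power d - i in Steiner's formula, hence the reversed coefficient. *)
  exists (fun i : 'I_d.+1 => (kappa R (d - i))^-1 * c ord0 (rev_ord i)) => r r0.
  rewrite minkowski_sum_ball// cP//; congr EFin.
  rewrite (reindex_inj rev_ord_inj)/=; apply: eq_bigr => i _.
  by rewrite mulrA divff ?kappa_neq0// mul1r subSS.
move=> /(xgetPex (fun=> 0)) => h r r0.
by rewrite -(minkowski_sum_ball r0 bK); exact: h.
Qed.

(** Integrating Steiner's formula against [rayleigh], the moment of order d - i is 1 / kappa_(d-i),
    which leaves exactly V_i. *)
Lemma willsE d (K : set 'rV[R]_d) : convex_body K ->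
  (wills K)%:E = vec_integral (fun x => (expR (- pi * distance K x ^+ 2))%:E).
Proof.
move=> bK; rewrite vec_integral_distance//.
pose V := intrinsic_volumes K.
pose c (i : 'I_d.+1) := kappa R (d - i) * V i.
have mi (i : 'I_d.+1) : lam.-integrable `[0, +oo[
    (fun r : R => (r ^+ (d - i) * rayleigh r)%:E).
  apply/integrableP; split; first exact: measurable_rayleigh_moment.
  suff -> : (\int[lam]_(x in `[0%R, +oo[) `|(x ^+ (d - i) * rayleigh x)%:E| =
      rayleigh_moment (d - i))%E by rewrite rayleigh_momentE ltry.
  apply: eq_integral => r; rewrite inE/= in_itv/= andbT => r0.
  by rewrite ger0_norm// mulr_ge0 ?exprn_ge0 ?rayleigh_ge0.
transitivity (\int[lam]_(r in `[0%R, +oo[)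
    \sum_(i < d.+1) (c i)%:E * ((r : R) ^+ (d - i) * rayleigh r)%:E)%E; last first.
  (* Steiner's formula is available for r > 0 only; at r = 0 both sides vanish because [rayleigh]
     does. *)
  apply: eq_integral => r; rewrite inE/= in_itv/= andbT le_eqVlt => /predU1P[<-|r0].
    rewrite /rayleigh mulr0 mul0r mule0 big1// => i _.
    by rewrite mulr0 mule0.
  rewrite intrinsic_volumesP// -EFinM mulr_suml -sumEFin; apply: eq_bigr => i _.
  by rewrite -EFinM mulrA.
rewrite integral_sum//; last by move=> i; apply: integrableZl.
rewrite /wills -sumEFin; apply: eq_bigr => i _.
rewrite integralZl//.
rewrite -/(rayleigh_moment (d - i)) rayleigh_momentE -EFinM.
by rewrite /c mulrAC divff ?kappa_neq0// mul1r.
Qed.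

End wills.

Section gaussian_width.
Variables (R : realType) (d : nat).
Local Notation TR := (measurableTypeR R).
Local Notation gam := (normal_prob (0 : R) 1).
Local Notation gaussd := (tuple_measure gam d).
Implicit Types (g x : 'rV[R]_d) (S : set 'rV[R]_d).

Lemma EgaussE (f : 'rV[R]_d -> R) :
  Egauss f = (\int[gaussd]_t (f (vec_of_tuple t))%:E)%E.
Proof. by rewrite /Egauss unlock. Qed.

Lemma measurable_support S : S !=set0 -> compact S ->
  measurable_fun [set: d.-tuple TR] (fun t => (support S (vec_of_tuple t))%:E : \bar R).
Proof.
move=> S0 cS; apply/measurable_EFinP.
by apply: measurable_vec_continuous; exact: support_continuous.
Qed.

Lemma penalized_support_continuous S (s : R) : convex_body S ->
  continuous (penalized_support S s : 'rV[R]_d -> R).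
Proof.
move=> bS; have cp : continuous (fun g => proj S (s *: g) : 'rV[R]_d).
  move=> g; apply: continuous_comp; last exact: proj_continuous.
  exact: scaler_continuous.
have cdot : continuous (fun g => dot (proj S (s *: g)) g : R).
  apply: continuous_big => [|i _ g]; first exact: add_continuous.
  apply: continuousM; last exact: coord_continuous.
  exact: (continuous_comp (cp g) (@coord_continuous R 1 d ord0 i (proj S (s *: g)))).
have cn : continuous (fun g => norm2 (proj S (s *: g)) : R).
  move=> g; exact: (continuous_comp (cp g) (@norm2_continuous R d (proj S (s *: g)))).
have -> : penalized_support S s = (fun g => dot (proj S (s *: g)) g) -
    (fun g => norm2 (proj S (s *: g))) * (fun g => norm2 (proj S (s *: g))) *
    (fun=> (2 * s)^-1) by apply/funext => g; rewrite /penalized_support expr2.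
move=> g; apply: continuousB; first exact: cdot.
by apply: continuousM; [apply: continuousM; exact: cn|exact: cst_continuous].
Qed.

Lemma measurable_penalized_support S (s : R) : convex_body S ->
  measurable_fun [set: d.-tuple TR] (fun t => (penalized_support S s (vec_of_tuple t))%:E : \bar R).
Proof.
move=> bS; apply/measurable_EFinP.
by apply: measurable_vec_continuous; exact: penalized_support_continuous.
Qed.

Lemma vec_diag_affine (s : R) (t : d.-tuple TR) :
  vec_of_tuple (diag_affine (const_mx s) 0 t) = s *: vec_of_tuple t :> 'rV[R]_d.
Proof. by apply/rowP => i; rewrite !mxE tnth_mktuple !mxE addr0. Qed.

Lemma integral_gauss_vec (f : 'rV[R]_d -> R) : continuous f -> (forall x, 0 <= f x) ->
  (\int[gaussd]_t (f (vec_of_tuple t))%:E =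
   vec_integral (fun x => (f (sqrt2pi R *: x) * expR (- pi * dot x x))%:E))%E.
Proof.
move=> cf f0; rewrite integral_gauss_lebesgue//.
- apply: eq_integral => t _; rewrite vec_diag_affine EFinM; congr (_ * _)%E.
  by rewrite -vec_gaussE.
- by apply/measurable_EFinP; exact: measurable_vec_continuous.
- by move=> t; rewrite lee_fin.
Qed.

Definition mean_norm : \bar R := (\int[gaussd]_t (norm2 (vec_of_tuple t))%:E)%E.

(** Half of the Gaussian exponent absorbs the norm; the other half is still integrable, with
    integral computed by the dilation sqrt 2. *)
Lemma mean_norm_lty : (mean_norm < +oo)%E.
Proof.
rewrite /mean_norm integral_gauss_vec; last 2 first.
- exact: norm2_continuous.
- exact: norm2_ge0.
pose h x : \bar R := (expR (- pi / 2 * dot x x))%:E.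
have cdot : continuous (fun x => dot x x : R).
  apply: continuous_big => [|i _ x]; first exact: add_continuous.
  by apply: continuousM; exact: coord_continuous.
have mh : vec_measurable h.
  apply/measurable_EFinP.
  apply: (measurable_vec_continuous (f := fun x => expR (- pi / 2 * dot x x))) => x.
  apply: (@continuous_comp _ _ _ (fun x => - pi / 2 * dot x x) expR); last exact: continuous_expR.
  by apply: continuousM; [exact: cst_continuous|exact: cdot].
apply: (@le_lt_trans _ _ (vec_integral h)).
  apply: ge0_le_integral => //.
  - by move=> t _; rewrite lee_fin mulr_ge0 ?norm2_ge0 ?expR_ge0.
  - apply/measurable_EFinP; apply: measurable_funM.
      apply: (measurable_vec_continuous (f := fun x => norm2 (sqrt2pi R *: x))) => x.
      apply: continuous_comp; last exact: norm2_continuous.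
      exact: scaler_continuous.
    have := @vec_measurable_gauss R d; rewrite /vec_measurable => /measurable_EFinP; exact.
  - move=> t _; move: (vec_of_tuple t) => x; rewrite lee_fin norm2Z gtr0_norm ?sqrt2pi_gt0//.
    set r := norm2 x; rewrite -norm2_sqr -/r.
    have -> : expR (- pi / 2 * r ^+ 2) = expR (pi / 2 * r ^+ 2) * expR (- pi * r ^+ 2).
      by rewrite -expRD; congr expR; field.
    (* With u = sqrt (2 pi) r, the bound is u <= 1 + u^2 / 4 <= exp (u^2 / 4). *)
    rewrite ler_pM2r ?expR_gt0//; apply: le_trans (expR_ge1Dx _).
    have -> : pi / 2 * r ^+ 2 = (sqrt2pi R * r) ^+ 2 / 4.
      by rewrite exprMn sqrt2pi_sqr; field.
    have := sqr_ge0 (sqrt2pi R * r / 2 - 1); lra.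
rewrite (vec_integral_diag (b := const_mx (Num.sqrt 2)) 0 _ mh); last 2 first.
- by move=> i; rewrite mxE sqrtr_gt0.
- by move=> x; rewrite lee_fin expR_ge0.
rewrite (eq_vec_integral (g := @vec_gauss R d)); first by rewrite vec_integral_gauss mule1 ltry.
move=> x; rewrite /h /vec_gauss addr0 diag_const_mx mul_mx_scalar dotZl dotZr mulrA -expr2.
by rewrite sqr_sqrtr//; congr (expR _)%:E; field.
Qed.

Lemma gaussian_widthE S :
  gaussian_width S = (\int[gaussd]_t (support S (vec_of_tuple t))%:E)%E.
Proof. exact: EgaussE. Qed.

Lemma gaussian_width_le S (D : R) : S 0 -> compact S -> (forall x, S x -> norm2 x <= D) ->
  (gaussian_width S <= D%:E * mean_norm)%E.
Proof.
move=> S0 cS SD; have Sn : S !=set0 by exists 0.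
have D0 : 0 <= D by rewrite -(norm2_0 R d); exact: SD.
have mn : measurable_fun [set: d.-tuple TR] (fun t => (norm2 (vec_of_tuple t : 'rV[R]_d))%:E).
  by apply/measurable_EFinP; apply: measurable_vec_continuous; exact: norm2_continuous.
rewrite gaussian_widthE /mean_norm -ge0_integralZl//; last first.
  by move=> t _; rewrite lee_fin norm2_ge0.
apply: ge0_le_integral => //.
- by move=> t _; rewrite lee_fin support_ge0.
- exact: measurable_support.
- exact: measurable_funeM.
- by move=> t _; rewrite -EFinM lee_fin support_le.
Qed.

Lemma gaussian_width_ge0 S : S 0 -> compact S -> (0 <= gaussian_width S)%E.
Proof.
move=> S0 cS; rewrite gaussian_widthE; apply: integral_ge0 => t _.
by rewrite lee_fin support_ge0.
Qed.

Lemma gaussian_width_fin_num S : S 0 -> compact S -> gaussian_width S \is a fin_num.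
Proof.
move=> S0 cS; rewrite ge0_fin_numE ?gaussian_width_ge0//.
have [D D0 SD] := compact_norm2_bounded cS.
apply: le_lt_trans (gaussian_width_le S0 cS SD) _.
by rewrite lte_mul_pinfty// ?mean_norm_lty// lee_fin.
Qed.

End gaussian_width.

(** * The logarithm of the Wills functional between the penalized mean and the Gaussian width *)

Section wills_gaussian.
Variables (R : realType) (d : nat).
Local Notation TR := (measurableTypeR R).
Local Notation gam := (normal_prob (0 : R) 1).
Local Notation gaussd := (tuple_measure gam d).
Implicit Types (g x y : 'rV[R]_d).
Variable T : set 'rV[R]_d.
Hypotheses (bT : convex_body T) (T0 : T 0).

Let cT : compact T. Proof. by case: bT. Qed.

Definition exp_penalized (s : R) g : R := expR (penalized_support T s g / s).

Lemma exp_penalized_continuous (s : R) : continuous (exp_penalized s : 'rV[R]_d -> R).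
Proof.
move=> g; apply: (@continuous_comp _ _ _ (fun g => penalized_support T s g / s) expR);
  last exact: continuous_expR.
by apply: continuousM; [exact: penalized_support_continuous|exact: cst_continuous].
Qed.

(** With g = sqrt (2 pi) x and c = 1 / (s sqrt (2 pi)), the projection of x on c T is c p, where p
    is the projection of s g on T. Expanding - pi |x - c p|^2 gives - pi |x|^2 + <p, g> / s - |p|^2
    / (2 s^2). *)
Lemma wills_gaussE (s : R) : 0 < s ->
  (wills (scale_set (s * Num.sqrt (2 * pi))^-1 T))%:E =
  (\int[gaussd]_t (exp_penalized s (vec_of_tuple t))%:E)%E.
Proof.
move=> s0; rewrite -/(sqrt2pi R); have p0 := sqrt2pi_gt0 R.
have sp0 : 0 < s * sqrt2pi R by rewrite mulr_gt0.
have sV0 : 0 < (s * sqrt2pi R)^-1 by rewrite invr_gt0.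
rewrite willsE; last exact: scale_set_convex_body.
rewrite integral_gauss_vec; last 2 first.
- exact: exp_penalized_continuous.
- by move=> x; exact: expR_ge0.
apply: eq_vec_integral => x; congr EFin; rewrite /exp_penalized -expRD; congr expR.
rewrite /distance proj_scale_set// invrK /penalized_support !scalerA.
set p := proj T _; set c := (s * sqrt2pi R)^-1.
rewrite norm2_sqr dot_subZ -norm2_sqr !dotE -!norm2_sqr (dotC p x).
have cE : c = (s * sqrt2pi R)^-1 by [].
have pis : pi = sqrt2pi R ^+ 2 / 2 by rewrite sqrt2pi_sqr; field.
rewrite pis cE; field.
by rewrite !gt_eqF.
Qed.

Lemma mean_penalized_ge0 (s : R) : 0 < s ->
  (0 <= \int[gaussd]_t (penalized_support T s (vec_of_tuple t))%:E)%E.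
Proof.
by move=> s0; apply: integral_ge0 => t _; rewrite lee_fin penalized_support_ge0.
Qed.

Lemma mean_penalized_le_width (s : R) : 0 < s ->
  (\int[gaussd]_t (penalized_support T s (vec_of_tuple t))%:E <= gaussian_width T)%E.
Proof.
move=> s0; have Tn : T !=set0 by exists 0.
rewrite gaussian_widthE; apply: ge0_le_integral => //.
- by move=> t _; rewrite lee_fin penalized_support_ge0.
- exact: measurable_penalized_support.
- exact: measurable_support.
- by move=> t _; rewrite lee_fin penalized_support_le.
Qed.

Lemma mean_penalized_fin_num (s : R) : 0 < s ->
  (\int[gaussd]_t (penalized_support T s (vec_of_tuple t))%:E)%E \is a fin_num.
Proof.
move=> s0; rewrite ge0_fin_numE ?mean_penalized_ge0//.
apply: le_lt_trans (mean_penalized_le_width s0) _.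
by rewrite -ge0_fin_numE ?gaussian_width_ge0// gaussian_width_fin_num.
Qed.

(* Vitale's exponential inequality [E exp (sup_t (<t, g> - |t|^2 / 2)) <= exp (E sup_t <t, g>)],
   up to the factor coming from the parameter [th] of the infimum convolution. *)
Lemma exp_penalized_le (s th : R) : 0 < s -> 0 < th -> th < 1 ->
  (\int[gaussd]_t (expR (penalized_support T (s * (1 - th)) (vec_of_tuple t) / s))%:E <=
   expeR ((s^-1)%:E * gaussian_width T))%E.
Proof.
move=> s0 th0 th1; have Tn : T !=set0 by exists 0.
have th1' : 0 < 1 - th by rewrite subr_gt0.
have sth : 0 < s * (1 - th) by rewrite mulr_gt0.
rewrite gaussian_widthE -ge0_integralZl//; last 3 first.
- exact: measurable_support.
- by move=> t _; rewrite lee_fin support_ge0.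
- by rewrite lee_fin invr_ge0 ltW.
apply: (gaussian_infconv th0 th1).
- apply/measurable_EFinP; apply: measurableT_comp; first exact: measurable_expR.
  apply: measurable_funM => //.
  by apply: measurable_vec_continuous; exact: penalized_support_continuous.
- by apply: measurable_funeM; exact: measurable_support.
- by move=> t; rewrite lee_fin expR_ge0.
- by move=> t; rewrite mule_ge0// lee_fin ?invr_ge0 ?support_ge0// ltW.
move=> t u; have := vec_of_tupleK t; have := vec_of_tupleK u.
set x := vec_of_tuple t; set y := vec_of_tuple u => uE tE.
have -> : \sum_(i < d) (tnth t i - tnth u i) ^+ 2 = dot (x - y) (x - y).
  by apply: eq_bigr => i _; rewrite !mxE expr2.
rewrite /= lee_fin ler_expR.
rewrite /penalized_support; have [Kp _] := projP ((s * (1 - th)) *: x) bT.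
set p := proj T _ in Kp *.
have h1 : s^-1 * dot p y <= s^-1 * support T y.
  by rewrite ler_wpM2l ?invr_ge0 ?(ltW s0)// support_ge.
(* The slack in the hypothesis of the infimum convolution is (1 - th) / 2 times this square plus
   (support T y - <p, y>) / s; completing the square forces the penalty parameter s (1 - th). *)
have h2 := dot_ge0 ((x - y) - (s * (1 - th))^-1 *: p).
have {}h2 : 0 <= (1 - th) / 2 * dot ((x - y) - (s * (1 - th))^-1 *: p)
    ((x - y) - (s * (1 - th))^-1 *: p).
  by rewrite mulr_ge0// divr_ge0// ltW.
rewrite -subr_ge0; apply: le_trans h2 _.
rewrite -subr_ge0 (_ : _ - _ = s^-1 * support T y - s^-1 * dot p y) ?subr_ge0//.
rewrite dot_subZ norm2_sqr (dotC (x - y) p) (dotBr x y p); field.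
by rewrite !gt_eqF.
Qed.

(** The maximizer for s is tested at s (1 - th): only the penalty changes, by a multiple of |p|^2 <=
    D^2 that vanishes with th. *)
Lemma penalized_support_penalty (s th : R) g (D : R) : 0 < s -> 0 < th -> th < 1 ->
  (forall x, T x -> norm2 x <= D) ->
  penalized_support T s g / s <= penalized_support T (s * (1 - th)) g / s +
    D ^+ 2 / (2 * s ^+ 2) * (th / (1 - th)).
Proof.
move=> s0 th0 th1 TD; have th1' : 0 < 1 - th by rewrite subr_gt0.
have sth : 0 < s * (1 - th) by rewrite mulr_gt0.
have [Kp _] := projP (s *: g) bT; have := penalized_support_ge g sth bT Kp.
rewrite [penalized_support T s g]/penalized_support/=.
set p := proj T _ in Kp *; set q := penalized_support _ _ _.
move=> h; have {}h : s^-1 * (dot p g - norm2 p ^+ 2 / (2 * (s * (1 - th)))) <= s^-1 * q.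
  by apply: ler_wpM2l h; rewrite invr_ge0 ltW.
have pD : norm2 p ^+ 2 / (2 * s ^+ 2) * (th / (1 - th)) <= D ^+ 2 / (2 * s ^+ 2) * (th / (1 - th)).
  have c0 : 0 <= th / (1 - th) by apply: ltW; exact: divr_gt0.
  apply: ler_wpM2r => //; apply: ler_wpM2r; first by rewrite invr_ge0 mulr_ge0 ?sqr_ge0.
  have D0 : 0 <= D by apply: le_trans (TD _ Kp); exact: norm2_ge0.
  by rewrite ler_pXn2r ?nnegrE ?norm2_ge0// TD.
apply: (@le_trans _ _ (q / s + norm2 p ^+ 2 / (2 * s ^+ 2) * (th / (1 - th)))); last first.
  by rewrite lerD2l.
rewrite [q / s]mulrC -lerBlDr; apply: le_trans h; rewrite le_eqVlt; apply/orP; left.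
by apply/eqP; field; rewrite !gt_eqF.
Qed.

(** [exp_penalized_le] as th tends to 0 from the right; the uniform correction [c th] permits the
    passage without a limit theorem for the integrals. *)
Lemma mean_exp_penalized_le (s : R) : 0 < s ->
  (\int[gaussd]_t (exp_penalized s (vec_of_tuple t))%:E <=
   expeR ((s^-1)%:E * gaussian_width T))%E.
Proof.
move=> s0; have wfin := gaussian_width_fin_num T0 cT.
have [D D0 TD] := compact_norm2_bounded cT.
set w := fine (gaussian_width T).
rewrite -(fineK wfin) -/w -EFinM/=.
pose c th := D ^+ 2 / (2 * s ^+ 2) * (th / (1 - th)).
have mexp (r : R) : measurable_fun [set: d.-tuple TR]
    (fun t => (expR (penalized_support T r (vec_of_tuple t) / s))%:E : \bar R).
  apply/measurable_EFinP; apply: measurableT_comp; first exact: measurable_expR.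
  apply: measurable_funM => //.
  by apply: measurable_vec_continuous; exact: penalized_support_continuous.
have bound th : 0 < th -> th < 1 ->
    (\int[gaussd]_t (exp_penalized s (vec_of_tuple t))%:E <= (expR (c th + s^-1 * w))%:E)%E.
  move=> th0 th1.
  apply: (@le_trans _ _ (\int[gaussd]_t ((expR (c th))%:E *
      (expR (penalized_support T (s * (1 - th)) (vec_of_tuple t) / s))%:E))%E).
    apply: ge0_le_integral => //.
    - by move=> t _; rewrite lee_fin expR_ge0.
    - exact: mexp.
    - by apply: measurable_funeM; exact: mexp.
    - move=> t _; rewrite -EFinM lee_fin -expRD ler_expR addrC.
      exact: penalized_support_penalty.
  rewrite ge0_integralZl//.
  rewrite expRD EFinM lee_wpmul2l ?lee_fin ?expR_ge0//.
  apply: le_trans (exp_penalized_le s0 th0 th1) _.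
  by rewrite -(fineK wfin) -EFinM.
apply/lee_addgt0Pr => e e0.
have ce : (fun th => expR (c th + s^-1 * w)) @ 0^'+ --> expR (s^-1 * w).
  have cf : {for 0, continuous (fun th => expR (c th + s^-1 * w))}.
    apply: (@continuous_comp _ _ _ (fun th => c th + s^-1 * w) expR); last exact: continuous_expR.
    apply: continuousD; last exact: cst_continuous.
    apply: continuousM; first exact: cst_continuous.
    apply: continuousM; first exact: cvg_id.
    apply: continuousV; first by rewrite subr0 oner_neq0.
    by apply: continuousB; [exact: cst_continuous|exact: cvg_id].
  have := cvg_at_right_filter cf.
  by rewrite {2}/c mul0r mulr0 add0r.
near (0 : R)^'+ => th.
have th0 : 0 < th by near: th; exact: nbhs_right_gt.
have th1 : th < 1 by near: th; exact: nbhs_right_lt.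
apply: (le_trans (bound th th0 th1)); rewrite -EFinD lee_fin -lerBlDl.
have : `|expR (s^-1 * w) - expR (c th + s^-1 * w)| < e.
  by near: th; move/cvgrPdist_lt : ce; exact.
rewrite ltr_norml => /andP[+ _]; lra.
Unshelve. all: by end_near. Qed.

(** Jensen by the tangent of exp at the mean m, with the negative term moved across so that only
    nonnegative functions are integrated: exp m + exp m * z / s <= exp (z / s) + exp m * m. *)
Lemma exp_mean_penalized_le (s : R) : 0 < s ->
  (expeR ((s^-1)%:E * \int[gaussd]_t (penalized_support T s (vec_of_tuple t))%:E) <=
   \int[gaussd]_t (exp_penalized s (vec_of_tuple t))%:E)%E.
Proof.
move=> s0; have hfin := mean_penalized_fin_num s0.
have h0 := mean_penalized_ge0 s0.
set h := fine (\int[gaussd]_t (penalized_support T s (vec_of_tuple t))%:E)%E.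
have hE : (\int[gaussd]_t (penalized_support T s (vec_of_tuple t))%:E = h%:E)%E by rewrite fineK.
rewrite hE -EFinM/=; set m := s^-1 * h.
have m0 : 0 <= m by rewrite mulr_ge0 ?invr_ge0 ?(ltW s0)// fine_ge0.
have mZ := measurable_penalized_support s bT.
have sV0 : 0 <= s^-1 by rewrite invr_ge0 ltW.
have Z0 t : 0 <= penalized_support T s (@vec_of_tuple R d t) by exact: penalized_support_ge0.
have me : measurable_fun [set: d.-tuple TR]
    (fun t => (exp_penalized s (vec_of_tuple t))%:E : \bar R).
  by apply/measurable_EFinP; apply: measurable_vec_continuous; exact: exp_penalized_continuous.
have em0 : 0 <= expR m := expR_ge0 _.
have : (\int[gaussd]_t (expR m + expR m * s^-1 * penalized_support T s (vec_of_tuple t))%:E <=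
   \int[gaussd]_t ((exp_penalized s (vec_of_tuple t))%:E + (expR m * m)%:E))%E.
  apply: ge0_le_integral => //.
  - by move=> t _; rewrite lee_fin addr_ge0// mulr_ge0// mulr_ge0.
  - apply/measurable_EFinP; apply: measurable_funD => //; apply: measurable_funM => //.
    exact/measurable_EFinP.
  - by apply: emeasurable_funD.
  - move=> t _; rewrite -EFinD lee_fin /exp_penalized; set z := penalized_support _ _ _.
    have -> : z / s = m + (s^-1 * z - m) by rewrite addrC subrK mulrC.
    rewrite expRD.
    have : expR m * (1 + (s^-1 * z - m)) <= expR m * expR (s^-1 * z - m).
      by rewrite ler_pM2l ?expR_gt0// expR_ge1Dx.
    lra.
under eq_integral do rewrite EFinD EFinM.
rewrite !ge0_integralD//; last 4 first.
- by move=> t _; rewrite lee_fin expR_ge0.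
- by move=> t _; rewrite lee_fin; apply: mulr_ge0.
- move=> t _; apply: mule_ge0; last by rewrite lee_fin.
  by rewrite lee_fin; apply: mulr_ge0.
- by apply: measurable_funeM.
rewrite !integral_cst// [X in (_ * X + _)%E]tuple_measure_normalT.
rewrite [X in (_ <= _ + _ * X)%E]tuple_measure_normalT !mule1.
rewrite ge0_integralZl//; last 2 first.
- by move=> t _; rewrite lee_fin.
- by rewrite lee_fin mulr_ge0.
by rewrite hE -EFinM -mulrA -/m leeD2rE.
Qed.

Lemma wills_term_bounds (s : R) : 0 < s ->
  ((\int[gaussd]_t (penalized_support T s (vec_of_tuple t))%:E <= (wills_term T s)%:E) /\
   ((wills_term T s)%:E <= gaussian_width T))%E.
Proof.
move=> s0; have hfin := mean_penalized_fin_num s0.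
have wfin := gaussian_width_fin_num T0 cT.
have := mean_exp_penalized_le s0; have := exp_mean_penalized_le s0.
rewrite -wills_gaussE// -(fineK hfin) -(fineK wfin) -!EFinM/= !lee_fin /wills_term.
set W := wills _ => h1 h2.
have W0 : 0 < W by apply: lt_le_trans h1; exact: expR_gt0.
split.
  by rewrite -ler_pdivrMl// -ler_expR lnK.
by rewrite -ler_pdivlMl// -ler_expR lnK.
Qed.

End wills_gaussian.

(** * Envelope formulas for the two integrals *)

Section projection_integral.
Variables (R : realType) (d : nat).
Local Notation TR := (measurableTypeR R).
Local Notation lam := (@lebesgue_measure R).
Local Notation gam := (normal_prob (0 : R) 1).
Local Notation gaussd := (tuple_measure gam d).
Implicit Types (g x y : 'rV[R]_d).
Variable T : set 'rV[R]_d.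
Hypotheses (bT : convex_body T) (T0 : T 0).

Let cT : compact T. Proof. by case: bT. Qed.

(** The maximizer for x is a competitor for y, and its two values differ only in the penalty. *)
Lemma penalized_support_envelope g (x y : R) : 0 < x -> 0 < y ->
  norm2 (proj T (x *: g)) ^+ 2 / 2 * (x^-1 - y^-1) <=
  penalized_support T y g - penalized_support T x g.
Proof.
move=> x0 y0; have [Kp _] := projP (x *: g) bT.
have := penalized_support_ge g y0 bT Kp.
rewrite [penalized_support T x g]/penalized_support/=.
set q := penalized_support _ _ _; set p := proj T _ => h.
rewrite lerBrDr; apply: le_trans h; rewrite le_eqVlt; apply/orP; left.
by apply/eqP; field; rewrite !gt_eqF.
Qed.

Lemma penalized_support_cvg g :
  penalized_support T s g @[s --> +oo] --> support T g.
Proof.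
have [D D0 TD] := compact_norm2_bounded cT.
have Tn : T !=set0 by exists 0.
have [t [Tt tE _]] := support_attained g Tn cT.
have lim : support T g - norm2 t ^+ 2 / 2 * s^-1 @[s --> +oo] --> support T g.
  rewrite -[X in _ --> X]subr0 -[X in _ - X](mulr0 (norm2 t ^+ 2 / 2)).
  apply: cvgB; first exact: cvg_cst.
  by apply: cvgM; [exact: cvg_cst|by apply/gtr0_cvgV0; [exact: nbhs_pinfty_gt|exact: cvg_id]].
apply: squeeze_cvgr lim (cvg_cst _).
near=> s; have s0 : 0 < s by near: s; exact: nbhs_pinfty_gt.
rewrite penalized_support_le// andbT.
have := penalized_support_ge g s0 bT Tt; rewrite -tE => /(le_trans _); apply.
by rewrite invfM mulrA.
Unshelve. all: by end_near. Qed.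

Lemma integral_proj_pointwise g (s : R) : 0 < s ->
  (\int[lam]_(x in `[s, +oo[) (norm2 (proj T (x *: g)) ^+ 2 / x ^+ 2)%:E =
   (2 * (support T g - penalized_support T s g))%:E)%E.
Proof.
move=> s0.
have Qc (x : R) : 0 < x -> {for x, continuous (fun x : R => norm2 (proj T (x *: g)) ^+ 2)}.
  move=> x0; have c1 : {for x, continuous (fun x : R => x *: g)}.
    exact: scalel_continuous.
  have c2 : {for x, continuous (fun x : R => norm2 (proj T (x *: g)))}.
    apply: continuous_comp; last exact: norm2_continuous.
    by apply: continuous_comp; [exact: c1|exact: proj_continuous].
  by apply: continuousM; exact: c2.
have := @envelope_integral R _ (fun x : R => penalized_support T x g) Qc.
apply => //.
- by move=> x y; exact: penalized_support_envelope.
- by move=> x _; rewrite sqr_ge0.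
- exact: penalized_support_cvg.
Qed.

(** Rescaling gives |Pi_(T/nu)(g)|^2 = |Pi_T(nu g)|^2 / nu^2; Tonelli then reduces to the identity
    for fixed g. The sum form keeps all terms nonnegative. *)
Lemma integral_mean_proj (s : R) : 0 < s ->
  (\int[lam]_(nu in `[s, +oo[)
      Egauss (fun g => norm2 (proj (scale_set nu^-1 T) g) ^+ 2)%R +
    2%:E * \int[gaussd]_t (penalized_support T s (vec_of_tuple t))%:E =
   2%:E * gaussian_width T)%E.
Proof.
move=> s0; have Tn : T !=set0 by exists 0.
(* The inverse is written as the power -1 to use measurability of [powR]; the two agree on [s, oo),
   and the indicator removes all other values. *)
pose F (p : TR * d.-tuple TR) : \bar R :=
  ((norm2 (proj T (p.1 *: vec_of_tuple p.2)) ^+ 2 * (p.1 `^ (-1)) ^+ 2)%R%:E *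
   (\1_(`[s, +oo[%classic : set TR) p.1)%:E)%E.
have mF : measurable_fun [set: TR * d.-tuple TR] F.
  apply: emeasurable_funM; apply/measurable_EFinP; last first.
    have mI : measurable_fun [set: TR] (\1_(`[s, +oo[%classic : set TR) : TR -> R).
      exact: measurable_indic.
    exact: (measurableT_comp mI measurable_fst).
  apply: measurable_funM; last first.
    apply: measurable_funX.
    exact: (measurableT_comp (@measurable_powR R (-1)) measurable_fst).
  apply: measurable_funX.
  have mN : measurable_fun [set: d.-tuple TR] (fun t => norm2 (proj T (vec_of_tuple t))).
    apply: (measurable_vec_continuous (f := fun x => norm2 (proj T x))) => x.
    by apply: continuous_comp; [exact: proj_continuous|exact: norm2_continuous].
  have mS : measurable_fun [set: TR * d.-tuple TR]
      (fun p => tuple_of_vec (p.1 *: vec_of_tuple p.2)).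
    apply/measurable_fun_tnthP => i.
    rewrite (_ : _ \o _ = fun p => p.1 * tnth p.2 i); last first.
      by apply/funext => p /=; rewrite tnth_mktuple !mxE.
    apply: measurable_funM; first exact: measurable_fst.
    exact: (measurableT_comp (measurable_tnth i) measurable_snd).
  have := measurableT_comp mN mS.
  by apply: eq_measurable_fun => p _ /=; rewrite tuple_of_vecK.
have F0 p : (0 <= F p)%E by rewrite mule_ge0// lee_fin// mulr_ge0 ?sqr_ge0.
have -> : (\int[lam]_(nu in `[s, +oo[)
      Egauss (fun g => norm2 (proj (scale_set nu^-1 T) g) ^+ 2)%R =
    \int[lam]_nu \int[gaussd]_t F (nu, t))%E.
  rewrite integral_mkcond; apply: eq_integral => nu _; rewrite patchE /F/= indicE.
  case: ifPn => [|_]; last first.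
    by rewrite integral0_eq// => t _; rewrite mule0.
  rewrite inE/= in_itv/= andbT => snu; have nu0 := lt_le_trans s0 snu.
  rewrite EgaussE; apply: eq_integral => t _; rewrite mule1 powR_inv1 ?(ltW nu0)//; congr EFin.
  rewrite proj_scale_set ?invr_gt0// invrK norm2Z exprMn mulrC.
  by rewrite gtr0_norm ?invr_gt0.
rewrite [X in (X + _)%E](fubini_tonelli (m1 := lam) (m2 := gaussd) F)//.
have -> : (\int[gaussd]_t \int[lam]_nu F (nu, t) =
    \int[gaussd]_t
      (2 * (support T (vec_of_tuple t) - penalized_support T s (vec_of_tuple t)))%:E)%E.
  apply: eq_integral => t _; rewrite -integral_proj_pointwise// [RHS]integral_mkcond.
  apply: eq_integral => nu _; rewrite patchE /F/= indicE; case: ifPn => [|_]; last by rewrite mule0.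
  rewrite inE/= in_itv/= andbT => snu; have nu0 := lt_le_trans s0 snu.
  by rewrite mule1 powR_inv1 ?(ltW nu0)// exprVn.
have mZ := measurable_penalized_support s bT.
have mS := measurable_support Tn cT.
rewrite gaussian_widthE -!ge0_integralZl//; last 2 first.
- by move=> t _; rewrite lee_fin support_ge0.
- by move=> t _; rewrite lee_fin penalized_support_ge0.
rewrite -ge0_integralD//; last 4 first.
- by move=> t _; rewrite lee_fin mulr_ge0// subr_ge0 penalized_support_le.
- apply/measurable_EFinP; apply: measurable_funM => //.
  by apply: measurable_funB; exact/measurable_EFinP.
- by move=> t _; rewrite mule_ge0// lee_fin penalized_support_ge0.
- exact: measurable_funeM.
by apply: eq_integral => t _; rewrite -!EFinM -EFinD; congr EFin; ring.
Qed.

End projection_integral.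

(** * Localized width: concavity, regularity and its penalized maximum *)

Section localized_width.
Variables (R : realType) (d : nat).
Local Notation lam := (@lebesgue_measure R).
Local Notation gam := (normal_prob (0 : R) 1).
Local Notation gaussd := (tuple_measure gam d).
Variable T : set 'rV[R]_d.
Hypotheses (bT : convex_body T) (T0 : T 0).

Let cT : compact T. Proof. by case: bT. Qed.

Definition truncation (r : R) : set 'rV[R]_d := T `&` scale_set r (@ball2 R d).

Lemma truncationE r : 0 <= r -> truncation r = [set x | T x /\ norm2 x <= r].
Proof.
move=> r0; apply/seteqP; split => x [Tx].
  move=> [y yb yx]; split; first exact: Tx.
  by rewrite -yx norm2Z ger0_norm// ler_piMr.
move=> xr; split => //; have [rE|rn0] := eqVneq r 0.
  exists 0; first by rewrite /ball2/= norm2_0.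
  rewrite scaler0; apply/esym/norm2_eq0/eqP.
  by rewrite eq_le norm2_ge0 andbT -rE.
have rp : 0 < r by rewrite lt0r rn0.
exists (r^-1 *: x); last by rewrite scalerA divff// scale1r.
by rewrite /ball2/= norm2Z gtr0_norm ?invr_gt0// ler_pdivrMl// mulr1.
Qed.

Lemma truncation0 r : 0 <= r -> truncation r 0.
Proof. by move=> r0; rewrite truncationE//=; split => //; rewrite norm2_0. Qed.

Lemma truncation_compact r : 0 <= r -> compact (truncation r).
Proof.
move=> r0; rewrite truncationE//.
apply: (@subclosed_compact _ _ T) => //; last by move=> x [].
rewrite (_ : mkset _ = T `&` [set x | norm2 x <= r])//.
apply: closedI; first by apply: compact_closed => //; exact: norm_hausdorff.
apply: (@preimage_closed _ _ (@norm2 R d) [set y | y <= r]).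
  by move=> x _; exact: norm2_continuous.
exact: closed_le.
Qed.

Definition localized_width (r : R) : R := fine (gaussian_width (truncation r)).

Lemma localized_widthE r : 0 <= r ->
  gaussian_width (truncation r) = (localized_width r)%:E.
Proof.
move=> r0; rewrite fineK// gaussian_width_fin_num//; first exact: truncation0.
exact: truncation_compact.
Qed.

Lemma gaussian_width_scale_le (S L : set 'rV[R]_d) (c : R) : 0 <= c ->
  S 0 -> compact S -> L 0 -> compact L ->
  (forall g, support S g <= c * support L g) ->
  (gaussian_width S <= c%:E * gaussian_width L)%E.
Proof.
move=> c0 S0 cS L0 cL SL; rewrite !gaussian_widthE.
have Sn : S !=set0 by exists 0.
have Ln : L !=set0 by exists 0.
rewrite -ge0_integralZl//; last 2 first.
- exact: measurable_support.
- by move=> t _; rewrite lee_fin support_ge0.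
apply: ge0_le_integral => //.
- by move=> t _; rewrite lee_fin support_ge0.
- exact: measurable_support.
- by apply: measurable_funeM; exact: measurable_support.
- by move=> t _; rewrite -EFinM lee_fin.
Qed.

Lemma support_le_support (S L : set 'rV[R]_d) (c : R) g : S !=set0 -> compact S -> compact L ->
  0 < c -> (forall x, S x -> L (c^-1 *: x)) -> support S g <= c * support L g.
Proof.
move=> Sn cS cL c0 SL; have [t [St -> _]] := support_attained g Sn cS.
by rewrite -ler_pdivrMl// -dotZl support_ge//; exact: SL.
Qed.

Lemma localized_width_ge0 r : 0 <= r -> 0 <= localized_width r.
Proof.
move=> r0; rewrite -lee_fin -localized_widthE// gaussian_width_ge0//.
  exact: truncation0.
exact: truncation_compact.
Qed.

(** [T] is convex and contains 0, so shrinking the part of [T] in the ball of radius b by a / b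
    lands in the part of radius a. *)
Lemma localized_width_ratio a b : 0 < a -> a <= b ->
  localized_width b <= b / a * localized_width a.
Proof.
move=> a0 ab; have b0 := lt_le_trans a0 ab; have [_ _ vT] := bT.
have [a0' b0'] := (ltW a0, ltW b0).
rewrite -lee_fin EFinM -!localized_widthE//.
apply: gaussian_width_scale_le; rewrite ?divr_ge0//;
  try exact: truncation0; try exact: truncation_compact.
move=> g; apply: support_le_support; rewrite ?divr_gt0//; try exact: truncation_compact.
  by exists 0; exact: truncation0.
move=> x; rewrite !truncationE// => -[Tx xb]; rewrite invf_div; split; last first.
  by rewrite norm2Z gtr0_norm ?divr_gt0// mulrAC ler_pdivrMr// ler_pM2l.
rewrite -[_ *: x]addr0 -(scaler0 _ (1 - a / b)); apply: vT => //.
  by rewrite divr_ge0.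
by rewrite ler_pdivrMr// mul1r.
Qed.

Definition mean_norm_real : R := fine (mean_norm R d).

Lemma mean_normE : mean_norm R d = mean_norm_real%:E.
Proof.
rewrite fineK// ge0_fin_numE ?mean_norm_lty//.
by apply: integral_ge0 => t _; rewrite lee_fin norm2_ge0.
Qed.

Lemma localized_width_le_norm r : 0 <= r -> localized_width r <= r * mean_norm_real.
Proof.
move=> r0; rewrite -lee_fin -localized_widthE// EFinM -mean_normE.
apply: gaussian_width_le; [exact: truncation0|exact: truncation_compact|].
by move=> x; rewrite truncationE// => -[].
Qed.

(** The ratio bound makes the increment at most (b - a) / a times the width at a, and that width is
    at most a E|g|. *)
Lemma localized_width_lipschitz a b : 0 <= a -> a <= b ->
  localized_width b - localized_width a <= (b - a) * mean_norm_real.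
Proof.
move=> a0 ab; have fa := localized_width_le_norm a0.
have [->|an0] := eqVneq a 0.
  rewrite subr0; apply: le_trans (localized_width_le_norm (le_trans a0 ab)).
  by rewrite lerBlDr lerDl localized_width_ge0.
have ap : 0 < a by rewrite lt0r an0.
apply: (@le_trans _ _ ((b - a) / a * localized_width a)).
  have := localized_width_ratio ap ab.
  by rewrite mulrBl mulrBl divff// mul1r lerD2r.
rewrite -mulrA ler_wpM2l ?subr_ge0//.
by rewrite ler_pdivrMl.
Qed.

Lemma localized_width_mono a b : 0 <= a -> a <= b -> localized_width a <= localized_width b.
Proof.
move=> a0 ab; have b0 := le_trans a0 ab.
rewrite -lee_fin -!localized_widthE// -[leRHS]mul1e.
apply: gaussian_width_scale_le => //; try exact: truncation0; try exact: truncation_compact.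
move=> g; apply: support_le_support => //; try exact: truncation_compact.
  by exists 0; exact: truncation0.
move=> x; rewrite invr1 scale1r !truncationE// => -[Tx xa]; split => //.
exact: le_trans ab.
Qed.

(** The midpoint of maximizers for radii a and b lies in [T] by convexity and has norm at most (a +
    b) / 2. *)
Lemma localized_width_midpoint a b : 0 <= a -> 0 <= b ->
  (localized_width a + localized_width b) / 2 <= localized_width ((a + b) / 2).
Proof.
move=> a0 b0; have [_ _ vT] := bT.
have m0 : 0 <= (a + b) / 2 by rewrite divr_ge0// addr_ge0.
rewrite -lee_fin mulrC EFinM EFinD -!localized_widthE// !gaussian_widthE.
have n0 r : 0 <= r -> truncation r !=set0 by move=> r0; exists 0; exact: truncation0.
have ms r : 0 <= r -> measurable_fun [set: d.-tuple (measurableTypeR R)]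
    (fun t => (support (truncation r) (vec_of_tuple t))%:E : \bar R).
  by move=> r0; apply: measurable_support; [exact: n0|exact: truncation_compact].
have s0 r t : 0 <= r -> (0 <= (support (truncation r) (@vec_of_tuple R d t))%:E)%E.
  by move=> r0; rewrite lee_fin support_ge0; [|exact: truncation_compact|exact: truncation0].
rewrite -ge0_integralD//; last 4 first.
- by move=> t _; exact: s0.
- exact: ms.
- by move=> t _; exact: s0.
- exact: ms.
rewrite -ge0_integralZl//; last 2 first.
- by apply: emeasurable_funD; exact: ms.
- by move=> t _; apply: adde_ge0; exact: s0.
apply: ge0_le_integral => //.
- by move=> t _; apply: mule_ge0; [rewrite lee_fin|apply: adde_ge0; exact: s0].
- by apply: measurable_funeM; apply: emeasurable_funD; exact: ms.
- exact: ms.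
move=> t _; rewrite -EFinD -EFinM lee_fin; move: (vec_of_tuple t) => g.
have [x [Ax -> _]] := support_attained g (n0 a a0) (truncation_compact a0).
have [y [By -> _]] := support_attained g (n0 b b0) (truncation_compact b0).
rewrite -dotDl -dotZl; apply: support_ge; first exact: truncation_compact.
move: Ax By; rewrite !truncationE// => -[Tx xa] [Ty yb]; split.
  have -> : 2^-1 *: (x + y) = 2^-1 *: x + (1 - 2^-1) *: y.
    by rewrite scalerDr; congr (_ + _ *: _); field.
  by apply: vT; rewrite ?invr_ge0 ?invf_le1// ler1n.
rewrite norm2Z gtr0_norm ?invr_gt0// [leRHS]mulrC ler_pM2l ?invr_gt0//.
by apply: le_trans (norm2D _ _) _; exact: lerD.
Qed.

Lemma localized_width_stable (D r : R) : (forall x, T x -> norm2 x <= D) -> D <= r ->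
  localized_width r = fine (gaussian_width T).
Proof.
move=> TD Dr; have D0 : 0 <= D by rewrite -(norm2_0 R d); exact: TD.
rewrite /localized_width; congr (fine (gaussian_width _)).
rewrite truncationE ?(le_trans D0)//; apply/seteqP; split => [x []//|x Tx].
by split => //; exact: le_trans (TD _ Tx) Dr.
Qed.

Lemma localized_width_le r : 0 <= r -> localized_width r <= fine (gaussian_width T).
Proof.
move=> r0; have [D D0 TD] := compact_norm2_bounded cT.
rewrite -(localized_width_stable TD (r := Num.max r D)) ?le_max ?lexx ?orbT//.
by apply: localized_width_mono => //; rewrite le_max lexx.
Qed.

Definition localized_obj (nu r : R) : R := localized_width r - r ^+ 2 / (2 * nu).

(** The Lipschitz bound concerns nonnegative radii; [Num.max 0] extends the function continuously to
    the line for the extreme value theorem. *)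
Lemma localized_width_continuous : continuous (fun r : R => localized_width (Num.max 0 r)).
Proof.
move=> x; apply/cvgrPdist_lt => e e0.
have m0 : 0 <= mean_norm_real.
  by rewrite -lee_fin -mean_normE; apply: integral_ge0 => t _; rewrite lee_fin norm2_ge0.
have m1 : 0 < mean_norm_real + 1 by rewrite ltr_pwDr.
have L a b : 0 <= a -> a <= b ->
    `|localized_width a - localized_width b| <= (b - a) * mean_norm_real.
  move=> a0 ab; rewrite distrC ger0_norm ?localized_width_lipschitz// subr_ge0.
  exact: localized_width_mono.
have max0 (a : R) : 0 <= Num.max 0 a by rewrite le_max lexx.
near=> y; have xy : `|x - y| < e / (mean_norm_real + 1).
  near: y; apply: (@cvgr_dist_lt _ _ _ (nbhs x) _ id x cvg_id).
  by rewrite divr_gt0.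
have dm : `|Num.max 0 x - Num.max 0 y| <= `|x - y|.
  rewrite /Num.max; case: ltP => x0; case: ltP => y0; rewrite ?subrr ?normr0//.
  - by rewrite subr0 (ger0_norm (ltW x0)) ger0_norm; lra.
  - by rewrite sub0r normrN (ger0_norm (ltW y0)) ler0_norm; lra.
have h : `|localized_width (Num.max 0 x) - localized_width (Num.max 0 y)| <=
    `|Num.max 0 x - Num.max 0 y| * mean_norm_real.
  have [le_xy|/ltW le_yx] := leP (Num.max 0 x) (Num.max 0 y).
    by rewrite [X in _ <= X * _]distrC [X in _ <= X * _]ger0_norm ?subr_ge0// L.
  by rewrite distrC [X in _ <= X * _]ger0_norm ?subr_ge0// L.
apply: le_lt_trans h _; apply: (@le_lt_trans _ _ (`|x - y| * (mean_norm_real + 1))).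
  by rewrite ler_pM// lerDl.
by rewrite -ltr_pdivlMr.
Unshelve. all: by end_near. Qed.

(** Beyond a radius D containing [T] the width is constant while the penalty grows, so the maximum
    over [0, D] is global. *)
Lemma localized_obj_max nu : 0 < nu ->
  exists r, 0 <= r /\ forall s, 0 <= s -> localized_obj nu s <= localized_obj nu r.
Proof.
move=> nu0; have [D D0 TD] := compact_norm2_bounded cT.
have [||r + rmax] := @EVT_max R (fun r => localized_width (Num.max 0 r) - r ^+ 2 / (2 * nu)) 0 D.
- exact: D0.
- apply: continuous_subspaceT => x; apply: cvgB; first exact: localized_width_continuous.
  by apply: cvgM; [exact: exprn_continuous|exact: cvg_cst].
rewrite in_itv/= => /andP[r0 rD]; exists r; split => // s s0.
have sD u : 0 <= u -> u <= D -> localized_obj nu u <= localized_obj nu r.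
  move=> u0 uD; have := rmax u; rewrite in_itv/= u0 uD => /(_ isT).
  by rewrite !max_r.
have [/sD|/ltW Ds] := leP s D; first exact.
apply: le_trans (sD _ D0 (lexx D)); rewrite /localized_obj.
rewrite !(localized_width_stable TD)// lerD2l lerN2.
by rewrite ler_pM2r ?invr_gt0 ?mulr_gt0// ler_pXn2r ?nnegrE.
Qed.

Lemma localized_radiusP nu : 0 < nu -> 0 <= localized_radius T nu /\
  forall s, 0 <= s -> localized_obj nu s <= localized_obj nu (localized_radius T nu).
Proof.
move=> nu0; have objE s : 0 <= s ->
    (gaussian_width (T `&` scale_set s (@ball2 R d)) - (s ^+ 2 / (2 * nu))%:E =
     (localized_obj nu s)%:E)%E.
  by move=> s0; rewrite -/(truncation s) localized_widthE.
rewrite /localized_radius; set P := [set _ | _]; suff: P (xget 0 P).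
  by move=> [x0 h]; split => // s s0; have := h s s0; rewrite !objE.
apply: xgetPex; have [r [r0 rmax]] := localized_obj_max nu0.
by exists r; split => // s s0; rewrite !objE// lee_fin rmax.
Qed.

Lemma localized_radius_le (D nu : R) : (forall x, T x -> norm2 x <= D) -> 0 < nu ->
  localized_radius T nu <= D.
Proof.
move=> TD nu0; have D0 : 0 <= D by rewrite -(norm2_0 R d); exact: TD.
have [r0 /(_ D D0)] := localized_radiusP nu0; set r := localized_radius T nu in r0 *.
have [//|Dr] := leP r D; rewrite /localized_obj.
rewrite !(localized_width_stable TD) ?(ltW Dr)// lerD2l lerN2.
by rewrite ler_pM2r ?invr_gt0 ?mulr_gt0// ler_pXn2r ?nnegrE// leNgt Dr.
Qed.

(* Compare both radii with their midpoint and use the midpoint concavity of the localized width. *)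
Lemma localized_radius_close (D x y : R) : (forall t, T t -> norm2 t <= D) -> 0 < x -> 0 < y ->
  (localized_radius T x - localized_radius T y) ^+ 2 <= 2 * D ^+ 2 * x * `|x^-1 - y^-1|.
Proof.
move=> TD x0 y0; have D0 : 0 <= D by rewrite -(norm2_0 R d); exact: TD.
have [r0 rmax] := localized_radiusP x0; have [s0 smax] := localized_radiusP y0.
have rD := localized_radius_le TD x0; have sD := localized_radius_le TD y0.
set r := localized_radius T x in r0 rmax rD *; set s := localized_radius T y in s0 smax sD *.
have m0 : 0 <= (r + s) / 2 by rewrite divr_ge0// addr_ge0.
have := rmax _ m0; have := smax _ m0; have := localized_width_midpoint r0 s0.
rewrite /localized_obj !invfM; set a := x^-1; set b := y^-1.
set fm := localized_width _; set fr := localized_width r; set fs := localized_width s => h1 h2 h3.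
have a0 : 0 < a by rewrite invr_gt0.
have b0 : 0 < b by rewrite invr_gt0.
(* Adding the two maximality inequalities and twice the midpoint inequality eliminates the widths;
   then ((r + s) / 2)^2 = (r^2 + s^2) / 2 - (r - s)^2 / 4. *)
have key : (a + b) * (r - s) ^+ 2 <= 2 * ((b - a) * (r ^+ 2 - s ^+ 2)) by lra.
have le1 : (b - a) * (r ^+ 2 - s ^+ 2) <= `|a - b| * D ^+ 2.
  apply: le_trans (ler_norm _) _; rewrite normrM distrC ler_wpM2l//.
  have r2 : r ^+ 2 <= D ^+ 2 by rewrite ler_pXn2r ?nnegrE.
  have s2 : s ^+ 2 <= D ^+ 2 by rewrite ler_pXn2r ?nnegrE.
  by rewrite ler_norml; have := sqr_ge0 r; have := sqr_ge0 s; move=> *; apply/andP; split; lra.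
have le2 : a * (r - s) ^+ 2 <= (a + b) * (r - s) ^+ 2.
  by rewrite ler_wpM2r ?sqr_ge0// lerDl ltW.
have : a * (r - s) ^+ 2 <= 2 * (`|a - b| * D ^+ 2) by lra.
by rewrite ler_pdivrMl// => /le_trans; apply; rewrite le_eqVlt; apply/orP; left; apply/eqP; ring.
Qed.

(** The bound on the squared difference in [localized_radius_close] vanishes as y tends to x. *)
Lemma localized_radius_continuous x : 0 < x ->
  {for x, continuous (fun nu => localized_radius T nu)}.
Proof.
move=> x0; have [D D0 TD] := compact_norm2_bounded cT.
apply/cvgrPdist_lt => e e0.
have lim : (fun y : R => 2 * D ^+ 2 * x * `|x^-1 - y^-1|) @ x --> (0 : R).
  have : {for x, continuous (fun y : R => 2 * D ^+ 2 * x * `|x^-1 - y^-1|)}.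
    apply: continuousM; first exact: cst_continuous.
    apply: (@continuous_comp _ _ _ (fun y : R => x^-1 - y^-1) Num.norm);
      last exact: norm_continuous.
    apply: continuousB; first exact: cst_continuous.
    by apply: continuousV; [rewrite gt_eqF|exact: cvg_id].
  by rewrite /prop_for /continuous_at subrr normr0 mulr0.
near=> y; have y0 : 0 < y by near: y; exact: lt_nbhsr.
rewrite -(ltr_pXn2r (n := 2)) ?nnegrE ?(ltW e0)// real_normK ?num_real//.
apply: le_lt_trans (localized_radius_close TD x0 y0) _.
by near: y; apply: (cvgr_lt 0) => //; rewrite exprn_gt0.
Unshelve. all: by end_near. Qed.

Lemma integral_localized_radius (s : R) : 0 < s ->
  (\int[lam]_(nu in `[s, +oo[) (localized_radius T nu ^+ 2 / nu ^+ 2)%:E =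
   (2 * (fine (gaussian_width T) - localized_obj s (localized_radius T s)))%:E)%E.
Proof.
move=> s0; have [D D0 TD] := compact_norm2_bounded cT.
have Qc (x : R) : 0 < x -> {for x, continuous (fun nu => localized_radius T nu ^+ 2)}.
  by move=> x0; apply: continuousM; exact: localized_radius_continuous.
have := @envelope_integral R _ (fun x : R => localized_obj x (localized_radius T x)) Qc.
apply => //.
- move=> x y x0 y0; have [r0 _] := localized_radiusP x0.
  have [_ /(_ _ r0)] := localized_radiusP y0; rewrite /localized_obj !invfM; lra.
- by move=> x _; rewrite sqr_ge0.
(* Lower barrier: the value of the objective at the fixed radius D, where the localized width is
   already that of [T]. *)
- have lim : fine (gaussian_width T) - D ^+ 2 / 2 * x^-1 @[x --> +oo] --> fine (gaussian_width T).
    rewrite -[X in _ --> X]subr0 -[X in _ - X](mulr0 (D ^+ 2 / 2)).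
    apply: cvgB; first exact: cvg_cst.
    by apply: cvgM; [exact: cvg_cst|by apply/gtr0_cvgV0; [exact: nbhs_pinfty_gt|exact: cvg_id]].
  apply: squeeze_cvgr lim (cvg_cst _).
  near=> x; have x0 : 0 < x by near: x; exact: nbhs_pinfty_gt.
  have [r0 /(_ D D0)] := localized_radiusP x0.
  rewrite {1}/localized_obj (localized_width_stable TD (lexx D)) invfM mulrA => ->/=.
  rewrite /localized_obj lerBlDr (le_trans (localized_width_le r0))// lerDl.
  by rewrite divr_ge0 ?sqr_ge0// mulr_ge0// ltW.
Unshelve. all: by end_near. Qed.

Lemma localized_obj_bounds (s : R) : 0 < s ->
  (0 <= (localized_obj s (localized_radius T s))%:E <=
   \int[gaussd]_t (penalized_support T s (vec_of_tuple t))%:E)%E.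
Proof.
move=> s0; have [r0 /(_ 0 (lexx 0))] := localized_radiusP s0.
rewrite {1}/localized_obj expr0n/= mul0r subr0 => h; apply/andP; split.
  by rewrite lee_fin (le_trans (localized_width_ge0 (lexx 0))).
set r := localized_radius T s in r0 *.
have Ac := truncation_compact r0; have A0 := truncation0 r0.
have An : truncation r !=set0 by exists 0.
rewrite /localized_obj EFinB -localized_widthE// leeBlDr//.
have c0 : 0 <= r ^+ 2 / (2 * s) by rewrite divr_ge0 ?sqr_ge0// mulr_ge0// ltW.
have -> : (r ^+ 2 / (2 * s))%:E = (\int[gaussd]_t (r ^+ 2 / (2 * s))%:E)%E.
  by rewrite integral_cst// [X in (_ * X)%E]tuple_measure_normalT mule1.
have mZ := measurable_penalized_support s bT.
rewrite -ge0_integralD//; last first.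
  by move=> t _; rewrite lee_fin penalized_support_ge0.
rewrite gaussian_widthE; apply: ge0_le_integral => //.
- by move=> t _; rewrite lee_fin support_ge0.
- exact: measurable_support.
- exact: emeasurable_funD.
move=> t _; rewrite -EFinD lee_fin; move: (vec_of_tuple t) => g.
have [x [Ax -> _]] := support_attained g An Ac.
move: Ax; rewrite truncationE// => -[Tx xr].
have := penalized_support_ge g s0 bT Tx; rewrite lerBlDr => /le_trans; apply.
by rewrite lerD2l ler_pM2r ?invr_gt0 ?mulr_gt0// ler_pXn2r ?nnegrE ?norm2_ge0.
Qed.

End localized_width.

(** * Two-sided comparison with the Gaussian width *)

Lemma width_sandwich (R : realType) (w u v : R) (I A : \bar R) :
  0 <= v -> v <= u -> u <= w -> (I = (2 * (w - v))%:E)%E -> A = (u%:E + I)%E ->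
  (((3^-1)%:E * A <= w%:E) /\ (w%:E <= 1%:E * A))%E.
Proof.
by move=> v0 vu uw -> ->; rewrite -EFinD -!EFinM !lee_fin; split; lra.
Qed.

Theorem corollary4p1 (R : realType) :
  exists c C : R, 0 < c /\ c <= C /\
  forall (d : nat) (T : set 'rV[R]_d) (sigma : R),
    (1 <= d)%N ->
    compact T -> convex_set (T : set (convex_lmodType 'rV[R]_d)) -> T 0 ->
    0 < sigma ->
    ((c%:E * A_quantity T sigma <= gaussian_width T)%E /\
     (gaussian_width T <= C%:E * A_quantity T sigma)%E) /\
    ((c%:E * B_quantity T sigma <= gaussian_width T)%E /\
     (gaussian_width T <= C%:E * B_quantity T sigma)%E).
Proof.
exists 3^-1, 1; split; first by rewrite invr_gt0.
split; first by rewrite invf_le1// ler1n.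
move=> d T s _ cT vT T0 s0.
have bT : convex_body T by split => //; [exists 0|exact: convex_set_is_convex].
have wfin := gaussian_width_fin_num T0 cT.
have hfin := mean_penalized_fin_num bT T0 s0.
have h0 := mean_penalized_ge0 bT T0 s0.
have [hu uw] := wills_term_bounds bT T0 s0.
have /andP[f0 fh] := localized_obj_bounds bT T0 s0.
have iP := integral_mean_proj bT T0 s0.
have iR := integral_localized_radius bT T0 s0.
move: hu uw fh h0 iP iR; rewrite /A_quantity /B_quantity.
rewrite -(fineK wfin) -(fineK hfin)/= !lee_fin.
set w := fine (gaussian_width T); set h := fine (\int[_]_ _ _)%E; set u := wills_term _ _.
set f := localized_obj _ _ _ in f0 *.
move=> hu uw fh h0 iP iR; split.
  apply: (width_sandwich (u := u) (v := h)) => //.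
  (* [iP] reads integral + 2 h = 2 w, and the finite term 2 h can be cancelled. *)
  by rewrite mulrBr EFinB !EFinM -iP addeK.
by apply: (width_sandwich (u := u) (v := f)) iR _ => //; exact: le_trans hu.
Qed.
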